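(* Let $\Omega$ be a measurable subset of $\mathbb{R}^d$, let $d=d_1+d_2$ with $d_1,d_2\ge 0$ integers, let $A$ be an invertible real $d\times d$ matrix, and let $\mathcal{T}=A(\mathbb{Z}^{d_1}\times\{0\})$ be the corresponding discrete subgroup of $\mathbb{R}^d$. Then $\Omega$ tiles $\mathbb{R}^d$ with $\mathcal{T}$ if and only if $\Omega$ has pair measure $A^T(\delta_{\mathbb{Z}^{d_1}}\times\mathfrak{m}_{d_2})$, which is supported on the dual set $\mathcal{T}^*$.
   Context: $\Omega$ tiles $\mathbb{R}^d$ with $\mathcal{T}$ if $\{\Omega+t:t\in\mathcal{T}\}$ is a partition of $\mathbb{R}^d$ up to Lebesgue measure zero. For a positive Radon measure $\mu$ on $\mathbb{R}^d$, $(\Omega,\mu)$ is a spectral pair, and $\mu$ is a pair measure for $\Omega$, if for each $f\in L^1(\Omega)\cap L^2(\Omega)$ the function $\hat f(\lambda)=\int_\Omega f(x)e^{-2\pi i\lambda\cdot x}dx$ satisfies $\int|\hat f|^2d\mu<\infty$, and the map $f\mapsto\hat f$ from $L^1(\Omega)\cap L^2(\Omega)\subset L^2(\Omega)$ into $L^2(\mu)$ is isometric with dense range. $\delta_{\mathbb{Z}^{d_1}}$ is the counting measure on the subset $\mathbb{Z}^{d_1}$ of $\mathbb{R}^{d_1}$, $\mathfrak{m}_{d_2}$ is Lebesgue measure on $\mathbb{R}^{d_2}$. For an invertible real $d\times d$ matrix $A$ and a Borel measure $\mu$ on $\mathbb{R}^d$, the measure $A^T\mu$ is defined by $A^T\mu(E)=|\det(A^T)^{-1}|\,\mu(A^TE)$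 for Borel sets $E$. The dual set is $\mathcal{T}^*=\{\gamma^*\in\mathbb{R}^d:\gamma^*\cdot\gamma\in\mathbb{Z}\text{ for all }\gamma\in\mathcal{T}\}=(A^T)^{-1}(\mathbb{Z}^{d_1}\times\mathbb{R}^{d_2})$. In $\mathbb{Z}^{d_1}\times\{0\}$, $0$ means that the coordinates from $d_1+1$ to $d$ vanish. *)

(* Defs.v *)
From HB Require Import structures.
From mathcomp Require Import all_boot all_order all_algebra.
From mathcomp Require Import complex.
From mathcomp Require Import all_classical all_reals all_analysis.
From mathcomp Require Import measurable_realfun.

Set Implicit Arguments.
Unset Strict Implicit.
Unset Printing Implicit Defensive.
Import Order.TTheory GRing.Theory Num.Theory.
Import numFieldNormedType.Exports.

Local Open Scope classical_set_scope.
Local Open Scope ring_scope.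

(* Points of R^n are column vectors ['cV[R]_n]; matrices carry the Borel
   sigma-algebra of their topology. *)
Section borel_matrix.
Variables (R : realType) (m n : nat).

Definition borel_mx : set (set 'M[R]_(m, n)) := <<s open >>.

Let borel_mx0 : borel_mx set0.
Proof. exact: sigma_algebra0. Qed.

Let borel_mxC A : borel_mx A -> borel_mx (~` A).
Proof. exact: sigma_algebraC. Qed.

Let borel_mx_bigcup (F : (set 'M[R]_(m, n))^nat) :
  (forall i, borel_mx (F i)) -> borel_mx (\bigcup_i F i).
Proof. exact: sigma_algebra_bigcup. Qed.

HB.instance Definition _ := @isMeasurable.Build default_measure_display
  'M[R]_(m, n) borel_mx borel_mx0 borel_mxC borel_mx_bigcup.

Lemma open_measurable_mx (U : set 'M[R]_(m, n)) : open U -> measurable U.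
Proof. exact: sub_sigma_algebra. Qed.

Lemma measurable_coord i j :
  measurable_fun [set: 'M[R]_(m, n)] (fun M : 'M[R]_(m, n) => M i j).
Proof.
apply: (measurability _ (RGenOpens.measurableE R)).
move=> _ [_ [a [b ->]] <-]; rewrite setTI; apply: open_measurable_mx.
have /continuousP := @coord_continuous R m n i j; apply.
exact: interval_open.
Qed.

Let box (qk : 'M[rat]_(m, n) * nat) : set 'M[R]_(m, n) :=
  [set M | forall i j, `|M i j - ratr (qk.1 i j)| < qk.2.+1%:R^-1].

Let openE (U : set 'M[R]_(m, n)) : open U ->
  U = \bigcup_(qk in [set qk | box qk `<=` U]) box qk.
Proof.
move=> oU; apply/seteqP; split => [M UM|M [qk qkU]]; last exact: qkU.
have /nbhs_ballP[e /= e0 eU] : nbhs M U by exact: open_nbhs_nbhs.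
have [k ke] : exists k : nat, k.+1%:R^-1 + k.+1%:R^-1 <= e :> R.
  exists (Num.truncn (e^-1 * 2)).
  rewrite -mulr2n -[leLHS]mulr_natl ler_pdivrMr// -ler_pdivrMl//.
  by rewrite ltW// truncnS_gt.
have /choice[q Hq] : forall ij : 'I_m * 'I_n, exists q : rat,
    `|M ij.1 ij.2 - ratr q| < k.+1%:R^-1.
  move=> ij; have [q] := @rat_in_itvoo R (M ij.1 ij.2 - k.+1%:R^-1)
    (M ij.1 ij.2 + k.+1%:R^-1) ltac:(by rewrite ltrD2l gtrN// invr_gt0).
  by rewrite in_itv/= => /andP[q1 q2]; exists q; rewrite distrC ltr_distl q1.
exists (\matrix_(i, j) q (i, j), k) => [N /= Nq|i j]; last first.
  by rewrite /= mxE; exact: (Hq (i, j)).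
apply: eU; split => // i j; apply: lt_le_trans ke.
have := Nq i j; rewrite mxE => Nij; rewrite /ball/=.
rewrite -(subrK (ratr (q (i, j))) (M i j)) -addrA.
rewrite (le_lt_trans (ler_normD _ _))// ltrD//; first exact: (Hq (i, j)).
by rewrite distrC.
Qed.

Lemma measurable_fun_mx d (T : measurableType d) (f : T -> 'M[R]_(m, n)) :
  (forall i j, measurable_fun setT (fun x => f x i j)) ->
  measurable_fun setT f.
Proof.
move=> mf; apply: (@measurability _ _ _ _ setT f open) => //.
move=> _ [U oU <-]; rewrite setTI (openE oU) preimage_bigcup.
rewrite bigcup_mkcond; apply: countable_bigcupT_measurable => [|qk].
  exact: countableP.
case: ifPn => // _.
rewrite (_ : _ @^-1` _ = \bigcap_(i in [set: 'I_m]) \bigcap_(j in [set: 'I_n])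
  [set x | `|f x i j - ratr (qk.1 i j)| < qk.2.+1%:R^-1]); last first.
  by apply/seteqP; split => x /= H i; [move=> _ j _; exact: H|
    move=> j; exact: H].
apply: fin_bigcap_measurable => // i _; apply: fin_bigcap_measurable => // j _.
have := mf i j measurableT _ (@measurable_itv R
  `](ratr (qk.1 i j) - qk.2.+1%:R^-1), (ratr (qk.1 i j) + qk.2.+1%:R^-1)[).
rewrite setTI; congr measurable; apply/seteqP.
by split => x /=; rewrite in_itv/= ltr_distl.
Qed.

End borel_matrix.

(* [pushforward m f] as a measure: the proof of measurability is an argument,
   so that the measure structure can be inferred. *)
Section image_measure.
Local Open Scope ereal_scope.
Context d d' (T : measurableType d) (T' : measurableType d') (R : realType).
Variables (m : {measure set T -> \bar R}) (f : T -> T').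

Definition image_measure (mf : measurable_fun setT f) : set T' -> \bar R :=
  pushforward m f.

Variable mf : measurable_fun setT f.

Let image_measure0 : image_measure mf set0 = 0.
Proof. by rewrite /image_measure /pushforward preimage_set0 measure0. Qed.

Let image_measure_ge0 A : 0 <= image_measure mf A.
Proof. exact: measure_ge0. Qed.

Let image_measure_sigma_additive : semi_sigma_additive (image_measure mf).
Proof.
move=> F mF tF mUF; rewrite /image_measure /pushforward preimage_bigcup.
apply: measure_semi_sigma_additive.
- by move=> n; rewrite -[X in measurable X]setTI; exact: mf.
- apply/trivIsetP => /= i j _ _ ij; rewrite -preimage_setI.
  by move/trivIsetP : tF => /(_ _ _ _ _ ij) ->//; rewrite preimage_set0.
- by rewrite -preimage_bigcup -[X in measurable X]setTI; exact: mf.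
Qed.

HB.instance Definition _ := isMeasure.Build _ _ _ (image_measure mf)
  image_measure0 image_measure_ge0 image_measure_sigma_additive.

End image_measure.

Section lebesgue_step.
Local Open Scope ereal_scope.
Variables (R : realType) (n : nat).
Variable mu : {sigma_finite_measure set 'cV[R]_n -> \bar R}.

Definition cons_cV (p : measurableTypeR R * 'cV[R]_n) : 'cV[R]_n.+1 :=
  col_mx (const_mx p.1 : 'cV_1) p.2.

Lemma measurable_cons_cV : measurable_fun setT cons_cV.
Proof.
apply: measurable_fun_mx => i j; case: (splitP (i : 'I_(1 + n))) => k ik.
- rewrite (_ : (fun x => _) = fst); first exact: measurable_fst.
  apply/funext => x; rewrite (_ : i = lshift n k); last exact: val_inj.
  by apply: etrans (col_mxEu _ _ _ _) _; rewrite mxE.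
- rewrite (_ : (fun x => _) = (fun v : 'cV_n => v k j) \o snd).
    exact: measurableT_comp (measurable_coord k j) measurable_snd.
  apply/funext => x; rewrite (_ : i = rshift 1 k); last exact: val_inj.
  exact: (@col_mxEd _ 1 n 1).
Qed.

Definition lebesgue_step : set 'cV[R]_n.+1 -> \bar R :=
  image_measure (lebesgue_measure \x mu) measurable_cons_cV.

HB.instance Definition _ := Measure.on lebesgue_step.

Let lebesgue_step_sigma_finite : sigma_finite setT lebesgue_step.
Proof.
have /sigma_finiteP[F [TF ndF Foo]] := sigma_finiteT (@lebesgue_measure R).
have /sigma_finiteP[G [TG ndG Goo]] := sigma_finiteT mu.
pose u (v : 'cV[R]_n.+1) : measurableTypeR R * 'cV[R]_n :=
  (v ord0 ord0, dsubmx (v : 'cV_(1 + n))).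
have mu_ : measurable_fun setT u.
  apply: measurable_fun_pair => /=; first exact: measurable_coord.
  apply: measurable_fun_mx => i j; under eq_fun do rewrite mxE.
  exact: measurable_coord.
have consK : cancel cons_cV u.
  move=> [x v]; rewrite /u /cons_cV col_mxKd; congr (_, _).
  have -> : (ord0 : 'I_n.+1) = lshift n (ord0 : 'I_1) by exact: val_inj.
  by apply: etrans (col_mxEu _ _ _ _) _; rewrite mxE.
exists (fun k => u @^-1` (F k `*` G k)).
  rewrite -preimage_bigcup (_ : \bigcup_k (F k `*` G k) = setT)//.
  rewrite -setXTT TF TG predeqE => -[x y]; split.
    by move=> [k _ []/= ? ?]; split; exists k.
  move=> [/= [i _ Fix] [k _ Gky]]; exists (maxn i k) => //; split.
  - by move: x Fix; exact/subsetPset/ndF/leq_maxl.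
  - by move: y Gky; exact/subsetPset/ndG/leq_maxr.
move=> k; have [mF Fk] := Foo k; have [mG Gk] := Goo k; split.
  by rewrite -[X in measurable X]setTI; apply: mu_ => //; exact: measurableX.
rewrite /lebesgue_step /image_measure /pushforward -comp_preimage.
rewrite (_ : u \o cons_cV = id) ?preimage_id; last exact/funext.
apply: le_lt_trans (_ : _ <= lebesgue_measure (F k) * mu (G k)) _.
  by rewrite le_eqVlt; apply/orP; left; apply/eqP; exact: product_measure1E.
by rewrite lte_mul_pinfty// ge0_fin_numE.
Qed.

HB.instance Definition _ :=
  Measure_isSigmaFinite.Build _ _ _ lebesgue_step lebesgue_step_sigma_finite.

End lebesgue_step.

Fixpoint lebesgue_cV (R : realType) (n : nat) :
    {sigma_finite_measure set 'cV[R]_n -> \bar R} :=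
  if n is k.+1 then lebesgue_step (lebesgue_cV R k) else \d_(0 : 'cV[R]_0).

(* [lebesgue_cV] is defined on Borel sets, [lebesgue] is its completion, defined
   on the Lebesgue measurable sets. *)
Section lebesgue.
Variables (R : realType) (n : nat).

Definition lebesgue := @completed_measure_extension _ _ _ (lebesgue_cV R n).

HB.instance Definition _ := Measure.on lebesgue.

Definition lebesgue_measurable (E : set 'cV[R]_n) : Prop :=
  (lebesgue_cV R n)^*%mu.-cara.-measurable E.

End lebesgue.
Arguments lebesgue {R n}.

Section integer_points.
Local Open Scope ereal_scope.
Variable R : realType.

Definition intvec (n : nat) : set 'cV[R]_n :=
  [set z | forall i, z i ord0 \is a Num.int].
Arguments intvec : clear implicits.

Lemma measurable_intvec n : measurable (intvec n).
Proof.
rewrite (_ : intvec n = \bigcap_(i in [set: 'I_n])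
    (fun z : 'cV[R]_n => z i ord0) @^-1` \bigcup_(k : int) [set k%:~R]); last first.
  apply/seteqP; split => z /= zZ i.
    by move=> _; have /intrP[k zk] := zZ i; exists k.
  by have [k _ /= ->] := zZ i Logic.I; exact: intr_int.
apply: fin_bigcap_measurable => // i _; rewrite -[X in measurable X]setTI.
apply: measurable_coord => //.
by apply: countable_bigcupT_measurable => // k; exact: measurable_set1.
Qed.

Definition counting_intvec n : set 'cV[R]_n -> \bar R :=
  mrestr counting (@measurable_intvec n).
Arguments counting_intvec : clear implicits.

HB.instance Definition _ n := Measure.on (counting_intvec n).

Definition col_pair d1 d2 (p : 'cV[R]_d1 * 'cV[R]_d2) : 'cV[R]_(d1 + d2) :=
  col_mx p.1 p.2.

Lemma measurable_col_pair d1 d2 : measurable_fun setT (@col_pair d1 d2).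
Proof.
apply: measurable_fun_mx => i j; case: (splitP i) => k ik.
- rewrite (_ : i = lshift d2 k) /col_pair; last exact: val_inj.
  under eq_fun do rewrite col_mxEu.
  exact: measurableT_comp (measurable_coord k j) measurable_fst.
- rewrite (_ : i = rshift d1 k) /col_pair; last exact: val_inj.
  under eq_fun do rewrite col_mxEd.
  exact: measurableT_comp (measurable_coord k j) measurable_snd.
Qed.

(* The product measure, transported along R^d1 x R^d2 = R^(d1 + d2). *)
Definition intvec_lebesgue d1 d2 : set 'cV[R]_(d1 + d2) -> \bar R :=
  image_measure (counting_intvec d1 \x lebesgue_cV R d2)
    (@measurable_col_pair d1 d2).
Arguments intvec_lebesgue : clear implicits.

HB.instance Definition _ d1 d2 := Measure.on (intvec_lebesgue d1 d2).

End integer_points.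
Arguments intvec {R} n.
Arguments counting_intvec {R} n.
Arguments intvec_lebesgue {R} d1 d2.

Section transpose_measure.
Local Open Scope ereal_scope.
Variables (R : realType) (n : nat) (A : 'M[R]_n).

Definition transpose_measure (unitA : A \in unitmx)
    (mu : {measure set 'cV[R]_n -> \bar R}) (E : set 'cV[R]_n) : \bar R :=
  `|\det (invmx A^T)|%:E * mu (mulmx A^T @` E).

Variables (unitA : A \in unitmx) (mu : {measure set 'cV[R]_n -> \bar R}).

Let transpose_imageE (E : set 'cV[R]_n) :
  mulmx A^T @` E = mulmx (invmx A^T) @^-1` E.
Proof.
have unitAT : A^T \in unitmx by rewrite unitmx_tr.
apply/seteqP; split => [_ [x Ex <-]|x Ex] /=; first by rewrite mulKmx.
by exists (invmx A^T *m x) => //; rewrite mulKVmx.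
Qed.

Let measurable_mulmx (B : 'M[R]_n) :
  measurable_fun setT (mulmx B : 'cV[R]_n -> 'cV[R]_n).
Proof.
apply: measurable_fun_mx => i j; under eq_fun do rewrite mxE.
apply: measurable_sum => k; apply: measurable_funM => //.
exact: measurable_coord.
Qed.

Let transpose_measureE E : transpose_measure unitA mu E =
  mscale (`|\det (invmx A^T)|%:nng)%R (image_measure mu
    (measurable_mulmx (invmx A^T))) E.
Proof.
by rewrite /transpose_measure transpose_imageE.
Qed.

Let transpose_measure0 : transpose_measure unitA mu set0 = 0.
Proof. by rewrite transpose_measureE measure0. Qed.

Let transpose_measure_ge0 E : 0 <= transpose_measure unitA mu E.
Proof. by rewrite transpose_measureE measure_ge0. Qed.

Let transpose_measure_sigma_additive :
  semi_sigma_additive (transpose_measure unitA mu).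
Proof.
have -> : transpose_measure unitA mu =
    mscale (`|\det (invmx A^T)|%:nng)%R (image_measure mu
      (measurable_mulmx (invmx A^T))) by exact/funext/transpose_measureE.
exact: measure_semi_sigma_additive.
Qed.

HB.instance Definition _ := isMeasure.Build _ _ _ (transpose_measure unitA mu)
  transpose_measure0 transpose_measure_ge0 transpose_measure_sigma_additive.

End transpose_measure.

Section complex_functions.
Context d (T : measurableType d) (R : realType).
Implicit Types (D : set T) (f : T -> R[i]).

Definition cmeasurable_fun D f : Prop :=
  measurable_fun D (fun x => complex.Re (f x)) /\
  measurable_fun D (fun x => complex.Im (f x)).

Definition cintegral (mu : {measure set T -> \bar R}) D f : R[i] :=
  Complex (\int[mu]_(x in D) complex.Re (f x))
          (\int[mu]_(x in D) complex.Im (f x)).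

Definition cLp (mu : {measure set T -> \bar R}) D (p : nat) f : Prop :=
  cmeasurable_fun D f /\
  (\int[mu]_(x in D) (ComplexField.Normc.normc (f x) ^+ p)%:E < +oo)%E.

Definition cL2norm (mu : {measure set T -> \bar R}) D f : \bar R :=
  ((\int[mu]_(x in D) (ComplexField.Normc.normc (f x) ^+ 2)%:E) `^ 2^-1)%E.

End complex_functions.

Section spectral_pair.
Variables (R : realType) (n : nat).
Implicit Types (Omega T : set 'cV[R]_n) (mu : {measure set 'cV[R]_n -> \bar R}).

Definition dot (x y : 'cV[R]_n) : R := \sum_i x i ord0 * y i ord0.

Definition cis (t : R) : R[i] := Complex (cos t) (sin t).

Definition fourier Omega (f : 'cV[R]_n -> R[i]) (l : 'cV[R]_n) : R[i] :=
  cintegral lebesgue Omega (fun x => f x * cis (- (2 * pi * dot l x))).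

(* Functions on Omega are represented by functions on R^n whose values
   outside Omega are irrelevant. *)
Definition L1L2 Omega (f : 'cV[R]_n -> R[i]) : Prop :=
  cLp lebesgue Omega 1 f /\ cLp lebesgue Omega 2 f.

Definition radon mu : Prop :=
  (forall K : set 'cV[R]_n, compact K -> (mu K < +oo)%E) /\
  (forall E : set 'cV[R]_n, measurable E ->
     mu E = ereal_sup [set mu K | K in [set K | compact K /\ K `<=` E]]).

Definition pair_measure Omega mu : Prop :=
  [/\ radon mu,
      forall f, L1L2 Omega f -> cLp mu setT 2 (fourier Omega f),
      forall f, L1L2 Omega f ->
        cL2norm mu setT (fourier Omega f) = cL2norm lebesgue Omega f &
      forall g, cLp mu setT 2 g -> forall e : R, 0 < e ->
        exists2 f, L1L2 Omega f &
          (cL2norm mu setT (fun l => (fourier Omega f l - g l)%R) < e%:E)%E].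

Definition translate Omega (t : 'cV[R]_n) : set 'cV[R]_n :=
  [set x + t | x in Omega].

Definition tiles Omega T : Prop :=
  lebesgue.-negligible (~` \bigcup_(t in T) translate Omega t) /\
  (forall s t, T s -> T t -> s != t ->
     lebesgue.-negligible (translate Omega s `&` translate Omega t)).

Definition dual_set T : set 'cV[R]_n :=
  [set l | forall t, T t -> dot l t \is a Num.int].

Definition supported_on mu (S : set 'cV[R]_n) : Prop :=
  mu.-negligible (~` S).

End spectral_pair.

Definition lattice (R : realType) (d1 d2 : nat) (A : 'M[R]_(d1 + d2)) :
    set 'cV[R]_(d1 + d2) :=
  [set A *m col_mx z 0 | z in intvec d1].

(* Main.v *)
From HB Require Import structures.
Require Import Defs.
From mathcomp Require Import all_boot all_order all_algebra.
From mathcomp Require Import complex.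
From mathcomp Require Import all_classical all_reals all_analysis.
From mathcomp Require Import measurable_realfun.
From mathcomp Require Import ring lra.
Import Order.TTheory GRing.Theory Num.Theory.
Import numFieldNormedType.Exports.

(** A function [f] supported in [Omega] is folded along the lattice: its values
    on each coset are summed, which gives a function on a fundamental slab, the
    image under [A] of the product of the unit cube of R^d1 and of R^d2. The
    characters whose frequencies lie in the dual set are constant on cosets, so
    that on the dual set the Fourier transform of [f] is the Fourier transform
    of the folded function (Fourier series in the first [d1] variables, Fourier
    integral in the others), up to the Jacobian of [A] (transform_fold). The
    slab and the dual set, with the pair measure, satisfy a Plancherel theorem
    (plancherel_slab), and the transforms are dense (transform_dense).

    If the translates of [Omega] by the lattice do not overlap, then folding
    does not add different values and preserves the square norm: the transform
    is isometric (N2_FT_packing). If moreover the translates leave no gap, then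
    every function on the slab is folded from a function on [Omega], and the
    range is dense (FT_dense).

    Conversely, suppose that [Omega] has the pair measure. If [Omega] meets a
    translate of itself in a set of positive measure, some set [E] inside one
    fundamental cell and its translate by a lattice vector both lie in [Omega].
    The difference of their indicators is not zero, but its transform vanishes
    on the dual set, against the isometry (isometric_no_overlap). If the
    translates miss a set of positive measure, let [E] be a part of it of
    finite positive measure inside one cell. The union of [Omega] and [E] has
    translates that do not overlap, so that the transform is isometric on it;
    hence the transform of the indicator of [E] is at distance at least the
    norm of this indicator from the transforms of functions on [Omega], against
    density (dense_no_gap).

    The Plancherel theorem is built from one duality principle for unimodular
    kernels. If the transform from [Y] to [X] is isometric, then the opposite
    transform satisfies the Bessel inequality, with equality when the isometry
    has dense range (plancherel_dual). For Fourier series the isometry is the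
    orthonormality of the characters on the cube, and the density is that of
    trigonometric polynomials (approximable_square_integrable). For Fourier
    integrals both R^n and its dual are unfolded into a cube and a lattice of
    integer points; the kernel is then a product of two Fourier series kernels
    twisted by a unimodular factor that couples only one variable of each side,
    and two successive applications of the Parseval identity conclude
    (plancherel_twisted, plancherel_lebesgue).

    These arguments concern Borel functions. A Lebesgue measurable set contains
    a Borel set of full measure, and a function that is measurable for the
    completed measure agrees almost everywhere with a Borel function
    (borel_representative), which transfers tiling and the pair measure
    property from [Omega] to a Borel subset and back (tiles_coreP,
    pair_measure_coreP). The pair measure is Radon because it is finite on
    boxes and because every Borel measure on R^n that is finite on compact sets
    is inner regular (inner_regular). *)

Set Implicit Arguments.
Unset Strict Implicit.
Unset Printing Implicit Defensive.
Local Open Scope classical_set_scope.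
Local Open Scope ring_scope.
Local Notation Re := complex.Re.
Local Notation Im := complex.Im.
Local Notation normc := ComplexField.Normc.normc.
Local Notation cmeas f := (cmeasurable_fun setT f).
Local Notation conjC z := (conjc z).

(** * Complex-valued functions and their integrals *)

Section complex_facts.
Context (R : realType).
Implicit Types z w : R[i].

Lemma ReM z w : Re (z * w) = Re z * Re w - Im z * Im w.
Proof. by case: z w => [a b] [c e]. Qed.

Lemma ImM z w : Im (z * w) = Re z * Im w + Im z * Re w.
Proof. by case: z w => [a b] [c e]. Qed.

Lemma ReD z w : Re (z + w) = Re z + Re w.
Proof. by case: z w => [a b] [c e]. Qed.

Lemma ImD z w : Im (z + w) = Im z + Im w.
Proof. by case: z w => [a b] [c e]. Qed.

Lemma ReN z : Re (- z) = - Re z. Proof. by case: z. Qed.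
Lemma ImN z : Im (- z) = - Im z. Proof. by case: z. Qed.
Lemma ReJ z : Re (conjC z) = Re z. Proof. by case: z. Qed.
Lemma ImJ z : Im (conjC z) = - Im z. Proof. by case: z. Qed.
Definition cE := (ReM, ImM, ReD, ImD, ReN, ImN, ReJ, ImJ).

Lemma complex_eqP z w : Re z = Re w -> Im z = Im w -> z = w.
Proof. by case: z w => [a b] [c e] /= -> ->. Qed.

Lemma normc_ge0 z : 0 <= normc z.
Proof. by case: z => a b; exact: sqrtr_ge0. Qed.

Lemma sqr_normcE z : normc z ^+ 2 = Re z ^+ 2 + Im z ^+ 2.
Proof. by case: z => a b /=; rewrite sqr_sqrtr// addr_ge0// sqr_ge0. Qed.

Lemma mul_conjcE z : z * conjC z = Complex (normc z ^+ 2) 0.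
Proof. by apply: complex_eqP; rewrite ?sqr_normcE !cE/=; ring. Qed.

Lemma normc_conj z : normc (conjC z) = normc z.
Proof. by case: z => a b /=; rewrite sqrrN. Qed.

Lemma normc_real (r : R) : normc (Complex r 0) = `|r|.
Proof. by rewrite /= expr0n addr0 sqrtr_sqr. Qed.

Lemma normr_Re_le z : `|Re z| <= normc z.
Proof. by case: z => a b /=; rewrite -sqrtr_sqr ler_wsqrtr// lerDl sqr_ge0. Qed.

Lemma normr_Im_le z : `|Im z| <= normc z.
Proof. by case: z => a b /=; rewrite -sqrtr_sqr ler_wsqrtr// lerDr sqr_ge0. Qed.

Lemma normc_le_ReIm z : normc z <= `|Re z| + `|Im z|.
Proof.
rewrite -(@ler_pXn2r _ 2)// ?nnegrE ?normc_ge0 ?addr_ge0//.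
rewrite sqr_normcE sqrrD !real_normK ?num_real// addrAC lerDl.
by rewrite mulrn_wge0// mulr_ge0.
Qed.

Lemma sqr_normcD_le z w :
  normc (z + w) ^+ 2 <= 2 * normc z ^+ 2 + 2 * normc w ^+ 2.
Proof.
rewrite !sqr_normcE !cE.
have := sqr_ge0 (Re z - Re w); have := sqr_ge0 (Im z - Im w); lra.
Qed.

Lemma cisD (s t : R) : cis (s + t) = cis s * cis t.
Proof. by rewrite /cis cosD sinD; apply: complex_eqP; rewrite !cE/=; ring. Qed.

Lemma cisN (s : R) : cis (- s) = conjC (cis s).
Proof. by rewrite /cis cosN sinN. Qed.

Lemma cis0 : cis (0 : R) = 1.
Proof. by rewrite /cis cos0 sin0. Qed.

Lemma normc_cis (s : R) : normc (cis s) = 1.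
Proof. by rewrite /= cos2Dsin2 sqrtr1. Qed.

End complex_facts.

Section complex_measurable.
Context d (T : measurableType d) (R : realType).
Implicit Types f g : T -> R[i].

Lemma cmeas_cst (z : R[i]) : cmeas (fun _ : T => z).
Proof. by split; exact: measurable_cst. Qed.

Lemma cmeasD f g : cmeas f -> cmeas g -> cmeas (fun x => f x + g x).
Proof.
move=> [f1 f2] [g1 g2]; split; under eq_fun do rewrite ?cE;
  exact: measurable_funD.
Qed.

Lemma cmeasN f : cmeas f -> cmeas (fun x => - f x).
Proof.
by move=> [f1 f2]; split; under eq_fun do rewrite ?cE; exact: measurableT_comp.
Qed.

Lemma cmeasB f g : cmeas f -> cmeas g -> cmeas (fun x => f x - g x).
Proof. by move=> mf mg; apply: cmeasD => //; exact: cmeasN. Qed.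

Lemma cmeasJ f : cmeas f -> cmeas (fun x => conjC (f x)).
Proof.
move=> [f1 f2]; split; under eq_fun do rewrite ?cE; first by [].
exact: measurableT_comp.
Qed.

Lemma cmeasM (D : set T) f g : cmeasurable_fun D f -> cmeasurable_fun D g ->
  cmeasurable_fun D (fun x => f x * g x).
Proof.
move=> [f1 f2] [g1 g2]; split; under eq_fun do rewrite ?cE.
  by apply: measurable_funB; exact: measurable_funM.
by apply: measurable_funD; exact: measurable_funM.
Qed.

Lemma cmeas_real (h : T -> R) : measurable_fun setT h ->
  cmeas (fun x => Complex (h x) 0).
Proof. by move=> mh; split => //=. Qed.

Lemma cmeas_cis (h : T -> R) : measurable_fun setT h -> cmeas (fun x => cis (h x)).
Proof.
move=> mh; split => /=; apply: measurableT_comp => //;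
  apply: continuous_measurable_fun; [exact: continuous_cos|exact: continuous_sin].
Qed.

Lemma measurable_normc f : cmeas f -> measurable_fun setT (fun x => normc (f x)).
Proof.
move=> [f1 f2]; rewrite (_ : (fun x => _) =
  fun x => Num.sqrt (Re (f x) ^+ 2 + Im (f x) ^+ 2)).
  apply: measurableT_comp; first exact: (continuous_measurable_fun (@sqrt_continuous R)).
  by apply: measurable_funD; exact: measurable_funX.
by apply/funext => x; case: (f x).
Qed.

Lemma cmeas_comp d' (T' : measurableType d') (phi : T' -> T) f :
  measurable_fun setT phi -> cmeas f -> cmeas (f \o phi).
Proof.
by move=> mphi [f1 f2]; split;
  [exact: (measurableT_comp f1 mphi)|exact: (measurableT_comp f2 mphi)].
Qed.

Lemma cmeas_indic (D : set T) f : measurable D -> cmeas f ->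
  cmeas (fun x => Complex (\1_D x) 0 * f x).
Proof.
by move=> mD mf; apply: cmeasM => //; apply: cmeas_real; exact: measurable_indic.
Qed.

End complex_measurable.

Section complex_integral.
Context d (T : measurableType d) (R : realType).
Variable mu : {measure set T -> \bar R}.
Implicit Types f g : T -> R[i].

Definition cint f := cmeas f /\ (\int[mu]_x (normc (f x))%:E < +oo)%E.
Local Notation I f := (cintegral mu setT f).

Lemma le_integral_real (g h : T -> R) :
  measurable_fun setT g -> measurable_fun setT h ->
  (forall x, 0 <= g x) -> (forall x, g x <= h x) ->
  (\int[mu]_x (g x)%:E <= \int[mu]_x (h x)%:E)%E.
Proof.
move=> mg mh g0 gh; apply: (ge0_le_integral mu measurableT).
- by move=> x _; rewrite lee_fin.
- exact/measurable_EFinP.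
- exact/measurable_EFinP.
- by move=> x _; rewrite lee_fin.
Qed.

Lemma integral_real_lty (h : T -> R) (g : T -> R) :
  measurable_fun setT h -> measurable_fun setT g ->
  (forall x, `|h x| <= g x) ->
  (\int[mu]_x (g x)%:E < +oo)%E -> mu.-integrable setT (EFin \o h).
Proof.
move=> mh mg hg goo; apply/integrableP; split; first exact/measurable_EFinP.
apply: le_lt_trans goo; apply: le_integral_real => //.
exact: measurableT_comp.
Qed.

Lemma cint_Re f : cint f -> mu.-integrable setT (EFin \o (fun x => Re (f x))).
Proof.
move=> [mf foo]; apply: integral_real_lty foo; first by case: mf.
  exact: measurable_normc.
by move=> x; exact: normr_Re_le.
Qed.

Lemma cint_Im f : cint f -> mu.-integrable setT (EFin \o (fun x => Im (f x))).
Proof.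
move=> [mf foo]; apply: integral_real_lty foo; first by case: mf.
  exact: measurable_normc.
by move=> x; exact: normr_Im_le.
Qed.

Lemma cint_ReIm f : mu.-integrable setT (EFin \o (fun x => Re (f x))) ->
  mu.-integrable setT (EFin \o (fun x => Im (f x))) -> cint f.
Proof.
move=> /integrableP[mr ir] /integrableP[mi ii].
have mf : cmeas f by split; exact/measurable_EFinP.
split=> //; have : (\int[mu]_x (`|(Re (f x))%:E| + `|(Im (f x))%:E|) < +oo)%E.
  by rewrite ge0_integralD//; [exact: lte_add_pinfty|
    exact: measurableT_comp|exact: measurableT_comp].
apply: le_lt_trans; apply: le_integral_real => //.
- exact: measurable_normc.
- by apply: measurable_funD; apply: measurableT_comp => //; case: mf.
- by move=> x; exact: normc_ge0.
- by move=> x; exact: normc_le_ReIm.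
Qed.

Lemma le_cint f (g : T -> R) : cmeas f -> measurable_fun setT g ->
  (forall x, normc (f x) <= g x) -> (\int[mu]_x (g x)%:E < +oo)%E -> cint f.
Proof.
move=> mf mg fg goo; split => //; apply: le_lt_trans goo.
apply: le_integral_real => //; first exact: measurable_normc.
by move=> x; exact: normc_ge0.
Qed.

Lemma cintD f g : cint f -> cint g -> cint (fun x => f x + g x).
Proof.
move=> fi gi; apply: cint_ReIm.
  have := integrableD measurableT (cint_Re fi) (cint_Re gi).
  by apply: eq_integrable => // x _ /=; rewrite cE.
have := integrableD measurableT (cint_Im fi) (cint_Im gi).
by apply: eq_integrable => // x _ /=; rewrite cE.
Qed.

Lemma cintM_bounded f g (M : R) : cint f -> cmeas g ->
  (forall x, normc (g x) <= M) -> cint (fun x => f x * g x).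
Proof.
move=> [mf foo] mg gM; apply: (@le_cint _ (fun x => normc (f x) * `|M|)).
- exact: cmeasM.
- by apply: measurable_funM => //; exact: measurable_normc.
- move=> x; rewrite ComplexField.Normc.normcM ler_wpM2l// ?normc_ge0//.
  by rewrite (le_trans (gM x))// ler_norm.
under eq_integral do rewrite EFinM.
rewrite ge0_integralZr//.
- by rewrite muleC lte_mul_pinfty// lee_fin.
- by apply/measurable_EFinP; exact: measurable_normc.
- by move=> x _; rewrite lee_fin normc_ge0.
Qed.

Lemma cintZl (z : R[i]) f : cint f -> cint (fun x => z * f x).
Proof.
move=> fi; under eq_fun do rewrite mulrC.
exact: (cintM_bounded fi (cmeas_cst _ z) (fun=> lexx _)).
Qed.

Lemma cintN f : cint f -> cint (fun x => - f x).
Proof. by move=> /(cintZl (-1)); under eq_fun do rewrite mulN1r. Qed.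

Lemma cintB f g : cint f -> cint g -> cint (fun x => f x - g x).
Proof. by move=> fi gi; apply: cintD => //; exact: cintN. Qed.

Lemma cintJ f : cint f -> cint (fun x => conjC (f x)).
Proof.
move=> [mf foo]; split; first exact: cmeasJ.
by under eq_integral do rewrite normc_conj.
Qed.

Lemma cintegralD f g : cint f -> cint g -> I (fun x => f x + g x) = I f + I g.
Proof.
move=> fi gi; apply: complex_eqP; rewrite cE /=.
  rewrite -RintegralD//; [|exact: cint_Re|exact: cint_Re].
  by apply: eq_Rintegral => x _; rewrite cE.
rewrite -RintegralD//; [|exact: cint_Im|exact: cint_Im].
by apply: eq_Rintegral => x _; rewrite cE.
Qed.

Lemma cintegralZl (z : R[i]) f : cint f -> I (fun x => z * f x) = z * I f.
Proof.
move=> fi; have [fr fI] := (cint_Re fi, cint_Im fi).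
have Zr (r : R) h : mu.-integrable setT (EFin \o h) ->
    mu.-integrable setT (EFin \o (fun x => r * h x)) by exact: integrableZl.
apply: complex_eqP; rewrite cE /=.
  rewrite -!RintegralZl// -RintegralB//; [|exact: Zr|exact: Zr].
  by apply: eq_Rintegral => x _; rewrite cE.
rewrite -!RintegralZl// -RintegralD//; [|exact: Zr|exact: Zr].
by apply: eq_Rintegral => x _; rewrite cE.
Qed.

Lemma cintegralN f : cint f -> I (fun x => - f x) = - I f.
Proof.
move=> fi; rewrite -mulN1r -cintegralZl//.
by congr (I _); apply/funext => x; rewrite mulN1r.
Qed.

Lemma cintegralB f g : cint f -> cint g -> I (fun x => f x - g x) = I f - I g.
Proof. by move=> fi gi; rewrite cintegralD ?cintegralN//; exact: cintN. Qed.

Lemma cintegralJ f : cint f -> I (fun x => conjC (f x)) = conjC (I f).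
Proof.
move=> fi; apply: complex_eqP; rewrite cE /=.
  by apply: eq_Rintegral => x _; rewrite cE.
rewrite -mulN1r -RintegralZl//; last exact: cint_Im.
by apply: eq_Rintegral => x _; rewrite cE mulN1r.
Qed.

Lemma ae_eq_cintegral f g : cmeas f -> cmeas g ->
  {ae mu, forall x, f x = g x} -> I f = I g.
Proof.
move=> [fr fi] [gr gi] fg; apply: complex_eqP => /=; congr fine;
  apply: ae_eq_integral => //=; try exact/measurable_EFinP;
  by apply: filterS fg => x /= -> _.
Qed.

(** With [z] the integral of [f], the integral of [conjC z * f] is the real
    number [normc z ^+ 2], and real integrals are monotone. *)
Lemma le_normc_cintegral f : cint f ->
  ((normc (I f))%:E <= \int[mu]_x (normc (f x))%:E)%E.
Proof.
move=> fi; have [z zE] : exists z, z = I f by exists (I f).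
rewrite -zE.
have [z0|z0] := eqVneq (normc z) 0.
  by rewrite z0 integral_ge0// => x _; rewrite lee_fin normc_ge0.
have zp : 0 < normc z by rewrite lt_neqAle eq_sym z0 normc_ge0.
have fin : (\int[mu]_x (normc (f x))%:E)%E \is a fin_num.
  rewrite ge0_fin_numE; first exact: fi.2.
  by apply: integral_ge0 => x _; rewrite lee_fin normc_ge0.
rewrite -[leRHS]fineK// lee_fin -(ler_pM2l zp) -expr2.
have -> : normc z ^+ 2 = Re (I (fun x => conjC z * f x)).
  by rewrite cintegralZl// -zE mulrC mul_conjcE.
rewrite /= -[X in _ <= _ * X]/(\int[mu]_x normc (f x)).
rewrite -RintegralZl//; last first.
  apply/integrableP; split.
    by apply/measurable_EFinP/measurable_normc; exact: fi.1.
  rewrite (le_lt_trans _ fi.2)//; under eq_integral do rewrite abse_EFin.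
  by under eq_integral do rewrite ger0_norm ?normc_ge0//.
apply: le_Rintegral => //.
- exact: (cint_Re (cintZl _ fi)).
- apply: (@integral_real_lty _ (fun x => normc z * normc (f x))).
  + by apply: measurable_funM => //; apply: measurable_normc; exact: fi.1.
  + by apply: measurable_funM => //; apply: measurable_normc; exact: fi.1.
  + by move=> x; rewrite ger0_norm// mulr_ge0// normc_ge0.
  + have := (cintZl z fi).2.
    by under eq_integral do rewrite ComplexField.Normc.normcM.
- move=> x _; rewrite (le_trans (ler_norm _))// (le_trans (normr_Re_le _))//.
  by rewrite ComplexField.Normc.normcM normc_conj.
Qed.

End complex_integral.

(** * Integration over product spaces *)

Section product_measure.
Local Open Scope ereal_scope.
Context d1 d2 (X : measurableType d1) (Y : measurableType d2) (R : realType).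
Variables (m1 : {sigma_finite_measure set X -> \bar R}).
Variables (m2 : {sigma_finite_measure set Y -> \bar R}).

(** A copy of the product measure that carries a sigma-finite structure, so
    that products can be iterated and Fubini's theorem applied to them. *)
Definition prodm : set (X * Y) -> \bar R := m1 \x m2.

HB.instance Definition _ := Measure.on prodm.

Let prodm_sigma_finite : sigma_finite setT prodm.
Proof.
have /sigma_finiteP[F [TF ndF Foo]] := sigma_finiteT m1.
have /sigma_finiteP[G [TG ndG Goo]] := sigma_finiteT m2.
exists (fun n => F n `*` G n).
 rewrite -setXTT TF TG predeqE => -[x y]; split.
    move=> [/= [n _ Fnx] [k _ Gky]]; exists (maxn n k) => //; split.
    - by move: x Fnx; exact/subsetPset/ndF/leq_maxl.
    - by move: y Gky; exact/subsetPset/ndG/leq_maxr.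
  by move=> [n _ []/= ? ?]; split; exists n.
move=> k; have [mF Fk] := Foo k; have [mG Gk] := Goo k.
split; first exact: measurableX.
by rewrite /prodm product_measure1E// lte_mul_pinfty// ge0_fin_numE.
Qed.

HB.instance Definition _ :=
  Measure_isSigmaFinite.Build _ _ _ prodm prodm_sigma_finite.

Lemma prodm_tonelli1 (f : X * Y -> \bar R) : measurable_fun setT f ->
  (forall x, 0 <= f x) ->
  \int[prodm]_z f z = \int[m1]_x \int[m2]_y f (x, y).
Proof. exact: fubini_tonelli1. Qed.

Lemma prodm_tonelli2 (f : X * Y -> \bar R) : measurable_fun setT f ->
  (forall x, 0 <= f x) ->
  \int[prodm]_z f z = \int[m2]_y \int[m1]_x f (x, y).
Proof. exact: fubini_tonelli2. Qed.

End product_measure.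

Section complex_fubini.
Context d1 d2 (X : measurableType d1) (Y : measurableType d2) (R : realType).
Variables (m1 : {sigma_finite_measure set X -> \bar R}).
Variables (m2 : {sigma_finite_measure set Y -> \bar R}).

Lemma measurable_Rintegral_snd (h : X * Y -> R) : measurable_fun setT h ->
  measurable_fun setT (fun x => \int[m2]_y h (x, y)).
Proof.
move=> /measurable_EFinP mh; rewrite /Rintegral; apply: measurableT_comp => //.
rewrite (_ : (fun x => _) = (fubini_F m2 ((EFin \o h)^\+)%E \-
    fubini_F m2 ((EFin \o h)^\-)%E)%E); last first.
  apply/funext => x; rewrite integralE; congr (_ - _)%E; apply: eq_integral => y _.
    by rewrite !funeposE.
  by rewrite !funenegE.
apply: emeasurable_funB; apply: measurable_fun_fubini_tonelli_F => //.
- exact: measurable_funepos.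
- exact: measurable_funeneg.
Qed.

Lemma measurable_Rintegral_fst (h : X * Y -> R) : measurable_fun setT h ->
  measurable_fun setT (fun y => \int[m1]_x h (x, y)).
Proof.
move=> /measurable_EFinP mh; rewrite /Rintegral; apply: measurableT_comp => //.
rewrite (_ : (fun x => _) = (fubini_G m1 ((EFin \o h)^\+)%E \-
    fubini_G m1 ((EFin \o h)^\-)%E)%E); last first.
  apply/funext => y; rewrite integralE; congr (_ - _)%E; apply: eq_integral => x _.
    by rewrite !funeposE.
  by rewrite !funenegE.
apply: emeasurable_funB; apply: measurable_fun_fubini_tonelli_G => //.
- exact: measurable_funepos.
- exact: measurable_funeneg.
Qed.

Lemma cmeas_integral_snd (F : X * Y -> R[i]) : cmeas F ->
  cmeas (fun x => cintegral m2 setT (fun y => F (x, y))).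
Proof.
by move=> [mr mi]; split; [exact: (measurable_Rintegral_snd mr)|
  exact: (measurable_Rintegral_snd mi)].
Qed.

Lemma cmeas_integral_fst (F : X * Y -> R[i]) : cmeas F ->
  cmeas (fun y => cintegral m1 setT (fun x => F (x, y))).
Proof.
by move=> [mr mi]; split; [exact: (measurable_Rintegral_fst mr)|
  exact: (measurable_Rintegral_fst mi)].
Qed.

Lemma cmeas_snd (F : X * Y -> R[i]) x : cmeas F -> cmeas (fun y => F (x, y)).
Proof. exact: (cmeas_comp (pair1_measurable x)). Qed.

Lemma cmeas_fst (F : X * Y -> R[i]) y : cmeas F -> cmeas (fun x => F (x, y)).
Proof. exact: (cmeas_comp (pair2_measurable y)). Qed.

Lemma cint_prod (F : X * Y -> R[i]) : cmeas F ->
  (\int[m1]_x \int[m2]_y (normc (F (x, y)))%:E < +oo)%E -> cint (prodm m1 m2) F.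
Proof.
move=> mF Foo; split => //; rewrite prodm_tonelli1//.
  by apply/measurable_EFinP; exact: measurable_normc.
by move=> x; rewrite lee_fin normc_ge0.
Qed.

Lemma integrable_snd_ae (h : X * Y -> R) :
  (prodm m1 m2).-integrable setT (EFin \o h) ->
  {ae m1, forall x, m2.-integrable setT (EFin \o (fun y => h (x, y)))}.
Proof. exact: ae_integrable1. Qed.

Lemma cint_snd_ae (F : X * Y -> R[i]) : cint (prodm m1 m2) F ->
  {ae m1, forall x, cint m2 (fun y => F (x, y))}.
Proof.
move=> Fi; have := integrable_snd_ae (cint_Re Fi).
by have := integrable_snd_ae (cint_Im Fi); apply: filterS2 => x; move=> *;
  exact: cint_ReIm.
Qed.

Lemma Rintegral_fubini1 (h : X * Y -> R) :
  (prodm m1 m2).-integrable setT (EFin \o h) ->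
  \int[m1]_x \int[m2]_y h (x, y) = \int[(prodm m1 m2)]_z h z.
Proof.
move=> hi; rewrite /Rintegral -(integral12_prod_meas1 hi); congr fine.
have Fi := integrable_fubini_F hi.
have mh : measurable_fun setT h.
  by apply/measurable_EFinP; exact: measurable_int hi.
apply: ae_eq_integral => //.
- by apply/measurable_EFinP; exact: measurable_Rintegral_snd.
- exact: measurable_int Fi.
- by have := integrable_ae measurableT Fi; apply: filterS => x /= /(_ Logic.I) fin _;
    rewrite fineK.
Qed.

Lemma Rintegral_fubini2 (h : X * Y -> R) :
  (prodm m1 m2).-integrable setT (EFin \o h) ->
  \int[m2]_y \int[m1]_x h (x, y) = \int[(prodm m1 m2)]_z h z.
Proof.
move=> hi; rewrite /Rintegral -(integral21_prod_meas1 hi); congr fine.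
have mh : measurable_fun setT h.
  by apply/measurable_EFinP; exact: measurable_int hi.
apply: ae_eq_integral => //.
- by apply/measurable_EFinP; exact: measurable_Rintegral_fst.
- exact: (measurable_fubini_G hi).
- by have := ae_integrable2 hi; apply: filterS => x /= /(integrable_fin_num measurableT) fin _;
    rewrite fineK.
Qed.

Lemma cintegral_prod_snd (F : X * Y -> R[i]) : cint (prodm m1 m2) F ->
  cintegral m1 setT (fun x => cintegral m2 setT (fun y => F (x, y))) =
  cintegral (prodm m1 m2) setT F.
Proof.
move=> Fi; apply: complex_eqP => /=.
- exact: (Rintegral_fubini1 (cint_Re Fi)).
- exact: (Rintegral_fubini1 (cint_Im Fi)).
Qed.

Lemma cintegral_prod_fst (F : X * Y -> R[i]) : cint (prodm m1 m2) F ->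
  cintegral m2 setT (fun y => cintegral m1 setT (fun x => F (x, y))) =
  cintegral (prodm m1 m2) setT F.
Proof.
move=> Fi; apply: complex_eqP => /=.
- exact: (Rintegral_fubini2 (cint_Re Fi)).
- exact: (Rintegral_fubini2 (cint_Im Fi)).
Qed.

Lemma cintegral_fubini (F : X * Y -> R[i]) : cint (prodm m1 m2) F ->
  cintegral m1 setT (fun x => cintegral m2 setT (fun y => F (x, y))) =
  cintegral m2 setT (fun y => cintegral m1 setT (fun x => F (x, y))).
Proof. by move=> Fi; rewrite cintegral_prod_snd// cintegral_prod_fst. Qed.

End complex_fubini.

(** * The squared norm of square integrable functions *)

Definition N2 d (T : measurableType d) (R : realType)
    (mu : {measure set T -> \bar R}) (f : T -> R[i]) : \bar R :=
  (\int[mu]_x (normc (f x) ^+ 2)%:E)%E.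

Section square_norm.
Context d (T : measurableType d) (R : realType).
Variable mu : {measure set T -> \bar R}.
Implicit Types f g : T -> R[i].
Local Notation N2 := (N2 mu).
Local Notation I f := (cintegral mu setT f).

Lemma measurable_sqr_normc f : cmeas f ->
  measurable_fun setT (fun x => normc (f x) ^+ 2).
Proof. by move=> mf; apply: measurable_funX; exact: measurable_normc. Qed.

Lemma N2_ge0 f : (0 <= N2 f)%E.
Proof. by apply: integral_ge0 => x _; rewrite lee_fin sqr_ge0. Qed.

Lemma N2_fineK f : (N2 f < +oo)%E -> ((fine (N2 f))%:E = N2 f)%E.
Proof. by move=> foo; rewrite fineK// ge0_fin_numE// N2_ge0. Qed.

Lemma eq_N2 f g : (forall x, normc (f x) = normc (g x)) -> N2 f = N2 g.
Proof. by move=> fg; apply: eq_integral => x _; rewrite fg. Qed.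

Lemma ae_eq_N2 f g : cmeas f -> cmeas g -> {ae mu, forall x, f x = g x} ->
  N2 f = N2 g.
Proof.
move=> mf mg fg; apply: ge0_ae_eq_integral => //.
- by apply/measurable_EFinP; exact: measurable_sqr_normc.
- by apply/measurable_EFinP; exact: measurable_sqr_normc.
- by move=> x _; rewrite lee_fin sqr_ge0.
- by move=> x _; rewrite lee_fin sqr_ge0.
- by apply: filterS fg => x /= -> _.
Qed.

Lemma le_N2 f g : cmeas f -> cmeas g -> (forall x, normc (f x) <= normc (g x)) ->
  (N2 f <= N2 g)%E.
Proof.
move=> mf mg fg; apply: le_integral_real; [exact: measurable_sqr_normc|
  exact: measurable_sqr_normc|by move=> x; rewrite sqr_ge0|move=> x].
by rewrite ler_pXn2r// ?nnegrE ?normc_ge0.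
Qed.

Lemma N2Z (z : R[i]) f : cmeas f ->
  N2 (fun x => z * f x) = ((normc z ^+ 2)%:E * N2 f)%E.
Proof.
move=> mf; rewrite -ge0_integralZl//.
- by apply: eq_integral => x _; rewrite ComplexField.Normc.normcM exprMn EFinM.
- by apply/measurable_EFinP; exact: measurable_sqr_normc.
- by move=> x _; rewrite lee_fin sqr_ge0.
- by rewrite lee_fin sqr_ge0.
Qed.

Lemma N2D_le f g : cmeas f -> cmeas g ->
  (N2 (fun x => f x + g x)%R <= 2%:E * N2 f + 2%:E * N2 g)%E.
Proof.
move=> mf mg; rewrite -!ge0_integralZl//; do 1?[
  by apply/measurable_EFinP; exact: measurable_sqr_normc|
  by move=> x _; rewrite lee_fin sqr_ge0|by rewrite lee_fin].
have m2 (h : T -> R[i]) : cmeas h ->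
    measurable_fun setT (fun x => 2 * normc (h x) ^+ 2).
  by move=> mh; apply: measurable_funM => //; exact: measurable_sqr_normc.
rewrite -ge0_integralD//; do 1?[
  by apply/measurable_EFinP; exact: m2|
  by move=> x _; rewrite -EFinM lee_fin mulr_ge0// sqr_ge0].
under [leRHS]eq_integral do rewrite -!EFinM -EFinD.
apply: le_integral_real.
- by apply: measurable_sqr_normc; exact: cmeasD.
- by apply: measurable_funD; exact: m2.
- by move=> x; rewrite sqr_ge0.
- by move=> x; exact: sqr_normcD_le.
Qed.

Lemma N2D_lty f g : cmeas f -> cmeas g -> (N2 f < +oo -> N2 g < +oo ->
  N2 (fun x => f x + g x)%R < +oo)%E.
Proof.
move=> mf mg foo goo; apply: le_lt_trans (N2D_le mf mg) _.
by apply: lte_add_pinfty; apply: lte_mul_pinfty.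
Qed.

Lemma N2N f : N2 (fun x => - f x) = N2 f.
Proof. by apply: eq_N2 => x; case: (f x) => a b /=; rewrite !sqrrN. Qed.

Lemma cint_mul_conj f g : cmeas f -> cmeas g -> (N2 f < +oo -> N2 g < +oo)%E ->
  (N2 f < +oo)%E -> cint mu (fun x => f x * conjC (g x)).
Proof.
move=> mf mg goo foo; have {}goo := goo foo.
apply: (@le_cint _ _ _ _ _ (fun x => normc (f x) ^+ 2 + normc (g x) ^+ 2)).
- by apply: cmeasM => //; exact: cmeasJ.
- by apply: measurable_funD; exact: measurable_sqr_normc.
- move=> x; rewrite ComplexField.Normc.normcM normc_conj.
  have := sqr_ge0 (normc (f x) - normc (g x)).
  have := sqr_ge0 (normc (f x)); have := sqr_ge0 (normc (g x)); nra.
under eq_integral do rewrite EFinD.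
rewrite ge0_integralD//; do 1?[
  by apply/measurable_EFinP; exact: measurable_sqr_normc|
  by move=> x _; rewrite lee_fin sqr_ge0].
exact: lte_add_pinfty.
Qed.

(** The polarization identity: isometry and approximation statements are turned
    into statements about the real part of a pairing. *)
Lemma N2B f g : cmeas f -> cmeas g -> (N2 f < +oo)%E -> (N2 g < +oo)%E ->
  N2 (fun x => f x - g x) =
  (fine (N2 f) + fine (N2 g) - 2 * Re (I (fun x => f x * conjC (g x))))%:E.
Proof.
move=> mf mg foo goo.
have fi : mu.-integrable setT (EFin \o (fun x => normc (f x) ^+ 2)).
  apply: integral_real_lty foo; do ?exact: measurable_sqr_normc.
  by move=> x; rewrite ger0_norm// sqr_ge0.
have gi : mu.-integrable setT (EFin \o (fun x => normc (g x) ^+ 2)).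
  apply: integral_real_lty goo; do ?exact: measurable_sqr_normc.
  by move=> x; rewrite ger0_norm// sqr_ge0.
have fgi := cint_Re (cint_mul_conj mf mg (fun=> goo) foo).
have fgi2 : mu.-integrable setT (EFin \o (fun x => 2 * Re (f x * conjC (g x)))).
  exact: (integrableZl measurableT 2 fgi).
have fgD : mu.-integrable setT
    (EFin \o (fun x => normc (f x) ^+ 2 + normc (g x) ^+ 2)).
  exact: (integrableD measurableT fi gi).
rewrite /= -RintegralZl//= EFinB EFinD.
rewrite /Rintegral !fineK; do 1?exact: integrable_fin_num.
rewrite -integralD_EFin// -integralB_EFin//.
apply: eq_integral => x _ /=; rewrite -EFinB !sqr_normcE !cE; congr EFin.
ring.
Qed.

Lemma N2_indic (D : set T) f : measurable D ->
  N2 (fun x => Complex (\1_D x) 0 * f x) = (\int[mu]_(x in D) (normc (f x) ^+ 2)%:E)%E.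
Proof.
move=> mD; rewrite [RHS]integral_mkcond; apply: eq_integral => x _.
rewrite patchE ComplexField.Normc.normcM normc_real indicE.
by case: (x \in D); rewrite ?normr1 ?mul1r// normr0 mul0r expr0n.
Qed.

(** Square integrable functions are approximated by their restrictions to sets
    of finite measure, on which transforms of bounded functions are integrable
    again. *)
Lemma N2_exhaust (F : (set T)^nat) f (e : R) : setT = \bigcup_i F i ->
  nondecreasing_seq F -> (forall i, measurable (F i)) -> cmeas f ->
  (N2 f < +oo)%E -> 0 < e ->
  exists i, (N2 f < N2 (fun x => Complex (\1_(F i) x) 0 * f x)%R + e%:E)%E.
Proof.
move=> FT ndF mF mf foo e0.
have := @ge0_nondecreasing_set_cvg_integral _ _ _ F
  (fun x => (normc (f x) ^+ 2)%:E) mu ndF mF _ _; rewrite -FT -/(N2 f) => cvgF.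
have {}cvgF : ((\int[mu]_(x in F i) (normc (f x) ^+ 2)%:E)%E @[i --> \oo] --> N2 f)%E.
  apply: cvgF => [i|i x _]; last by rewrite lee_fin sqr_ge0.
  by apply/measurable_EFinP/measurable_funTS; exact: measurable_sqr_normc.
have : (N2 f - e%:E < N2 f)%E.
  by rewrite -N2_fineK// -EFinB lte_fin gtrBl.
move=> lt; have [i _ Hi] : \forall i \near \oo,
    (N2 f - e%:E < \int[mu]_(x in F i) (normc (f x) ^+ 2)%:E)%E.
  apply: (cvgF (fun y => N2 f - e%:E < y)%E).
  exact: open_ereal_gt'.
exists i; rewrite N2_indic//.
by have := Hi i (leqnn i); rewrite lteBlDr.
Qed.

End square_norm.

(** * Transforms by a unimodular kernel and their duality *)

Section transform.
Context d1 d2 (X : measurableType d1) (Y : measurableType d2) (R : realType).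

Definition transform (mX : {measure set X -> \bar R}) (E : X * Y -> R[i])
    (f : X -> R[i]) (y : Y) : R[i] :=
  cintegral mX setT (fun x => f x * E (x, y)).

Definition plancherel (mX : {measure set X -> \bar R})
    (mY : {measure set Y -> \bar R}) (E : X * Y -> R[i]) : Prop :=
  forall f, cint mX f -> (N2 mX f < +oo)%E -> N2 mY (transform mX E f) = N2 mX f.

Definition unimodular (E : X * Y -> R[i]) := forall p, normc (E p) = 1.

(** The kernel of the inverse transform. *)
Definition dual_kernel (E : X * Y -> R[i]) : Y * X -> R[i] :=
  fun p => conjC (E (p.2, p.1)).

End transform.

Section transform_theory.
Context d1 d2 (X : measurableType d1) (Y : measurableType d2) (R : realType).
Variables (mX : {sigma_finite_measure set X -> \bar R}).
Variables (mY : {sigma_finite_measure set Y -> \bar R}).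
Variable E : X * Y -> R[i].
Hypotheses (mE : cmeas E) (uE : unimodular E).

Lemma cmeas_transform f : cmeas f -> cmeas (transform mX E f).
Proof.
move=> mf; apply: (@cmeas_integral_fst _ _ _ _ _ mX (fun p => f p.1 * E p)).
by apply: cmeasM => //; exact: (cmeas_comp measurable_fst).
Qed.

Lemma normc_transform_le f y : cint mX f ->
  ((normc (transform mX E f y))%:E <= \int[mX]_x (normc (f x))%:E)%E.
Proof.
move=> fi; apply: le_trans (le_normc_cintegral _) _; last first.
  rewrite le_eqVlt; apply/orP; left; apply/eqP; apply: eq_integral => x _.
  by rewrite ComplexField.Normc.normcM uE mulr1.
apply: (@cintM_bounded _ _ _ _ _ _ 1) => //; first exact: cmeas_fst.
by move=> x; rewrite uE.
Qed.

Lemma normc_transform_bounded f : cint mX f ->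
  exists2 M : R, 0 <= M & forall y, normc (transform mX E f y) <= M.
Proof.
move=> fi; exists (fine (\int[mX]_x (normc (f x))%:E)%E).
  by apply: fine_ge0; apply: integral_ge0 => x _; rewrite lee_fin normc_ge0.
move=> y; rewrite -lee_fin fineK ?normc_transform_le// ge0_fin_numE ?fi.2//.
by apply: integral_ge0 => x _; rewrite lee_fin normc_ge0.
Qed.

Lemma cmeas_dual_kernel : cmeas (dual_kernel E).
Proof.
apply: cmeasJ; apply: (cmeas_comp (phi := fun p : Y * X => (p.2, p.1))) mE.
by apply: measurable_fun_pair.
Qed.

Lemma unimodular_dual_kernel : unimodular (dual_kernel E).
Proof. by move=> p; rewrite normc_conj. Qed.

(** Fubini's theorem: the transform by the dual kernel is the adjoint of the
    transform by the kernel. *)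
Lemma transform_pairing f a : cint mX f -> cint mY a ->
  cintegral mX setT (fun x => f x * conjC (transform mY (dual_kernel E) a x)) =
  cintegral mY setT (fun y => transform mX E f y * conjC (a y)).
Proof.
move=> fi ai; pose F p := f p.1 * E p * conjC (a p.2).
have mF : cmeas F.
  apply: cmeasM; first by apply: cmeasM => //; exact: (cmeas_comp measurable_fst fi.1).
  by apply: cmeasJ; exact: (cmeas_comp measurable_snd ai.1).
have Fi : cint (prodm mX mY) F.
  apply: cint_prod => //.
  have -> : (\int[mX]_x \int[mY]_y (normc (F (x, y)))%:E =
      (\int[mX]_x (normc (f x))%:E) * \int[mY]_y (normc (a y))%:E)%E.
    rewrite -ge0_integralZr//.
    - apply: eq_integral => x _; rewrite -ge0_integralZl//.
      + by apply: eq_integral => y _; rewrite -EFinM !ComplexField.Normc.normcM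
          uE mulr1 normc_conj.
      + by apply/measurable_EFinP; apply: measurable_normc; exact: ai.1.
      + by move=> y _; rewrite lee_fin normc_ge0.
      + by rewrite lee_fin normc_ge0.
    - by apply/measurable_EFinP; apply: measurable_normc; exact: fi.1.
    - by move=> x _; rewrite lee_fin normc_ge0.
    - by apply: integral_ge0 => y _; rewrite lee_fin normc_ge0.
  apply: lte_mul_pinfty; last exact: ai.2.
    by apply: integral_ge0 => y _; rewrite lee_fin normc_ge0.
  rewrite ge0_fin_numE ?fi.2//.
  by apply: integral_ge0 => y _; rewrite lee_fin normc_ge0.
transitivity (cintegral mX setT (fun x => cintegral mY setT (fun y => F (x, y)))).
  congr cintegral; apply/funext => x; rewrite /transform.
  have aEi : cint mY (fun y => a y * dual_kernel E (y, x)).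
    apply: (@cintM_bounded _ _ _ _ _ _ 1) => //.
      by apply: cmeas_fst; exact: cmeas_dual_kernel.
    by move=> y; rewrite unimodular_dual_kernel.
  rewrite -cintegralJ// -cintegralZl; last exact: cintJ.
  congr cintegral; apply/funext => y.
  rewrite /F /dual_kernel/= rmorphM/= conjcK; ring.
rewrite (cintegral_fubini Fi); congr cintegral; apply/funext => y.
rewrite /transform mulrC -cintegralZl.
  by congr cintegral; apply/funext => x; rewrite /F/= mulrC.
apply: (@cintM_bounded _ _ _ _ _ _ 1) => //; first exact: cmeas_fst.
by move=> x; rewrite uE.
Qed.

End transform_theory.

Section duality.
Context d1 d2 (X : measurableType d1) (Y : measurableType d2) (R : realType).
Variables (mX : {sigma_finite_measure set X -> \bar R}).
Variables (mY : {sigma_finite_measure set Y -> \bar R}).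
Variable E : X * Y -> R[i].
Hypotheses (mE : cmeas E) (uE : unimodular E).
Local Notation hat := (transform mX E).
Local Notation check := (transform mY (dual_kernel E)).
Let mEd : cmeas (dual_kernel E) := cmeas_dual_kernel mE.
Let uEd : unimodular (dual_kernel E) := unimodular_dual_kernel uE.

Lemma cint_indic (d : measure_display) (T : measurableType d)
    (mu : {measure set T -> \bar R}) (D : set T) (f : T -> R[i]) (M : R) :
  measurable D -> (mu D < +oo)%E -> cmeas f -> (forall x, normc (f x) <= M) ->
  cint mu (fun x => Complex (\1_D x) 0 * f x).
Proof.
move=> mD Doo mf fM; apply: (@cintM_bounded _ _ _ _ _ _ M) => //.
split; first by apply: cmeas_real; exact: measurable_indic.
under eq_integral do rewrite normc_real ger0_norm//.
by rewrite integral_indic// setIT.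
Qed.

Lemma N2_indic_lty (d : measure_display) (T : measurableType d)
    (mu : {measure set T -> \bar R}) (D : set T) (f : T -> R[i]) (M : R) :
  measurable D -> (mu D < +oo)%E -> cmeas f -> (forall x, normc (f x) <= M) ->
  (N2 mu (fun x => Complex (\1_D x) 0 * f x)%R < +oo)%E.
Proof.
move=> mD Doo mf fM; apply: le_lt_trans (_ : (M ^+ 2)%:E * mu D < +oo)%E; last first.
  by rewrite lte_mul_pinfty// lee_fin sqr_ge0.
rewrite N2_indic// -integral_cst//; apply: ge0_le_integral => //.
- by move=> x _; rewrite lee_fin sqr_ge0.
- by apply/measurable_EFinP/measurable_funTS; exact: measurable_sqr_normc.
- move=> x _; rewrite lee_fin ler_pXn2r// nnegrE ?normc_ge0//.
  by rewrite (le_trans _ (fM x))// normc_ge0.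
Qed.

Lemma indic_mul_conj (T : Type) (D : set T) (f : T -> R[i]) x :
  f x * conjC (Complex (\1_D x) 0 * f x) =
  Complex (normc (Complex (\1_D x) 0 * f x) ^+ 2) 0.
Proof.
rewrite -mul_conjcE rmorphM/= indicE; case: (x \in D) => /=.
  by rewrite -[Complex 1 0]/(1 : R[i]) mul1r.
by rewrite oppr0 -[Complex 0 0]/(0 : R[i]) !mul0r mulr0.
Qed.

Lemma indic_mul_conjr (T : Type) (D : set T) (f : T -> R[i]) x :
  Complex (\1_D x) 0 * f x * conjC (f x) =
  Complex (normc (Complex (\1_D x) 0 * f x) ^+ 2) 0.
Proof.
rewrite -indic_mul_conj rmorphM/= mulrCA mulrA; congr (_ * _ * _).
by rewrite oppr0.
Qed.

(** Bessel's argument. With [a] the restriction of [hat f] to [D], the pairing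
    of [f] and [check a] equals the squared norm of [a], and so does the
    squared norm of [check a] by isometry; the inequality expresses that the
    squared norm of [f - check a] is nonnegative. *)
Lemma N2_truncated_transform f D : plancherel mY mX (dual_kernel E) ->
  cint mX f -> (N2 mX f < +oo)%E -> measurable D -> (mY D < +oo)%E ->
  (N2 mY (fun y => Complex (\1_D y) 0 * hat f y)%R <= N2 mX f)%E.
Proof.
move=> PYX fi foo mD Doo; set a := fun y => _.
have mf := cmeas_transform mX mE fi.1.
have [M M0 fM] := normc_transform_bounded mE uE fi.
have ai : cint mY a by exact: cint_indic fM.
have aoo : (N2 mY a < +oo)%E by exact: N2_indic_lty fM.
have ca : N2 mX (check a) = N2 mY a by exact: PYX.
have mc : cmeas (check a) by apply: cmeas_transform => //; exact: ai.1.
have := N2B fi.1 mc foo; rewrite ca => /(_ aoo).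
rewrite (transform_pairing mE uE fi ai).
have -> : (fun y => hat f y * conjC (a y)) = fun y => Complex (normc (a y) ^+ 2) 0.
  by apply/funext => y; exact: indic_mul_conj.
rewrite /= -[\int[mY]_x _]/(fine (N2 mY a)) => eN.
have := N2_ge0 mX (fun x => f x - check a x).
by rewrite eN lee_fin -(N2_fineK foo) -(N2_fineK aoo) lee_fin; lra.
Qed.

Lemma bessel f : plancherel mY mX (dual_kernel E) ->
  cint mX f -> (N2 mX f < +oo)%E -> (N2 mY (hat f) <= N2 mX f)%E.
Proof.
move=> PYX fi foo.
have /sigma_finiteP[F [FT ndF Foo]] := sigma_finiteT mY.
have mf := cmeas_transform mX mE fi.1.
have cvgF : ((\int[mY]_(x in F i) (normc (hat f x) ^+ 2)%:E)%E @[i --> \oo] -->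
    N2 mY (hat f))%E.
  rewrite /N2 FT; apply: ge0_nondecreasing_set_cvg_integral => //.
  - by move=> i; have [] := Foo i.
  - by move=> i; apply/measurable_EFinP/measurable_funTS; exact: measurable_sqr_normc.
  - by move=> i x _; rewrite lee_fin sqr_ge0.
rewrite -(cvg_lim _ cvgF)//; apply: lime_le.
  by apply/cvg_ex; exists (N2 mY (hat f)).
apply: nearW => i; have [mFi Fioo] := Foo i.
by rewrite -N2_indic//; exact: N2_truncated_transform.
Qed.

(** For [check a] close to [f], the squared norm of [hat f - a] is nonnegative
    and equals, by the pairing, the squared norm of [hat f] minus that of [f]
    plus a small error: this reverses the Bessel inequality. *)
Lemma plancherel_dual : plancherel mY mX (dual_kernel E) ->
  (forall f, cint mX f -> (N2 mX f < +oo)%E -> forall e : R, 0 < e ->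
    exists a, [/\ cint mY a, (N2 mY a < +oo)%E &
      (N2 mX (fun x => f x - check a x)%R <= e%:E)%E]) ->
  plancherel mX mY E.
Proof.
move=> PYX dense f fi foo; apply/eqP; rewrite eq_le bessel//=.
apply/lee_addgt0Pr => e e0; have [a [ai aoo ae]] := dense f fi foo e e0.
have mf := cmeas_transform mX mE fi.1.
have hfoo := le_lt_trans (bessel PYX fi foo) foo.
have ca : N2 mX (check a) = N2 mY a by exact: PYX.
have mc : cmeas (check a) by apply: cmeas_transform => //; exact: ai.1.
move: ae; rewrite (N2B fi.1 mc foo) ?ca// (transform_pairing mE uE fi ai) => ae.
have := N2_ge0 mY (fun y => hat f y - a y).
rewrite (N2B mf ai.1 hfoo aoo) => he.
move: ae he; rewrite -(N2_fineK foo) -(N2_fineK hfoo) -EFinD !lee_fin; lra.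
Qed.

(** The inverse transform of [g], restricted to a set of finite measure before
    and after the transformation so as to remain integrable, has a transform
    close to [g]. *)
Lemma transform_dense : plancherel mX mY E -> plancherel mY mX (dual_kernel E) ->
  forall g, cmeas g -> (N2 mY g < +oo)%E -> forall e : R, 0 < e ->
  exists f, [/\ cint mX f, (N2 mX f < +oo)%E &
    (N2 mY (fun y => hat f y - g y)%R < e%:E)%E].
Proof.
move=> PXY PYX g mg goo e e0.
have /sigma_finiteP[F [FT ndF Foo]] := sigma_finiteT mX.
have /sigma_finiteP[G [GT ndG Goo]] := sigma_finiteT mY.
have e40 : 0 < e / 5 by rewrite divr_gt0.
(* Two errors, of [g] against its restriction [h] and of [hat k] against [h];
   the inequality [N2D_le] doubles them, and a fifth of [e] for each leaves
   room. *)
have [n gn] := N2_exhaust GT ndG (fun i => (Goo i).1) mg goo e40.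
have [mGn Gnoo] := Goo n.
set h := fun y => Complex (\1_(G n) y) 0 * g y in gn.
have mh : cmeas h by exact: cmeas_indic.
have hle y : normc (h y) <= normc (g y).
  rewrite /h ComplexField.Normc.normcM normc_real indicE.
  by case: (y \in G n); rewrite ?normr1 ?mul1r// normr0 mul0r normc_ge0.
have hoo : (N2 mY h < +oo)%E by rewrite (le_lt_trans _ goo)//; exact: le_N2.
have hi : cint mY h.
  apply: (@le_cint _ _ _ _ _ (fun y => normc (h y) ^+ 2 + \1_(G n) y)) => //.
  - by apply: measurable_funD; [exact: measurable_sqr_normc|exact: measurable_indic].
  - move=> y; rewrite /h ComplexField.Normc.normcM normc_real indicE.
    case: (y \in G n) => /=; last by rewrite normr0 mul0r expr0n addr0.
    rewrite normr1 mul1r.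
    have := sqr_ge0 (normc (g y) - 1); have := normc_ge0 (g y); lra.
  under eq_integral do rewrite EFinD.
  rewrite ge0_integralD//; do 1?[
    by apply/measurable_EFinP; exact: measurable_sqr_normc|
    by apply/measurable_EFinP; exact: measurable_indic|
    by move=> x _; rewrite lee_fin ?sqr_ge0].
  by rewrite integral_indic// setIT lte_add_pinfty.
have gh : (N2 mY (fun y => g y - h y)%R <= (e / 5)%:E)%E.
  rewrite (N2B mg mh goo hoo).
  have -> : (fun y => g y * conjC (h y)) = fun y => Complex (normc (h y) ^+ 2) 0.
    by apply/funext => y; exact: indic_mul_conj.
  rewrite /= -[\int[mY]_x _]/(fine (N2 mY h)).
  move: gn; rewrite -(N2_fineK goo) -(N2_fineK hoo) -EFinD lte_fin lee_fin; lra.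
pose f := check h.
have mf : cmeas f by apply: cmeas_transform => //; exact: hi.1.
have fN : N2 mX f = N2 mY h by exact: PYX.
have foo : (N2 mX f < +oo)%E by rewrite fN.
have [M M0 fM] := normc_transform_bounded mEd uEd hi.
have [m fm] := N2_exhaust FT ndF (fun i => (Foo i).1) mf foo e40.
have [mFm Fmoo] := Foo m.
set k := fun x => Complex (\1_(F m) x) 0 * f x in fm.
have ki : cint mX k by exact: cint_indic fM.
have koo : (N2 mX k < +oo)%E by exact: N2_indic_lty fM.
exists k; split => //.
have hk : N2 mY (hat k) = N2 mX k by exact: PXY.
have hkoo : (N2 mY (hat k) < +oo)%E by rewrite hk.
have mhk : cmeas (hat k) by apply: cmeas_transform => //; exact: ki.1.
have kh : (N2 mY (fun y => hat k y - h y)%R <= (e / 5)%:E)%E.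
  rewrite (N2B mhk mh hkoo hoo) -(transform_pairing mE uE ki hi) -/f.
  have -> : (fun x => k x * conjC (f x)) = fun x => Complex (normc (k x) ^+ 2) 0.
    by apply/funext => x; exact: indic_mul_conjr.
  rewrite /= -[\int[mX]_x _]/(fine (N2 mX k)) hk.
  move: fm; rewrite -(N2_fineK foo) -(N2_fineK koo) -EFinD lte_fin lee_fin fN; lra.
have -> : (fun y => hat k y - g y) = fun y => (hat k y - h y) + - (g y - h y).
  by apply/funext => y; ring.
have mkh : cmeas (fun y => hat k y - h y) by exact: cmeasB.
have mgh : cmeas (fun y => g y - h y) by exact: cmeasB.
apply: (le_lt_trans (N2D_le mY mkh (cmeasN mgh))); rewrite N2N.
have koo' := le_lt_trans kh (ltry _); have goo' := le_lt_trans gh (ltry _).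
move: kh gh; rewrite -(N2_fineK koo') -(N2_fineK goo') !lee_fin -!EFinM -EFinD lte_fin.
lra.
Qed.

End duality.

(** * Product kernels and measure preserving maps *)

Section square_norm_product.
Context d1 d2 (X : measurableType d1) (Y : measurableType d2) (R : realType).
Variables (m1 : {sigma_finite_measure set X -> \bar R}).
Variables (m2 : {sigma_finite_measure set Y -> \bar R}).
Variable f : X * Y -> R[i].
Hypothesis mf : cmeas f.

Let mf2 : measurable_fun setT (fun z => (normc (f z) ^+ 2)%:E).
Proof. by apply/measurable_EFinP; exact: measurable_sqr_normc. Qed.

Let f20 z : (0 <= (normc (f z) ^+ 2)%:E)%E.
Proof. by rewrite lee_fin sqr_ge0. Qed.

Lemma N2_prod_snd : N2 (prodm m1 m2) f = (\int[m1]_x N2 m2 (fun y => f (x, y)))%E.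
Proof. by rewrite /N2 fubini_tonelli1. Qed.

Lemma N2_prod_fst : N2 (prodm m1 m2) f = (\int[m2]_y N2 m1 (fun x => f (x, y)))%E.
Proof. by rewrite /N2 fubini_tonelli2. Qed.

Lemma measurable_N2_snd : measurable_fun setT (fun x => N2 m2 (fun y => f (x, y))).
Proof. exact: (@measurable_fun_fubini_tonelli_F _ _ X Y R m2 _ mf2 f20). Qed.

Lemma measurable_N2_fst : measurable_fun setT (fun y => N2 m1 (fun x => f (x, y))).
Proof. exact: (@measurable_fun_fubini_tonelli_G _ _ X Y R m1 _ mf2 f20). Qed.

Lemma N2_snd_lty_ae : (N2 (prodm m1 m2) f < +oo)%E ->
  {ae m1, forall x, N2 m2 (fun y => f (x, y)) < +oo}%E.
Proof.
rewrite N2_prod_snd => foo.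
have /(integrable_ae measurableT) : m1.-integrable setT (fun x => N2 m2 (fun y => f (x, y))).
  apply/integrableP; split; first exact: measurable_N2_snd.
  by under eq_integral do rewrite gee0_abs ?N2_ge0//.
by apply: filterS => x /(_ Logic.I); rewrite ge0_fin_numE// N2_ge0.
Qed.

Lemma N2_fst_lty_ae : (N2 (prodm m1 m2) f < +oo)%E ->
  {ae m2, forall y, N2 m1 (fun x => f (x, y)) < +oo}%E.
Proof.
rewrite N2_prod_fst => foo.
have /(integrable_ae measurableT) : m2.-integrable setT (fun y => N2 m1 (fun x => f (x, y))).
  apply/integrableP; split; first exact: measurable_N2_fst.
  by under eq_integral do rewrite gee0_abs ?N2_ge0//.
by apply: filterS => x /(_ Logic.I); rewrite ge0_fin_numE// N2_ge0.
Qed.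

End square_norm_product.

Section twisted_product.
Context d1 d2 d3 d4 (X1 : measurableType d1) (X2 : measurableType d2)
  (Y1 : measurableType d3) (Y2 : measurableType d4) (R : realType).
Variables (m1 : {sigma_finite_measure set X1 -> \bar R}).
Variables (m2 : {sigma_finite_measure set X2 -> \bar R}).
Variables (n1 : {sigma_finite_measure set Y1 -> \bar R}).
Variables (n2 : {sigma_finite_measure set Y2 -> \bar R}).
Variables (E1 : X1 * Y1 -> R[i]) (E2 : X2 * Y2 -> R[i]) (u : X1 * Y2 -> R[i]).

(** The factor [u] couples the first space variable with the second frequency
    only: it can be absorbed between the transform in the second variable and
    the transform in the first one. *)
Definition twisted_kernel (p : (X1 * X2) * (Y1 * Y2)) : R[i] :=
  E1 (p.1.1, p.2.1) * E2 (p.1.2, p.2.2) * u (p.1.1, p.2.2).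

Hypotheses (mE1 : cmeas E1) (mE2 : cmeas E2) (mu : cmeas u).
Hypotheses (uE1 : unimodular E1) (uE2 : unimodular E2) (uu : unimodular u).

Lemma unimodular_twisted : unimodular twisted_kernel.
Proof.
by move=> p; rewrite !ComplexField.Normc.normcM uE1 uE2 uu !mulr1.
Qed.

Lemma cmeas_twisted : cmeas twisted_kernel.
Proof.
have m11 : measurable_fun setT (fun p : (X1 * X2) * (Y1 * Y2) => p.1.1).
  exact: measurableT_comp measurable_fst measurable_fst.
have m12 : measurable_fun setT (fun p : (X1 * X2) * (Y1 * Y2) => p.1.2).
  exact: measurableT_comp measurable_snd measurable_fst.
have m21 : measurable_fun setT (fun p : (X1 * X2) * (Y1 * Y2) => p.2.1).
  exact: measurableT_comp measurable_fst measurable_snd.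
have m22 : measurable_fun setT (fun p : (X1 * X2) * (Y1 * Y2) => p.2.2).
  exact: measurableT_comp measurable_snd measurable_snd.
apply: cmeasM; first apply: cmeasM.
- exact: (cmeas_comp (measurable_fun_pair m11 m21) mE1).
- exact: (cmeas_comp (measurable_fun_pair m12 m22) mE2).
- exact: (cmeas_comp (measurable_fun_pair m11 m22) mu).
Qed.

Section partial_transform.
Variable f : X1 * X2 -> R[i].
Hypotheses (fi : cint (prodm m1 m2) f).

Let g (p : X1 * Y2) := transform m2 E2 (fun x2 => f (p.1, x2)) p.2.

Let mg : cmeas g.
Proof.
apply: (@cmeas_integral_snd _ _ _ _ _ m2
  (fun q : (X1 * Y2) * X2 => f (q.1.1, q.2) * E2 (q.2, q.1.2))).
have m11 : measurable_fun setT (fun p : (X1 * Y2) * X2 => p.1.1).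
  exact: measurableT_comp measurable_fst measurable_fst.
have m12 : measurable_fun setT (fun p : (X1 * Y2) * X2 => p.1.2).
  exact: measurableT_comp measurable_snd measurable_fst.
apply: cmeasM.
- exact: (cmeas_comp (measurable_fun_pair m11 measurable_snd) fi.1).
- exact: (cmeas_comp (measurable_fun_pair measurable_snd m12) mE2).
Qed.

Let k y2 x1 := g (x1, y2) * u (x1, y2).

Let cint_k y2 : cint m1 (k y2).
Proof.
have mk : cmeas (k y2) by apply: cmeasM; exact: cmeas_fst.
have mnf : measurable_fun setT (fun z => (normc (f z))%:E).
  by apply/measurable_EFinP/measurable_normc; exact: fi.1.
have nf0 z : (0 <= (normc (f z))%:E)%E by rewrite lee_fin normc_ge0.
split => //; apply: le_lt_trans
  (_ : \int[m1]_x1 \int[m2]_x2 (normc (f (x1, x2)))%:E < +oo)%E; last first.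
  by rewrite -(@prodm_tonelli1 _ _ X1 X2 R m1 m2 _ mnf nf0); exact: fi.2.
apply: ae_ge0_le_integral => //.
- by move=> x _; rewrite lee_fin normc_ge0.
- by apply/measurable_EFinP; exact: measurable_normc.
- by move=> x _; exact: integral_ge0.
- exact: (@measurable_fun_fubini_tonelli_F _ _ X1 X2 R m2 _ mnf nf0).
apply: filterS (cint_snd_ae fi) => x1 fx1 _.
rewrite /k ComplexField.Normc.normcM uu mulr1.
exact: (normc_transform_le mE2 uE2).
Qed.

Lemma transform_twistedE y1 y2 :
  transform (prodm m1 m2) twisted_kernel f (y1, y2) = transform m1 E1 (k y2) y1.
Proof.
pose h z := f z * twisted_kernel (z, (y1, y2)).
have hi : cint (prodm m1 m2) h.
  apply: (@cintM_bounded _ _ _ _ _ _ 1) => //.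
    exact: (cmeas_fst _ cmeas_twisted).
  by move=> z; rewrite unimodular_twisted.
rewrite /transform -(cintegral_prod_snd hi); apply: ae_eq_cintegral.
- exact: (@cmeas_integral_snd _ _ _ _ _ m2 h hi.1).
- apply: cmeasM; last exact: (cmeas_fst _ mE1).
  exact: (cint_k y2).1.
apply: filterS (cint_snd_ae fi) => x1 fx1; rewrite /k /g /transform /=.
rewrite -mulrA mulrC -cintegralZl.
  congr cintegral; apply/funext => x2; rewrite /h /twisted_kernel/=; ring.
apply: (@cintM_bounded _ _ _ _ _ _ 1) => //.
  exact: (cmeas_fst _ mE2).
by move=> z; rewrite uE2.
Qed.

Hypothesis foo : (N2 (prodm m1 m2) f < +oo)%E.
Hypotheses (P1 : plancherel m1 n1 E1) (P2 : plancherel m2 n2 E2).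

Lemma N2_partial_transform : N2 (prodm m1 n2) g = N2 (prodm m1 m2) f.
Proof.
rewrite !N2_prod_snd//; last exact: fi.1.
apply: ge0_ae_eq_integral => //.
- exact: measurable_N2_snd.
- by apply: measurable_N2_snd; exact: fi.1.
- by move=> *; exact: N2_ge0.
- by move=> *; exact: N2_ge0.
- apply: filterS2 (cint_snd_ae fi) (N2_snd_lty_ae fi.1 foo) => x1 fx1 fx1oo _.
  exact: (P2 fx1 fx1oo).
Qed.

(** For almost every frequency [y2] the function [k y2] has the same modulus as
    the partial transform [g], so that the second Parseval identity does not
    see [u]. *)
Lemma N2_twisted :
  N2 (prodm n1 n2) (transform (prodm m1 m2) twisted_kernel f) = N2 (prodm m1 m2) f.
Proof.
have mh : cmeas (transform (prodm m1 m2) twisted_kernel f).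
  by apply: cmeas_transform; [exact: cmeas_twisted|exact: fi.1].
rewrite -N2_partial_transform N2_prod_fst// [RHS]N2_prod_fst//.
apply: ge0_ae_eq_integral => //.
- exact: measurable_N2_fst.
- exact: measurable_N2_fst.
- by move=> *; exact: N2_ge0.
- by move=> *; exact: N2_ge0.
have goo : (N2 (prodm m1 n2) g < +oo)%E by rewrite N2_partial_transform.
apply: filterS (N2_fst_lty_ae mg goo) => y2 gy2 _.
have kg : N2 m1 (k y2) = N2 m1 (fun x => g (x, y2)).
  by apply: eq_N2 => x; rewrite ComplexField.Normc.normcM uu mulr1.
rewrite -kg -P1 ?kg//.
by congr N2; apply/funext => y1; rewrite transform_twistedE.
Qed.

End partial_transform.

Lemma plancherel_twisted : plancherel m1 n1 E1 -> plancherel m2 n2 E2 ->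
  plancherel (prodm m1 m2) (prodm n1 n2) twisted_kernel.
Proof. by move=> P1 P2 f fi foo; exact: N2_twisted. Qed.

End twisted_product.

Section transport.
Context d1 d2 d3 (X : measurableType d1) (X' : measurableType d2)
  (Y : measurableType d3) (R : realType).
Variables (mX : {measure set X -> \bar R}) (mX' : {measure set X' -> \bar R}).
Variables (mY : {measure set Y -> \bar R}).
Variables (phi : X -> X').
Hypothesis mphi : measurable_fun setT phi.
Hypothesis phiE : forall D, measurable D -> mX' D = mX (phi @^-1` D).

Lemma ge0_integral_transport (f : X' -> \bar R) : measurable_fun setT f ->
  (forall x, 0 <= f x)%E -> (\int[mX']_x f x = \int[mX]_x f (phi x))%E.
Proof.
move=> mf f0; have := ge0_integral_pushforward mphi mX measurableT mf.
rewrite preimage_setT => <-; last by move=> *; exact: f0.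
by apply: eq_measure_integral => A mA _; exact: phiE.
Qed.

Lemma N2_transport f : cmeas f -> N2 mX' f = N2 mX (f \o phi).
Proof.
move=> mf; apply: ge0_integral_transport.
  by apply/measurable_EFinP; exact: measurable_sqr_normc.
by move=> x; rewrite lee_fin sqr_ge0.
Qed.

Lemma cint_transport f : cint mX' f -> cint mX (f \o phi).
Proof.
move=> [mf foo]; split; first exact: (cmeas_comp mphi mf).
rewrite -(@ge0_integral_transport (fun x => (normc (f x))%:E))//.
  by apply/measurable_EFinP; exact: measurable_normc.
by move=> x; rewrite lee_fin normc_ge0.
Qed.

Lemma Rintegral_transport (h : X' -> R) : measurable_fun setT h ->
  \int[mX']_x h x = \int[mX]_x h (phi x).
Proof.
move=> /measurable_EFinP mh; rewrite /Rintegral integralE [in RHS]integralE.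
rewrite !ge0_integral_transport//; do ?[exact: measurable_funepos|
  exact: measurable_funeneg].
by congr (fine (_ - _)); apply: eq_integral => x _;
  rewrite ?funeposE ?funenegE.
Qed.

Lemma cintegral_transport f : cmeas f ->
  cintegral mX' setT f = cintegral mX setT (f \o phi).
Proof.
move=> [mr mi]; apply: complex_eqP => /=.
- exact: (Rintegral_transport mr).
- exact: (Rintegral_transport mi).
Qed.

Lemma plancherel_transport_l (E : X' * Y -> R[i]) : cmeas E ->
  plancherel mX mY (fun p => E (phi p.1, p.2)) -> plancherel mX' mY E.
Proof.
move=> mE PE f fi foo; rewrite N2_transport; last exact: fi.1.
rewrite -PE.
- congr N2; apply/funext => y; rewrite /transform cintegral_transport//.
  by apply: cmeasM; [exact: fi.1|exact: (cmeas_comp (pair2_measurable y) mE)].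
- exact: cint_transport.
- by rewrite -N2_transport//; exact: fi.1.
Qed.

End transport.

Section transport_r.
Context d1 d2 d3 (X : measurableType d1) (Y : measurableType d2)
  (Y' : measurableType d3) (R : realType).
Variables (mX : {sigma_finite_measure set X -> \bar R}).
Variables (mY : {measure set Y -> \bar R}) (mY' : {measure set Y' -> \bar R}).
Variables (psi : Y -> Y').
Hypothesis mpsi : measurable_fun setT psi.
Hypothesis psiE : forall D, measurable D -> mY' D = mY (psi @^-1` D).

Lemma plancherel_transport_r (E : X * Y' -> R[i]) : cmeas E ->
  plancherel mX mY (fun p => E (p.1, psi p.2)) -> plancherel mX mY' E.
Proof.
move=> mE PE f fi foo; rewrite -PE// (N2_transport mpsi psiE)//.
by apply: cmeas_transform => //; exact: fi.1.
Qed.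

End transport_r.

(** * Linear changes of variables for Lebesgue measure *)

Lemma ge0_integral_mrestr d (T : measurableType d) (R : realType)
    (mu : {measure set T -> \bar R}) (D : set T) (mD : measurable D)
    (f : T -> \bar R) : measurable_fun setT f -> (forall x, 0 <= f x)%E ->
  (\int[mrestr mu mD]_x f x = \int[mu]_(x in D) f x)%E.
Proof.
move=> mf f0; rewrite (@ge0_negligible_integral _ _ _ (mrestr mu mD) _ (~` D))//.
- rewrite setDE setTI setCK; apply: eq_measure_integral => A mA AD.
  by change (mu (A `&` D) = mu A); rewrite setIidl.
- exact: measurableC.
- by change (mu (~` D `&` D) = 0%E); rewrite setICl measure0.
Qed.

Section affine_real.
Variable R : realType.
Local Notation leb := (@lebesgue_measure R).

Let affine (a b : R) : measurableTypeR R -> measurableTypeR R := fun x => a * x + b.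

Let measurable_affine a b : measurable_fun setT (affine a b).
Proof. by apply: measurable_funD => //; exact: measurable_funM. Qed.

(** Lebesgue measure is determined by its values on half-open intervals. *)
Lemma ge0_integral_affine (a b : R) (f : measurableTypeR R -> \bar R) : a != 0 ->
  measurable_fun setT f -> (forall x, 0 <= f x)%E ->
  (\int[leb]_x f x = `|a|%:E * \int[leb]_x f (a * x + b)%R)%E.
Proof.
move=> a0 mf f0.
pose k : {nonneg R} := NngNum (normr_ge0 a).
pose m := mscale k (image_measure leb (measurable_affine a b)).
transitivity (\int[m]_x f x)%E; last first.
  rewrite ge0_integral_mscale//; congr (_ * _)%E.
  exact: (ge0_integral_transport (mX := leb) (measurable_affine a b)).
apply: eq_measure_integral => A mA _; apply: lebesgue_measure_unique => //.
move=> _ [[c e] _ <-]/=; rewrite /mscale /image_measure /pushforward /=.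
have [apos|aneg] : 0 < a \/ a < 0 by case: (ltgtP a 0) a0 => //; [right|left].
  have -> : affine a b @^-1` `]c, e]%classic = `](c - b) / a, (e - b) / a]%classic.
    apply/seteqP; split => x /=; rewrite /affine !in_itv/= ltr_pdivrMr//
      ler_pdivlMr// ltrBlDr lerBrDr [x * a]mulrC//.
  rewrite !lebesgue_measure_itv/= !lte_fin ltr_pM2r ?invr_gt0// ltrD2r.
  case: ifPn => _; last by rewrite mule0.
  rewrite -!EFinB -EFinM gtr0_norm//; congr EFin; field.
  by rewrite gt_eqF.
have -> : affine a b @^-1` `]c, e]%classic = `[(e - b) / a, (c - b) / a[%classic.
  apply/seteqP; split => x /=; rewrite /affine !in_itv/= ltr_ndivlMr//
    ler_ndivrMr// ltrBlDr lerBrDr [x * a]mulrC andbC//.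
rewrite !lebesgue_measure_itv/= !lte_fin ltr_nM2r ?invr_lt0// ltrD2r.
case: ifPn => _; last by rewrite mule0.
rewrite -!EFinB -EFinM ltr0_norm//; congr EFin; field.
by rewrite lt_eqF.
Qed.

End affine_real.

Section linear_change_of_variables.
Variable R : realType.
Implicit Types n : nat.

(** The translation [b] is kept in the property because the induction on block
    matrices creates one: the second block of variables is shifted by a
    multiple of the first one. *)
Definition change_of_variables n (B : 'M[R]_n) := forall (b : 'cV[R]_n) f,
  measurable_fun setT f -> (forall x, 0 <= f x)%E ->
  (\int[lebesgue_cV R n]_x f x =
   `|\det B|%:E * \int[lebesgue_cV R n]_x f (B *m x + b)%R)%E.

Lemma measurable_mulmx m n (B : 'M[R]_(m, n)) :
  measurable_fun setT (mulmx B : 'cV[R]_n -> 'cV[R]_m).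
Proof.
apply: measurable_fun_mx => i j; under eq_fun do rewrite mxE.
apply: measurable_sum => k; apply: measurable_funM => //.
exact: measurable_coord.
Qed.

Lemma measurable_addmx n d (T : measurableType d) (f g : T -> 'cV[R]_n) :
  measurable_fun setT f -> measurable_fun setT g ->
  measurable_fun setT (fun x => f x + g x).
Proof.
move=> mf mg; apply: measurable_fun_mx => i j; under eq_fun do rewrite mxE.
apply: measurable_funD; first exact: (measurableT_comp (measurable_coord i j) mf).
exact: (measurableT_comp (measurable_coord i j) mg).
Qed.

Lemma measurable_oppmx n d (T : measurableType d) (f : T -> 'cV[R]_n) :
  measurable_fun setT f -> measurable_fun setT (fun x => - f x).
Proof.
move=> mf; apply: measurable_fun_mx => i j; under eq_fun do rewrite mxE.
apply: measurableT_comp => //; exact: (measurableT_comp (measurable_coord i j) mf).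
Qed.

Lemma measurable_affine_mx n (B : 'M[R]_n) b :
  measurable_fun setT (fun x : 'cV[R]_n => B *m x + b).
Proof.
by apply: measurable_addmx; [exact: measurable_mulmx|exact: measurable_cst].
Qed.

Lemma change_of_variablesM n (B C : 'M[R]_n) :
  change_of_variables B -> change_of_variables C -> change_of_variables (B *m C).
Proof.
move=> vB vC b f mf f0; rewrite (vB b)// (vC 0); last 2 first.
- exact: (measurableT_comp mf (measurable_affine_mx B b)).
- by move=> x.
rewrite muleA -EFinM -normrM -det_mulmx; congr (_ * _)%E.
by apply: eq_integral => x _; rewrite addr0 mulmxA.
Qed.

Lemma ge0_integral_cons n (f : 'cV[R]_n.+1 -> \bar R) :
  measurable_fun setT f -> (forall x, 0 <= f x)%E ->
  (\int[lebesgue_cV R n.+1]_x f x =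
   \int[lebesgue_measure]_x \int[lebesgue_cV R n]_v f (cons_cV (x, v)))%E.
Proof.
move=> mf f0.
rewrite (ge0_integral_transport (mX := prodm lebesgue_measure (lebesgue_cV R n))
  (@measurable_cons_cV R n))//.
rewrite (@prodm_tonelli1 _ _ _ _ R lebesgue_measure (lebesgue_cV R n) (f \o @cons_cV R n))//.
  exact: (measurableT_comp mf (@measurable_cons_cV R n)).
by move=> p; exact: f0.
Qed.

Lemma ge0_integral_cons_swap n (f : 'cV[R]_n.+1 -> \bar R) :
  measurable_fun setT f -> (forall x, 0 <= f x)%E ->
  (\int[lebesgue_cV R n.+1]_x f x =
   \int[lebesgue_cV R n]_v \int[lebesgue_measure]_x f (cons_cV (x, v)))%E.
Proof.
move=> mf f0; rewrite ge0_integral_cons//.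
rewrite (@fubini_tonelli _ _ _ _ R lebesgue_measure (lebesgue_cV R n) (f \o @cons_cV R n))//.
  exact: (measurableT_comp mf (@measurable_cons_cV R n)).
by move=> p; exact: f0.
Qed.

Lemma mul_block_cons n (a : R) (w : 'rV[R]_n) (v : 'cV[R]_n) (B : 'M[R]_n) x y :
  (block_mx a%:M w v B : 'M[R]_(1 + n)) *m (cons_cV (x, y) : 'cV[R]_(1 + n)) =
  cons_cV (a * x + (w *m y) 0 0, x *: v + B *m y).
Proof.
rewrite /cons_cV /= [LHS]mul_block_col; congr col_mx.
  rewrite mul_scalar_mx scalemx_const (mx11_scalar (w *m y)).
  by apply/matrixP => i j; rewrite !ord1 !mxE eqxx mulr1n.
congr (_ + _); apply/matrixP => i j; rewrite !mxE big_ord1 !mxE.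
by rewrite !ord1 mulrC.
Qed.

Lemma addr_cons n (x x' : R) (y y' : 'cV[R]_n) :
  cons_cV (x, y) + cons_cV (x', y') = cons_cV (x + x', y + y').
Proof.
apply: etrans (@add_col_mx _ 1 n 1 _ _ _ _) _; congr col_mx.
by apply/matrixP => i j; rewrite !mxE.
Qed.

Lemma cons_cV_surj n (b : 'cV[R]_n.+1) :
  exists b0 b', b = cons_cV (b0, b') :> 'cV[R]_n.+1.
Proof.
exists (b 0 0), (dsubmx (b : 'cV[R]_(1 + n))).
apply: etrans (esym (vsubmxK (b : 'cV[R]_(1 + n)))) _.
rewrite /cons_cV /=; apply: (f_equal (fun u => @col_mx R 1 n 1 u _)).
apply/matrixP => i j; rewrite !ord1 !mxE; congr (b _ _).
exact: val_inj.
Qed.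

(** The first coordinate is integrated first, at fixed second block: there the
    map is affine in one real variable. *)
Lemma change_of_variables_ublock n (a : R) (w : 'rV[R]_n) (B : 'M[R]_n) :
  a != 0 -> change_of_variables B ->
  @change_of_variables (1 + n) (block_mx a%:M w 0 B).
Proof.
move=> a0 vB b f mf f0; have [b0 [b' ->]] := cons_cV_surj b.
have mfc : measurable_fun setT (f \o @cons_cV R n).
  exact: (measurableT_comp mf (@measurable_cons_cV R n)).
rewrite ge0_integral_cons_swap// ge0_integral_cons_swap//; last first.
  exact: (measurableT_comp mf (measurable_affine_mx _ _)).
rewrite det_ublock det_scalar1 normrM EFinM [X in (X * _)%E]muleC -muleA.
rewrite (vB b' (fun y => \int[lebesgue_measure]_x f (cons_cV (x, y)))%E); last 2 first.
- exact: (@measurable_fun_fubini_tonelli_G _ _ _ _ R lebesgue_measure _ mfc (fun p => f0 _)).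
- by move=> y; exact: integral_ge0.
congr (_ * _)%E; rewrite -ge0_integralZl//; last 2 first.
- pose h p := f (block_mx a%:M w 0 B *m cons_cV p + cons_cV (b0, b')).
  have mh : measurable_fun setT h.
    apply: (measurableT_comp mf); apply: (measurableT_comp (measurable_affine_mx _ _)).
    exact: measurable_cons_cV.
  exact: (@measurable_fun_fubini_tonelli_G _ _ _ _ R lebesgue_measure _ mh (fun p => f0 _)).
- by move=> y _; exact: integral_ge0.
apply: eq_integral => y _.
rewrite (@ge0_integral_affine _ a ((w *m y) 0 0 + b0))//; last first.
  exact: (measurableT_comp mfc (pair2_measurable _)).
congr (_ * _)%E; apply: eq_integral => x _; congr f.
by rewrite mul_block_cons addr_cons scaler0 add0r addrA.
Qed.

Lemma change_of_variables_lblock n (a : R) (v : 'cV[R]_n) (B : 'M[R]_n) :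
  a != 0 -> change_of_variables B ->
  @change_of_variables (1 + n) (block_mx a%:M 0 v B).
Proof.
move=> a0 vB b f mf f0; have [b0 [b' ->]] := cons_cV_surj b.
have mfc : measurable_fun setT (f \o @cons_cV R n).
  exact: (measurableT_comp mf (@measurable_cons_cV R n)).
rewrite ge0_integral_cons// ge0_integral_cons//; last first.
  exact: (measurableT_comp mf (measurable_affine_mx _ _)).
rewrite det_lblock det_scalar1 normrM EFinM -muleA.
rewrite (@ge0_integral_affine _ a b0
  (fun x => \int[lebesgue_cV R n]_y f (cons_cV (x, y)))%E)//; last 2 first.
- exact: (@measurable_fun_fubini_tonelli_F _ _ _ _ R (lebesgue_cV R n) _ mfc (fun p => f0 _)).
- by move=> y; exact: integral_ge0.
congr (_ * _)%E; rewrite -ge0_integralZl//; last 2 first.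
- pose h p := f (block_mx a%:M 0 v B *m cons_cV p + cons_cV (b0, b')).
  have mh : measurable_fun setT h.
    apply: (measurableT_comp mf); apply: (measurableT_comp (measurable_affine_mx _ _)).
    exact: measurable_cons_cV.
  exact: (@measurable_fun_fubini_tonelli_F _ _ _ _ R (lebesgue_cV R n) _ mh (fun p => f0 _)).
- by move=> y _; exact: integral_ge0.
apply: eq_integral => x _.
rewrite (vB (x *: v + b') (fun y => f (cons_cV (a * x + b0, y))))//; last first.
  exact: (measurableT_comp mfc (pair1_measurable _)).
congr (_ * _)%E; apply: eq_integral => y _; congr f.
by rewrite mul_block_cons addr_cons mul0mx mxE addr0 addrA [B *m y + _]addrC.
Qed.

(** Gaussian elimination: a matrix whose first entry is nonzero is the product
    of a lower and an upper block triangular matrix, and adding a row to the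
    first one reduces the other matrices to this case. *)
Lemma change_of_variables_unitmx n (B : 'M[R]_n) : B \in unitmx ->
  change_of_variables B.
Proof.
elim: n B => [|n IHn] B uB.
  move=> b f mf f0; rewrite (flatmx0 B) det_mx00 normr1 mul1e.
  by apply: eq_integral => x _; congr f; rewrite [LHS]flatmx0 [RHS]flatmx0.
have unit1 : (1%:M : 'M[R]_n) \in unitmx by exact: unitmx1.
have pivot (C : 'M[R]_(1 + n)) : C \in unitmx -> C 0 0 != 0 ->
    change_of_variables C.
  move=> uC C0; pose a := C 0 0; pose w := ursubmx C; pose v := dlsubmx C.
  (* The Schur complement of the pivot. *)
  pose D := drsubmx C - v *m (a^-1 *: w).
  have CE : C = block_mx 1%:M 0 (a^-1 *: v) 1%:M *m block_mx a%:M w 0 D.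
    rewrite mulmx_block !mul1mx !mul0mx !addr0 -{1}[C]submxK.
    congr block_mx.
    - apply/matrixP => i j; rewrite !ord1 !mxE eqxx mulr1n; congr (C _ _);
        exact: val_inj.
    - by rewrite mul_mx_scalar scalerA divff// scale1r.
    - by rewrite /D -scalemxAl -scalemxAr addrC subrK.
  have uD : D \in unitmx.
    move: uC; rewrite {1}CE unitmxE det_mulmx det_lblock det_ublock !det1 !mul1r.
    by rewrite unitrM => /andP[_]; rewrite -unitmxE.
  rewrite CE; apply: change_of_variablesM.
  - by apply: change_of_variables_lblock; [exact: oner_neq0|exact: IHn].
  - by apply: change_of_variables_ublock => //; exact: IHn.
have [B0|B0] := eqVneq (B 0 0) 0; last exact: pivot.
(* The row of a nonzero entry of the first column is added to the first row. *)
have [k Bk] : exists k : 'I_n, B (lift 0 k) 0 != 0.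
  apply/existsP; apply: contraTT uB; rewrite negb_exists => /forallP Bk.
  rewrite unitmxE unitfE negbK (expand_det_col _ 0) big1// => i _.
  have [->|[j ->]] : i = 0 \/ exists j, i = lift 0 j.
    by case: (unliftP 0 i) => [j|] ->; [right; exists j|left].
  - by rewrite B0 mul0r.
  - by have := Bk j; rewrite negbK => /eqP ->; rewrite mul0r.
pose E (s : R) : 'M[R]_(1 + n) := block_mx 1%:M (s *: delta_mx 0 k) 0 1%:M.
have EK : E (-1) *m E 1 = 1%:M.
  rewrite mulmx_block !mulmx1 !mul1mx !mulmx0 !mul0mx !addr0 !add0r.
  by rewrite scale1r scaleN1r subrr scalar_mx_block.
have uE : E 1 \in unitmx.
  by rewrite unitmxE det_ublock !det1 mulr1 unitr1.
have -> : B = E (-1) *m (E 1 *m (B : 'M[R]_(1 + n))) by rewrite mulmxA EK mul1mx.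
apply: change_of_variablesM.
  apply: change_of_variables_ublock; [exact: oner_neq0|exact: IHn].
apply: pivot; first by rewrite unitmx_mul uE.
have E0 (j : 'I_n) : (E 1 : 'M[R]_n.+1) 0 (lift 0 j) = (j == k)%:R.
  have -> : lift (0 : 'I_n.+1) j = rshift 1 j by exact: val_inj.
  have -> : (0 : 'I_n.+1) = lshift n (ord0 : 'I_1) by exact: val_inj.
  by apply: etrans (block_mxEur _ _ _ _ _ _) _; rewrite !mxE eqxx mul1r.
rewrite mxE big_ord_recl (bigD1 k)//= big1 ?addr0; last first.
  by move=> j /negbTE jk; rewrite E0 jk mul0r.
by rewrite [X in _ * X]B0 mulr0 add0r E0 eqxx mul1r.
Qed.

End linear_change_of_variables.

Lemma measure_integral_indic d (T : measurableType d) (R : realType)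
    (mu : {measure set T -> \bar R}) (A : set T) : measurable A ->
  (mu A = \int[mu]_x (\1_A x)%:E)%E.
Proof. by move=> mA; rewrite integral_indic// setIT. Qed.
Arguments measure_integral_indic {d T R} mu [A].

Section lebesgue_product.
Variable R : realType.

Lemma cons_cV0 n (x : R) (v : 'cV[R]_n) j : cons_cV (x, v) ord0 j = x.
Proof.
have -> : (ord0 : 'I_n.+1) = lshift n (ord0 : 'I_1) by exact: val_inj.
by apply: etrans (col_mxEu _ _ _ _) _; rewrite mxE.
Qed.

Lemma cons_cV_lift n (x : R) (v : 'cV[R]_n) i j :
  cons_cV (x, v) (lift ord0 i) j = v i j.
Proof.
have -> : lift (ord0 : 'I_n.+1) i = rshift 1 i by exact: val_inj.
exact: (@col_mxEd R 1 n 1).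
Qed.

Lemma col_mx_cons n m (x : R) (v : 'cV[R]_n) (w : 'cV[R]_m) :
  col_mx (cons_cV (x, v)) w = cons_cV (x, col_mx v w) :> 'cV[R]_(n.+1 + m).
Proof.
rewrite /cons_cV /=; have := @col_mxA R 1 n m 1 (const_mx x) v w.
move: (esym _) => e; rewrite (eq_irrelevance e (erefl (1 + n + m)%N)) => H.
exact: esym H.
Qed.

(** Lebesgue measure is defined by adding one coordinate at a time;
    associativity of the concatenation of vectors makes it a product measure.
    *)
Lemma ge0_integral_col_mx d1 d2 (f : 'cV[R]_(d1 + d2) -> \bar R) :
  measurable_fun setT f -> (forall x, 0 <= f x)%E ->
  (\int[lebesgue_cV R (d1 + d2)]_x f x =
   \int[lebesgue_cV R d1]_v \int[lebesgue_cV R d2]_w f (col_mx v w))%E.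
Proof.
elim: d1 f => [|d1 IH] f mf f0.
  rewrite integral_dirac//; last first.
    exact: (@measurable_fun_fubini_tonelli_F _ _ _ _ R (lebesgue_cV R d2)
      (f \o @col_pair R 0 d2) (measurableT_comp mf (@measurable_col_pair R 0 d2))
      (fun p => f0 _)).
  rewrite diracT mul1e; apply: eq_integral => w _; congr f.
  apply/matrixP => i j; rewrite -[in RHS](_ : rshift 0 i = i); last exact: val_inj.
  by rewrite [RHS]col_mxEd.
rewrite [RHS]ge0_integral_cons//; last 2 first.
- exact: (@measurable_fun_fubini_tonelli_F _ _ _ _ R (lebesgue_cV R d2)
      (f \o @col_pair R d1.+1 d2)
      (measurableT_comp mf (@measurable_col_pair R d1.+1 d2)) (fun p => f0 _)).
- by move=> v; exact: integral_ge0.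
apply: etrans (@ge0_integral_cons _ (d1 + d2)%N f mf f0) _.
apply: eq_integral => x _.
rewrite (IH (fun v => f (cons_cV (x, v))))//.
  apply: eq_integral => v _; apply: eq_integral => w _; congr f.
  by rewrite col_mx_cons.
apply: (measurableT_comp mf).
exact: (measurableT_comp (@measurable_cons_cV R _) (pair1_measurable x)).
Qed.

Lemma lebesgue_cV_box n (J : set (measurableTypeR R)) : measurable J ->
  lebesgue_cV R n [set v | forall i, J (v i ord0)] =
  (lebesgue_measure J ^+ n)%E.
Proof.
move=> mJ.
have mbox k : measurable [set v : 'cV[R]_k | forall i, J (v i ord0)].
  rewrite (_ : [set v | _] = \bigcap_(i in [set: 'I_k])
      (fun v : 'cV[R]_k => v i ord0) @^-1` J); last first.
    by apply/seteqP; split => v /= H i; [move=> _|]; exact: H.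
  apply: fin_bigcap_measurable => // i _; rewrite -[X in measurable X]setTI.
  exact: measurable_coord.
elim: n => [|n IH].
  rewrite expe0 /= diracE mem_set//.
  by case.
pose B := [set v : 'cV[R]_n.+1 | forall i, J (v i ord0)].
have mB : measurable B := mbox n.+1.
have mB1 : measurable_fun setT (EFin \o \1_B : 'cV[R]_n.+1 -> \bar R).
  by apply/measurable_EFinP; exact: measurable_indic.
have B0 x : (0 <= (EFin \o \1_B : 'cV[R]_n.+1 -> \bar R) x)%E by rewrite lee_fin.
apply: etrans (measure_integral_indic (lebesgue_cV R n.+1) mB) _.
apply: etrans (ge0_integral_cons mB1 B0) _.
pose B' := [set v : 'cV[R]_n | forall i, J (v i ord0)].
have mB' : measurable B' := mbox n.
rewrite expeS -IH -[X in (_ * _ X)%E]/B'.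
transitivity (\int[lebesgue_measure]_x ((\1_J x)%:E * lebesgue_cV R n B'))%E.
  apply: eq_integral => x _.
  rewrite (measure_integral_indic _ mB').
  rewrite -ge0_integralZl//; last first.
    by apply/measurable_EFinP; exact: measurable_indic.
  apply: eq_integral => v _; rewrite -EFinM !indicE -natrM mulnb; congr ((_ : bool)%:R%:E).
  apply/idP/andP => [|[]]; rewrite !inE/=.
    move=> H; split; first by have := H ord0; rewrite cons_cV0.
    by move=> i; have := H (lift ord0 i); rewrite cons_cV_lift.
  move=> Jx Jv i; case: (unliftP ord0 i) => [k|] ->; last by rewrite cons_cV0.
  by rewrite cons_cV_lift.
rewrite ge0_integralZr//; last by apply/measurable_EFinP; exact: measurable_indic.
by rewrite integral_indic// setIT.
Qed.

End lebesgue_product.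

(** * The unit cube, the integer points and the unfolding of space *)

Lemma measurable_indic_EFin d (T : measurableType d) (R : realType) (A : set T) :
  measurable A -> measurable_fun setT (fun x => (\1_A x)%:E : \bar R).
Proof. by move=> mA; apply/measurable_EFinP; exact: measurable_indic. Qed.

Section cube.
Variable R : realType.
Implicit Types n : nat.

Lemma ge0_integral_translate n (b : 'cV[R]_n) f :
  measurable_fun setT f -> (forall x, 0 <= f x)%E ->
  (\int[lebesgue_cV R n]_x f (x + b)%R = \int[lebesgue_cV R n]_x f x)%E.
Proof.
move=> mf f0; rewrite [RHS](change_of_variables_unitmx (unitmx1 R n) b)//.
rewrite det1 normr1 mul1e.
by apply: eq_integral => x _; rewrite mul1mx.
Qed.

Definition cube n : set 'cV[R]_n := [set v | forall i, 0 <= v i ord0 < 1].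

Lemma measurable_cube n : measurable (@cube n).
Proof.
rewrite (_ : @cube n = \bigcap_(i in [set: 'I_n])
    (fun v : 'cV[R]_n => v i ord0) @^-1` `[0, 1[%classic); last first.
  apply/seteqP; split => v /= H i; first by move=> _; rewrite /= in_itv; exact: H.
  by have := H i Logic.I; rewrite /= in_itv.
apply: fin_bigcap_measurable => // i _; rewrite -[X in measurable X]setTI.
by apply: measurable_coord => //; exact: measurable_itv.
Qed.

Definition mcube n : set 'cV[R]_n -> \bar R :=
  mrestr (lebesgue_cV R n) (@measurable_cube n).

HB.instance Definition _ n := Measure.on (@mcube n).

Lemma mcube_setT n : @mcube n setT = 1%E.
Proof.
rewrite /mcube /mrestr setTI.
have -> : @cube n = [set v | forall i, `[(0 : R), 1[%classic (v i ord0)].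
  by apply/seteqP; split => v /= H i; have := H i; rewrite /= in_itv.
rewrite lebesgue_cV_box; last exact: measurable_itv.
rewrite lebesgue_measure_itv/= lte_fin ltr01 sube0.
by elim: n => [|n IH]; rewrite ?expe0// expeS IH mul1e.
Qed.

Let mcube_sigma_finite n : sigma_finite setT (@mcube n).
Proof.
exists (fun=> setT); first by rewrite bigcup_const//; exists 0%N.
by move=> i; split => //; rewrite [X in (X < _)%E]mcube_setT ltry.
Qed.

HB.instance Definition _ n :=
  Measure_isSigmaFinite.Build _ _ _ (@mcube n) (@mcube_sigma_finite n).

Lemma measurable_set1_cV n (v : 'cV[R]_n) : measurable [set v].
Proof.
rewrite (_ : [set v] = \bigcap_(i in [set: 'I_n])
    (fun w : 'cV[R]_n => w i ord0) @^-1` [set v i ord0]); last first.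
  apply/seteqP; split => [w -> //|w H].
  by apply/matrixP => i j; rewrite ord1; exact: H.
apply: fin_bigcap_measurable => // i _; rewrite -[X in measurable X]setTI.
by apply: measurable_coord => //; exact: measurable_set1.
Qed.

Lemma counting_intvec_set1 n (z : 'cV[R]_n) : intvec n z ->
  counting_intvec n [set z] = 1%E.
Proof.
move=> zZ; rewrite /counting_intvec /mrestr setIidl; last by move=> ? ->.
by rewrite /counting; case: ifPn => [_|/asboolP[]//]; rewrite fset_set1 finmap.cardfs1.
Qed.

Let counting_intvec_sigma_finite n : sigma_finite setT (@counting_intvec R n).
Proof.
pose G (i : nat) : set 'cV[R]_n :=
  if (choice.unpickle i : option 'cV[int]_n) is Some m then [set map_mx intr m] else set0.
have mG i : measurable (G i).
  by rewrite /G; case: (choice.unpickle i) => [m|]; [exact: measurable_set1_cV|exact: measurable0].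
have finG i : finite_set (G i) by rewrite /G; case: (choice.unpickle i).
exists (fun i => ~` intvec n `|` G i) => [|i].
  apply/esym/seteqP; split => // v _.
  have [vZ|vZ] := pselect (intvec n v); last by exists 0%N => //; left.
  have /choice[m Hm] : forall i, exists k : int, v i ord0 = k%:~R.
    by move=> i; have /intrP[k ->] := vZ i; exists k.
  exists (choice.pickle (\col_i m i)) => //; right; rewrite /G choice.pickleK.
  by apply/matrixP => i j; rewrite !mxE ord1.
split; first by apply: measurableU => //; apply: measurableC; exact: measurable_intvec.
change (counting ((~` intvec n `|` G i) `&` intvec n) < +oo :> \bar R)%E.
rewrite setIUl setICl set0U /counting; case: ifPn => [_|/asboolP[]]; first exact: ltry.
exact: finite_setIl.
Qed.

HB.instance Definition _ n := Measure_isSigmaFinite.Build _ _ _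
  (@counting_intvec R n) (@counting_intvec_sigma_finite n).

Definition floor_cV n (x : 'cV[R]_n) : 'cV[R]_n :=
  \col_i (Num.floor (x i ord0))%:~R.

Lemma floor_cV_intvec n (x : 'cV[R]_n) : intvec n (floor_cV x).
Proof. by move=> i; rewrite mxE intr_int. Qed.

Lemma cube_sub_floor n (x : 'cV[R]_n) : cube (x - floor_cV x).
Proof.
by move=> i; rewrite !mxE subr_ge0 floor_le/= ltrBlDl -[1]/(1%:~R) -intrD floorD1_gt.
Qed.

Lemma intvec_floor_unique n (x z : 'cV[R]_n) : intvec n z -> cube (x - z) ->
  z = floor_cV x.
Proof.
move=> zZ xz; apply/matrixP => i j; rewrite ord1 mxE.
have /intrP[k zk] := zZ i; have := xz i; rewrite !mxE zk subr_ge0 ltrBlDl => /andP[kx xk].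
congr (_%:~R); apply/esym/floor_def; rewrite kx/=.
by rewrite intrD.
Qed.

Lemma counting_cube n (x : 'cV[R]_n) :
  counting_intvec n [set z | cube (x - z)] = 1%E.
Proof.
rewrite -(counting_intvec_set1 (floor_cV_intvec x)).
rewrite /counting_intvec /mrestr; congr counting.
apply/seteqP; split => z /= [xz zZ]; split => //.
- exact: intvec_floor_unique.
- by rewrite xz; exact: cube_sub_floor.
Qed.

(** Each point is in a unique way the sum of a point of the cube and an integer
    point. *)
Lemma lebesgue_unfold n (D : set 'cV[R]_n) : measurable D ->
  lebesgue_cV R n D =
  prodm (@mcube n) (@counting_intvec R n) ((fun p => p.1 + p.2) @^-1` D).
Proof.
move=> mD.
have madd : measurable_fun setT (fun p : 'cV[R]_n * 'cV[R]_n => p.1 + p.2).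
  exact: measurable_addmx.
have msub : measurable_fun setT (fun p : 'cV[R]_n * 'cV[R]_n => p.1 - p.2).
  by apply: measurable_addmx => //; apply: measurable_oppmx.
have mD' : measurable ((fun p : 'cV[R]_n * 'cV[R]_n => p.1 + p.2) @^-1` D).
  by rewrite -[X in measurable X]setTI; exact: madd.
rewrite (measure_integral_indic (lebesgue_cV R n) mD).
rewrite (measure_integral_indic (prodm (@mcube n) (@counting_intvec R n)) mD').
rewrite prodm_tonelli2//; last exact: measurable_indic_EFin.
pose h (p : 'cV[R]_n * 'cV[R]_n) : \bar R :=
  ((\1_(@cube n) (p.1 - p.2))%:E * (\1_D p.1)%:E)%E.
have mh : measurable_fun setT h.
  apply: emeasurable_funM.
    exact: (measurableT_comp (@measurable_indic_EFin _ _ R _ (@measurable_cube n)) msub).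
  exact: (measurableT_comp (@measurable_indic_EFin _ _ R _ mD) measurable_fst).
have h0 p : (0 <= h p)%E by rewrite /h -EFinM lee_fin.
transitivity (\int[counting_intvec n]_z \int[lebesgue_cV R n]_x h (x, z))%E; last first.
  apply: eq_integral => z _.
  rewrite ge0_integral_mrestr//; last first.
    by apply: (measurableT_comp (measurable_indic_EFin mD')); exact: pair2_measurable.
  rewrite -(ge0_integral_translate z); last 2 first.
  - exact: (measurableT_comp mh (pair2_measurable z)).
  - by move=> x.
  rewrite [RHS]integral_mkcond; apply: eq_integral => x _.
  rewrite /h/= addrK patchE !indicE.
  by case: (x \in cube (n:=n)); rewrite ?mul1e ?mul0e.
rewrite -(@fubini_tonelli _ _ _ _ R (lebesgue_cV R n) (@counting_intvec R n) h)//; apply: eq_integral => x _.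
rewrite /h/= ge0_integralZr//; last first.
  exact: (measurableT_comp (@measurable_indic_EFin _ _ R _ (@measurable_cube n)) (measurableT_comp msub (pair1_measurable x))).
rewrite -[LHS]mul1e; congr (_ * _)%E.
have mx : measurable [set z | cube (x - z)].
  rewrite -[X in measurable X]setTI.
  exact: (measurableT_comp msub (pair1_measurable x) measurableT (@measurable_cube n)).
by rewrite -(counting_cube x) (measure_integral_indic _ mx).
Qed.

End cube.

(** * The Fourier kernel and orthonormality of the characters *)

Section fourier_kernel.
Variable R : realType.
Implicit Types n : nat.

Lemma dotC n (x y : 'cV[R]_n) : dot x y = dot y x.
Proof. by apply: eq_bigr => i _; rewrite mulrC. Qed.

Lemma dotDl n (x y z : 'cV[R]_n) : dot (x + y) z = dot x z + dot y z.
Proof. by rewrite -big_split; apply: eq_bigr => i _; rewrite mxE mulrDl. Qed.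

Lemma dotDr n (x y z : 'cV[R]_n) : dot z (x + y) = dot z x + dot z y.
Proof. by rewrite dotC dotDl ![dot _ z]dotC. Qed.

Lemma dotNl n (x z : 'cV[R]_n) : dot (- x) z = - dot x z.
Proof. by rewrite -sumrN; apply: eq_bigr => i _; rewrite mxE mulNr. Qed.

Lemma dotZr n (a : R) (x z : 'cV[R]_n) : dot z (a *: x) = a * dot z x.
Proof. by rewrite mulr_sumr; apply: eq_bigr => i _; rewrite mxE mulrCA. Qed.

Lemma dot0r n (z : 'cV[R]_n) : dot z 0 = 0.
Proof. by apply: big1 => i _; rewrite mxE mulr0. Qed.

Lemma dot_eq0 n (x : 'cV[R]_n) : dot x x = 0 -> x = 0.
Proof.
move=> /eqP; rewrite psumr_eq0 => [/allP x0|i _]; last by rewrite -expr2 sqr_ge0.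
apply/matrixP => i j; rewrite ord1 mxE; apply/eqP.
by have := x0 i (mem_index_enum _); rewrite mulf_eq0 orbb.
Qed.

Lemma dot_intvec n (x y : 'cV[R]_n) : intvec n x -> intvec n y ->
  dot x y \is a Num.int.
Proof. by move=> xZ yZ; apply: rpred_sum => i _; exact: rpredM. Qed.

Lemma intvecB n (x y : 'cV[R]_n) : intvec n x -> intvec n y -> intvec n (x - y).
Proof. by move=> xZ yZ i; rewrite !mxE; exact: rpredB. Qed.

Lemma intvecD n (x y : 'cV[R]_n) : intvec n x -> intvec n y -> intvec n (x + y).
Proof. by move=> xZ yZ i; rewrite !mxE; exact: rpredD. Qed.

Lemma intvecN n (x : 'cV[R]_n) : intvec n x -> intvec n (- x).
Proof. by move=> xZ i; rewrite !mxE; rewrite rpredN. Qed.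

Lemma intvec0 n : intvec n (0 : 'cV[R]_n).
Proof. by move=> i; rewrite mxE rpred0. Qed.

Lemma measurable_dot n d (T : measurableType d) (f g : T -> 'cV[R]_n) :
  measurable_fun setT f -> measurable_fun setT g ->
  measurable_fun setT (fun x => dot (f x) (g x)).
Proof.
move=> mf mg; apply: measurable_sum => i; apply: measurable_funM.
  exact: (measurableT_comp (measurable_coord i ord0) mf).
exact: (measurableT_comp (measurable_coord i ord0) mg).
Qed.

Definition fker n (p : 'cV[R]_n * 'cV[R]_n) : R[i] :=
  cis (- (2 * pi * dot p.2 p.1)).

Lemma cmeas_fker n : cmeas (@fker n).
Proof.
apply: cmeas_cis; apply: measurableT_comp => //; apply: measurable_funM => //.
exact: measurable_dot.
Qed.

Lemma unimodular_fker n : unimodular (@fker n).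
Proof. by move=> p; exact: normc_cis. Qed.

Lemma fkerDl n (x y l : 'cV[R]_n) : fker (x + y, l) = fker (x, l) * fker (y, l).
Proof. by rewrite /fker/= -cisD dotDr mulrDr opprD. Qed.

Lemma fkerDr n (x l m : 'cV[R]_n) : fker (x, l + m) = fker (x, l) * fker (x, m).
Proof. by rewrite /fker/= -cisD dotDl mulrDr opprD. Qed.

Lemma fkerNr n (x l : 'cV[R]_n) : fker (x, - l) = conjC (fker (x, l)).
Proof. by rewrite /fker/= dotNl mulrN cisN. Qed.

Lemma fkerC n (x l : 'cV[R]_n) : fker (x, l) = fker (l, x).
Proof. by rewrite /fker/= dotC. Qed.

Lemma cis_2pi_nat (k : nat) : cis (2 * pi * k%:R : R) = 1.
Proof.
elim: k => [|k IH]; first by rewrite mulr0 cis0.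
rewrite -[k.+1%:R]natr1 mulrDr cisD IH mul1r mulr1 /cis mulr_natl cos2pi sin2pi.
by [].
Qed.

Lemma cis_2pi_int (t : R) : t \is a Num.int -> cis (- (2 * pi * t)) = 1.
Proof.
move=> /intrP[k ->]; case: k => k; rewrite ?NegzE.
  by rewrite cisN cis_2pi_nat conjc1.
by rewrite mulrNz mulrN opprK cis_2pi_nat.
Qed.

Lemma fker_intvec n (z l : 'cV[R]_n) : intvec n z -> intvec n l -> fker (z, l) = 1.
Proof. by move=> zZ lZ; rewrite /fker cis_2pi_int//; exact: dot_intvec. Qed.

Lemma measurable_floor_cV n d (T : measurableType d) (f : T -> 'cV[R]_n) :
  measurable_fun setT f -> measurable_fun setT (fun x => floor_cV (f x)).
Proof.
move=> mf; apply: measurable_fun_mx => i j; under eq_fun do rewrite mxE.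
have mfl : measurable_fun setT (fun r : R => (Num.floor r)%:~R : R).
  by apply: nondecreasing_measurable => // x y xy; rewrite ler_int le_floor.
apply: (measurableT_comp mfl).
exact: (measurableT_comp (measurable_coord i ord0) mf).
Qed.

Definition frac_cV n (x : 'cV[R]_n) : 'cV[R]_n := x - floor_cV x.

Lemma measurable_frac_cV n : measurable_fun setT (@frac_cV n).
Proof.
apply: measurable_addmx; first exact: measurable_id.
by apply: measurable_oppmx; exact: measurable_floor_cV.
Qed.

Lemma frac_cV_cube n (x : 'cV[R]_n) : cube x -> frac_cV x = x.
Proof.
move=> xQ; rewrite /frac_cV -(@intvec_floor_unique _ _ x 0) ?subr0//.
exact: intvec0.
Qed.

Lemma frac_cVD n (x z : 'cV[R]_n) : intvec n z -> frac_cV (x + z) = frac_cV x.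
Proof.
move=> zZ; rewrite /frac_cV -(@intvec_floor_unique _ _ (x + z) (floor_cV x + z)).
- by rewrite opprD addrACA subrr addr0.
- by apply: intvecD => //; exact: floor_cV_intvec.
- by rewrite opprD addrACA subrr addr0; exact: cube_sub_floor.
Qed.

Lemma ge0_integral_unfold n (f : 'cV[R]_n -> \bar R) :
  measurable_fun setT f -> (forall x, 0 <= f x)%E ->
  (\int[lebesgue_cV R n]_x f x =
   \int[@mcube R n]_x \int[counting_intvec n]_z f (x + z)%R)%E.
Proof.
move=> mf f0.
have madd : measurable_fun setT (fun p : 'cV[R]_n * 'cV[R]_n => p.1 + p.2).
  exact: measurable_addmx.
rewrite (ge0_integral_transport (mX := prodm (@mcube R n) (@counting_intvec R n))
  madd (@lebesgue_unfold R n))// prodm_tonelli1//.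
exact: (measurableT_comp mf madd).
Qed.

Lemma ae_intvec n : {ae @counting_intvec R n, forall z, intvec n z}.
Proof.
exists (~` intvec n); split => //; first by apply: measurableC; exact: measurable_intvec.
change (counting (~` (intvec n : set 'cV[R]_n) `&` intvec n) = 0 :> \bar R)%E.
by rewrite setICl measure0.
Qed.

Lemma ae_cube n : {ae @mcube R n, forall z, cube z}.
Proof.
exists (~` @cube R n); split => //; first by apply: measurableC; exact: measurable_cube.
change (lebesgue_cV R n (~` @cube R n `&` @cube R n) = 0 :> \bar R)%E.
by rewrite setICl measure0.
Qed.

Lemma counting_cubeD n (x : 'cV[R]_n) :
  counting_intvec n [set z | cube (x + z)] = 1%E.
Proof.
rewrite -(counting_intvec_set1 (intvecN (floor_cV_intvec x))).
change (counting ([set z | cube (x + z)%R] `&` intvec n) =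
  counting ([set (- floor_cV x)%R] `&` intvec n) :> \bar R)%E; congr counting.
apply/seteqP; split => z /= [xz zZ]; split => //.
- rewrite -[z]opprK; congr (- _); apply: intvec_floor_unique; first exact: intvecN.
  by rewrite opprK.
- by rewrite xz; exact: cube_sub_floor.
Qed.

(** The translation of the torus, read on the cube. The integral over a
    translated cube is unfolded over the integer points, of which exactly one
    contributes for each point of the cube. *)
Lemma mcube_translate n (h : 'cV[R]_n) (D : set 'cV[R]_n) : measurable D ->
  @mcube R n D = mcube ((fun x => frac_cV (x + h)) @^-1` D).
Proof.
move=> mD.
have mG : measurable_fun setT (fun x => (\1_D (frac_cV x))%:E : \bar R).
  exact: (measurableT_comp (@measurable_indic_EFin _ _ R _ mD) (@measurable_frac_cV n)).
have mh : measurable_fun setT (fun x : 'cV[R]_n => x + h).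
  by apply: measurable_addmx.
have mQ := @measurable_cube R n.
have mD' : measurable ((fun x => frac_cV (x + h)) @^-1` D).
  rewrite -[X in measurable X]setTI.
  exact: (measurableT_comp (@measurable_frac_cV n) mh measurableT mD).
rewrite (measure_integral_indic (@mcube R n) mD).
rewrite (measure_integral_indic (@mcube R n) mD').
transitivity (\int[lebesgue_cV R n]_x
    ((\1_(@cube R n) (x - h)%R)%:E * (\1_D (frac_cV x))%:E))%E; last first.
  rewrite ge0_integral_mrestr//; last exact: measurable_indic_EFin.
  have mh' : measurable_fun setT (fun x : 'cV[R]_n => x - h) by apply: measurable_addmx.
  rewrite -(ge0_integral_translate h); last 2 first.
  - apply: emeasurable_funM => //.
    exact: (measurableT_comp (@measurable_indic_EFin _ _ R _ mQ) mh').
  - by move=> x; rewrite -EFinM lee_fin.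
  rewrite [RHS]integral_mkcond; apply: eq_integral => x _.
  rewrite addrK patchE !indicE.
  by case: (x \in cube (n:=n)); rewrite ?mul1e ?mul0e.
have mf : measurable_fun setT (fun x : 'cV[R]_n =>
    (\1_(@cube R n) (x - h)%R)%:E * (\1_D (frac_cV x))%:E : \bar R)%E.
  apply: emeasurable_funM => //.
  by apply: (measurableT_comp (@measurable_indic_EFin _ _ R _ mQ)); apply: measurable_addmx.
rewrite ge0_integral_unfold//.
apply: ge0_ae_eq_integral => //.
- exact: measurable_indic_EFin.
- pose g (p : 'cV[R]_n * 'cV[R]_n) :=
    ((\1_(@cube R n) (p.1 + p.2 - h)%R)%:E * (\1_D (frac_cV (p.1 + p.2)))%:E : \bar R)%E.
  apply: (@measurable_fun_fubini_tonelli_F _ _ _ _ R (@counting_intvec R n) g).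
    by apply: (measurableT_comp mf); apply: measurable_addmx.
  by move=> p; rewrite /g -EFinM lee_fin.
- by move=> x _; apply: integral_ge0 => z _; rewrite -EFinM lee_fin.
apply: filterS (@ae_cube n) => x xQ _.
transitivity (\int[counting_intvec n]_z
    ((\1_[set z | cube (x - h + z)%R] z)%:E * (\1_D x)%:E))%E.
  have mz : measurable [set z | cube (x - h + z)].
    rewrite -[X in measurable X]setTI.
    by apply: (_ : measurable_fun setT (fun z => x - h + z)) => //; apply: measurable_addmx.
  rewrite ge0_integralZr//; last exact: measurable_indic_EFin.
  rewrite [X in (X * _)%E](_ : _ = 1%E) ?mul1e//.
  rewrite -(counting_cubeD (x - h)); apply/esym.
  exact: (measure_integral_indic (@counting_intvec R n) mz).
apply: ae_eq_integral => //.
- apply: emeasurable_funM => //; apply: measurable_indic_EFin.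
  rewrite -[X in measurable X]setTI.
  by apply: (_ : measurable_fun setT (fun z => x - h + z)) => //; apply: measurable_addmx.
- by apply: (measurableT_comp mf); apply: measurable_addmx.
apply: filterS (@ae_intvec n) => z zZ _.
by rewrite frac_cVD// frac_cV_cube// addrAC.
Qed.

(** The translation by [h] preserves the measure of the cube and multiplies the
    character by [-1], since [dot h l] is one half. *)
Lemma integral_fker_eq0 n (l : 'cV[R]_n) : intvec n l -> l != 0 ->
  cintegral (@mcube R n) setT (fun x => fker (x, l)) = 0.
Proof.
move=> lZ l0; have ll0 : dot l l != 0 by apply: contra_neq l0; exact: dot_eq0.
pose h := (2 * dot l l)^-1 *: l.
have mh : measurable_fun setT (fun x : 'cV[R]_n => frac_cV (x + h)).
  by apply: (measurableT_comp (@measurable_frac_cV n)); apply: measurable_addmx.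
have ml : cmeas (fun x => fker (x, l)) := cmeas_fst l (@cmeas_fker n).
have := cintegral_transport mh (mcube_translate h) ml.
rewrite (_ : _ \o _ = fun x => -1 * fker (x, l)); last first.
  apply/funext => x /=; rewrite /frac_cV fkerDl [X in _ * X](_ : _ = 1) ?mulr1.
    rewrite fkerDl mulrC; congr (_ * _).
    rewrite /fker/= /h dotZr cisN.
    have -> : 2 * pi * ((2 * dot l l)^-1 * dot l l) = pi :> R by field.
    by rewrite /cis cospi sinpi; apply: complex_eqP; rewrite /= ?oppr0.
  by rewrite fker_intvec//; apply: intvecN; exact: floor_cV_intvec.
rewrite cintegralZl; last first.
  split => //; under eq_integral do rewrite unimodular_fker.
  rewrite (@integral_cst _ _ _ (@mcube R n) _ measurableT 1%E).
  by rewrite [X in (_ * X)%E](@mcube_setT R n) mule1 ltry.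
move=> /eqP; rewrite mulN1r -subr_eq0 opprK -mulr2n => /eqP I2.
have : (2%:R : R[i]) * cintegral (@mcube R n) setT (fun x => fker (x, l)) = 0.
  by rewrite mulr_natl.
by move=> /eqP; rewrite mulf_eq0 pnatr_eq0/= => /eqP.
Qed.

End fourier_kernel.

Section fourier_series.
Variables (R : realType) (n : nat).
Local Notation V := 'cV[R]_n.
Local Notation Q := (@mcube R n).
Local Notation Z := (@counting_intvec R n).
Let E : V * V -> R[i] := @fker R n.
Let mE : cmeas E := @cmeas_fker R n.
Let uE : unimodular E := @unimodular_fker R n.
Let mEd : cmeas (dual_kernel E) := cmeas_dual_kernel mE.
Let uEd : unimodular (dual_kernel E) := unimodular_dual_kernel uE.
Local Notation check := (transform Z (dual_kernel E)).

Lemma integral_mcube_cst (r : \bar R) : (\int[Q]_x r = r)%E.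
Proof.
by rewrite (integral_cst Q measurableT) [X in (_ * X)%E](@mcube_setT R n) mule1.
Qed.

Lemma cint_mcube_bounded (f : V -> R[i]) (M : R) : cmeas f ->
  (forall x, normc (f x) <= M) -> cint Q f.
Proof.
move=> mf fM; apply: (@le_cint _ _ _ _ _ (fun=> M)) => //.
by rewrite integral_mcube_cst ltry.
Qed.

Lemma N2_mcube_bounded (f : V -> R[i]) (M : R) : cmeas f ->
  (forall x, normc (f x) <= M) -> (N2 Q f <= (M ^+ 2)%:E)%E.
Proof.
move=> mf fM; rewrite -[leRHS]integral_mcube_cst; apply: le_integral_real => //.
- exact: measurable_sqr_normc.
- by move=> x; rewrite sqr_ge0.
- by move=> x; rewrite ler_pXn2r// nnegrE ?normc_ge0// (le_trans _ (fM x))// normc_ge0.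
Qed.

Lemma cmeas_set1 (k : V) : cmeas (fun z : V => Complex (\1_[set k] z) 0 : R[i]).
Proof.
by apply: cmeas_real; apply: measurable_indic; exact: measurable_set1_cV.
Qed.

Lemma cint_set1 (k : V) : intvec n k -> cint Z (fun z => Complex (\1_[set k] z) 0).
Proof.
move=> kZ; split; first exact: cmeas_set1.
under eq_integral do rewrite normc_real ger0_norm//.
rewrite -measure_integral_indic; last exact: measurable_set1_cV.
by rewrite [X in (X < _)%E](counting_intvec_set1 kZ) ltry.
Qed.

Lemma cintegral_set1 (k : V) : intvec n k ->
  cintegral Z setT (fun z => Complex (\1_[set k] z) 0) = 1.
Proof.
move=> kZ; apply: complex_eqP => /=; rewrite /Rintegral.
  rewrite -measure_integral_indic; last exact: measurable_set1_cV.
  by rewrite [X in fine X](counting_intvec_set1 kZ).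
by rewrite integral0.
Qed.

Lemma cintegral_counting_pick (g : V -> R[i]) (k : V) : intvec n k -> cmeas g ->
  (forall z, intvec n z -> z != k -> g z = 0) -> cintegral Z setT g = g k.
Proof.
move=> kZ mg gk; have ki := cint_set1 kZ.
transitivity (cintegral Z setT (fun z => g k * Complex (\1_[set k] z) 0)).
  apply: ae_eq_cintegral => //.
    by apply: cmeasM; [exact: cmeas_cst|exact: cmeas_set1].
  apply: filterS (@ae_intvec R n) => z zZ.
  have [->|zk] := eqVneq z k.
    by rewrite indicE mem_set// -[Complex _ _]/(1 : R[i]) mulr1.
  rewrite gk// indicE memNset; last exact/eqP.
  by rewrite -[Complex _ _]/(0 : R[i]) mulr0.
by rewrite cintegralZl// cintegral_set1// mulr1.
Qed.

Lemma check_bounded a : cint Z a -> exists2 M : R, 0 <= M &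
  forall x, normc (check a x) <= M.
Proof. exact: normc_transform_bounded. Qed.

Lemma cmeas_check a : cmeas a -> cmeas (check a).
Proof. exact: cmeas_transform. Qed.

Lemma cint_check a : cint Z a -> cint Q (check a).
Proof.
move=> ai; have [M _ aM] := check_bounded ai.
by apply: cint_mcube_bounded aM; apply: cmeas_check; exact: ai.1.
Qed.

Lemma integral_fkerE (k l : V) : intvec n k -> intvec n l ->
  cintegral Q setT (fun x => conjC (E (x, k)) * E (x, l)) = (l == k)%:R.
Proof.
move=> kZ lZ; under eq_fun do rewrite -fkerNr mulrC -fkerDr.
have [->|lk] := eqVneq l k; last first.
  by apply: integral_fker_eq0; [exact: intvecB|rewrite subr_eq0].
rewrite subrr (_ : (fun x => _) = fun=> 1); last first.
  by apply/funext => x; rewrite /fker/= dotC dot0r mulr0 oppr0 cis0.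
apply: complex_eqP => /=; rewrite /Rintegral; last by rewrite integral0.
by rewrite integral_mcube_cst.
Qed.

(** The characters are orthonormal on the cube. Pairing [check a] with one
    character moves the transform onto the character, whose transform is the
    indicator of one integer point. *)
Lemma transform_check a (k : V) : cint Z a -> intvec n k ->
  transform Q E (check a) k = a k.
Proof.
move=> ai kZ; pose f x := conjC (E (x, k)).
have mEk : cmeas (fun x => E (x, k)) := cmeas_fst k mE.
have mf : cmeas f by exact: cmeasJ.
have fi : cint Q f.
  by apply: (@cint_mcube_bounded _ 1) => // x; rewrite normc_conj uE.
have ci : cint Q (fun x => check a x * E (x, k)).
  apply: (@cintM_bounded _ _ _ _ _ _ 1) => //; first exact: cint_check.
  by move=> x; rewrite uE.
apply: (can_inj (@conjcK R)).
rewrite /transform -cintegralJ//.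
transitivity (cintegral Q setT (fun x => f x * conjC (check a x))).
  by congr cintegral; apply/funext => x; rewrite rmorphM mulrC.
rewrite (transform_pairing mE uE fi ai).
rewrite (@cintegral_counting_pick _ k)//.
- by rewrite /transform integral_fkerE// eqxx mul1r.
- apply: cmeasM; first exact: cmeas_transform.
  by apply: cmeasJ; exact: ai.1.
- move=> z zZ zk; rewrite /transform integral_fkerE//.
  by rewrite (negbTE zk) mul0r.
Qed.

Lemma Re_cintegral_mul_conj d (T : measurableType d)
    (mu : {measure set T -> \bar R}) (f : T -> R[i]) :
  Re (cintegral mu setT (fun x => f x * conjC (f x))) = fine (N2 mu f).
Proof.
by rewrite /=; congr fine; apply: eq_integral => x _; rewrite mul_conjcE.
Qed.

(** The isometry from square summable families on the integer points to the
    cube: it follows from the inversion formula by the pairing. *)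
Lemma plancherel_integer_cube : plancherel Z Q (dual_kernel E).
Proof.
move=> a ai aoo; have [M M0 aM] := check_bounded ai.
have mc : cmeas (check a) by apply: cmeas_check; exact: ai.1.
have coo : (N2 Q (check a) < +oo)%E.
  exact: le_lt_trans (N2_mcube_bounded mc aM) (ltry _).
rewrite -(N2_fineK coo) -(N2_fineK aoo); congr EFin.
rewrite -!Re_cintegral_mul_conj.
rewrite (transform_pairing mE uE (cint_check ai) ai); congr Re.
apply: ae_eq_cintegral.
- apply: cmeasM; first exact: cmeas_transform.
  by apply: cmeasJ; exact: ai.1.
- by apply: cmeasM; [exact: ai.1|apply: cmeasJ; exact: ai.1].
- by apply: filterS (@ae_intvec R n) => k kZ; rewrite transform_check.
Qed.

End fourier_series.

(** * Density of the trigonometric polynomials *)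

Section step_polynomial.
Variable R : realType.
Implicit Types u v s : R.

(** The polynomials [(1 - (1 - u) ^+ N) ^+ (2 ^ M)], with [N] and [M] tuned to
    each other, converge on the unit interval to the indicator of [1/2 <= u],
    as in the elementary proof of the Stone-Weierstrass theorem. The exponents
    are [N = j ^ 2] and [M = j ^ 2 - j]: then [2 ^ M * (1 - u) ^+ N] is at most
    [2 ^ -j] when [u] is at least one half, and tends to infinity when [u] is
    less. *)
Definition step_poly (j : nat) u : R :=
  (1 - (1 - u) ^+ (j * j)) ^+ (2 ^ (j * j - j)).

Lemma bernoulli_ge (x : R) m : -1 <= x -> 1 + m%:R * x <= (1 + x) ^+ m.
Proof.
move=> x1; elim: m => [|m IH]; first by rewrite mul0r addr0 expr0.
rewrite exprS; have : (1 + x) * (1 + m%:R * x) <= (1 + x) * (1 + x) ^+ m.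
  by rewrite ler_wpM2l//; lra.
apply: le_trans; rewrite -[m.+1%:R]natr1.
have : 0 <= m%:R * (x * x) by rewrite mulr_ge0// -expr2 sqr_ge0.
lra.
Qed.

Lemma step_poly_itv j u : 0 <= u <= 1 -> 0 <= step_poly j u <= 1.
Proof.
move=> /andP[u0 u1].
have /andP[v0 v1] : 0 <= (1 - u) ^+ (j * j) <= 1.
  by rewrite exprn_ge0 ?exprn_ile1//; lra.
by rewrite /step_poly exprn_ge0 ?exprn_ile1//; lra.
Qed.

Lemma near_half_expn (e : R) : 0 < e -> \forall j \near \oo, (2^-1 : R) ^+ j <= e.
Proof.
move=> e0; have : ((GRing.exp (2^-1 : R) : R^nat) @ \oo --> (0 : R)).
  by apply: cvg_expr; rewrite ger0_norm ?invr_ge0// invf_lt1// ltr1n.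
move=> /cvgrPdist_le/(_ _ e0); apply: filterS => j.
by rewrite sub0r normrN ger0_norm// exprn_ge0// invr_ge0.
Qed.

(** Bernoulli's inequality is used twice: directly on the side of the limit 1,
    and on the other side through [(1 - s) ^+ m * (1 + m * s) <= (1 - s ^+ 2)
    ^+ m <= 1]. *)
Lemma step_poly_cvg u : 0 <= u <= 1 -> forall e : R, 0 < e ->
  \forall j \near \oo, `|step_poly j u - (2^-1 <= u)%R%:R| <= e.
Proof.
move=> /andP[u0 u1] e e0; set v := 1 - u.
have v0 : 0 <= v by rewrite /v; lra.
have v1 : v <= 1 by rewrite /v; lra.
have expM j : (2 ^ (j * j - j))%:R = (2 : R) ^+ (j * j - j) by rewrite natrX.
have jj j : (j <= j * j)%N by case: j => // j; rewrite leq_pmulr.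
have half2 k : (2 : R) ^+ k * 2^-1 ^+ k = 1.
  by rewrite -exprMn mulfV// expr1n.
have [uh|uh] := leP 2^-1 u.
  have vh : v <= 2^-1 by rewrite /v; lra.
  apply: filterS (near_half_expn e0) => j; apply: le_trans.
  have /andP[s0 s1] := @step_poly_itv j u ltac:(by rewrite u0 u1).
  rewrite ler0_norm ?subr_le0// opprB lerBlDr -lerBlDl.
  have v2 : - 1 <= - v ^+ (j * j).
    by rewrite lerN2 exprn_ile1.
  apply: le_trans (bernoulli_ge (2 ^ (j * j - j)) v2).
  rewrite mulrN lerB// expM.
  apply: (@le_trans _ _ (2 ^+ (j * j - j) * 2^-1 ^+ (j * j))).
    by rewrite ler_wpM2l ?exprn_ge0// lerXn2r// nnegrE// invr_ge0.
  by rewrite -{2}(subnK (jj j)) exprD mulrA half2 mul1r.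
have vh : 2^-1 < v by rewrite /v; lra.
have vp : 0 < v by lra.
have w1 : `|(2 * v)^-1| < 1.
  by rewrite ger0_norm ?invr_ge0 ?mulr_ge0// invf_lt1; lra.
have w4 : 0 < (2 * v)^-1 / 4 by rewrite divr_gt0// invr_gt0 mulr_gt0.
have /cvgrPdist_le/(_ _ w4) := @cvg_expr R _ w1.
apply: filterS3 (near_half_expn e0) (nbhs_infty_gt 0) => j je j0 jw.
apply: le_trans je; rewrite subr0.
have /andP[s0 s1] := @step_poly_itv j u ltac:(by rewrite u0 u1).
rewrite ger0_norm//.
set s := v ^+ (j * j); set m := (2 ^ (j * j - j))%N.
have sp : 0 <= s by rewrite exprn_ge0.
have s1' : s <= 1 by rewrite exprn_ile1.
have ms : 2 ^+ j <= m%:R * s.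
  have NE : (j * j - j = j.-1 * j)%N by rewrite -{3}[j]mul1n -mulnBl subn1.
  rewrite /m /s expM -[X in v ^+ X](subnK (jj j)) exprD mulrA -exprMn NE exprM -exprMn.
  rewrite lerXn2r// ?nnegrE ?mulr_ge0 ?exprn_ge0 ?mulr_ge0//.
  have : 4 <= (2 * v) ^+ j.-1.
    have := jw; rewrite sub0r normrN ger0_norm; last by rewrite exprn_ge0// invr_ge0 mulr_ge0.
    rewrite -{1}(prednK j0) exprS ler_pM2l ?invr_gt0 ?mulr_gt0// exprVn.
    by rewrite lef_pV2 ?posrE ?exprn_gt0 ?mulr_gt0.
  set t := (2 * v) ^+ _ => t4.
  have : 4 * 2^-1 <= t * v by rewrite ler_pM// ltW.
  lra.
have rms : step_poly j u * (1 + m%:R * s) <= 1.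
  apply: (@le_trans _ _ ((1 - s) ^+ m * (1 + s) ^+ m)).
    by rewrite ler_wpM2l// bernoulli_ge//; lra.
  rewrite -exprMn exprn_ile1//.
    by rewrite mulr_ge0//; lra.
  by rewrite -subr_sqr expr1n lerBlDr lerDl sqr_ge0.
have : step_poly j u * 2 ^+ j <= 1.
  by apply: le_trans rms; rewrite ler_wpM2l// ler_wpDl.
by rewrite exprVn -ler_pdivlMr ?exprn_gt0// mul1r.
Qed.

End step_polynomial.

Section trigonometric_approximation.
Variables (R : realType) (n : nat).
Local Notation V := 'cV[R]_n.
Local Notation Q := (@mcube R n).
Local Notation Z := (@counting_intvec R n).
Local Notation E := (@fker R n).
Local Notation check := (transform Z (dual_kernel E)).
Implicit Types (p q f g : V -> R[i]).

Lemma dual_fkerE (k x : V) : dual_kernel E (k, x) = E (x, - k).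
Proof. by rewrite fkerNr. Qed.

Inductive trig : (V -> R[i]) -> Prop :=
| trig_char c k of intvec n k : trig (fun x => c * E (x, k))
| trigD p q of trig p & trig q : trig (fun x => p x + q x).

Lemma trig_cst c : trig (fun=> c).
Proof.
rewrite (_ : (fun=> c) = fun x => c * E (x, 0)).
  by apply: trig_char; exact: intvec0.
by apply/funext => x; rewrite /fker/= dotC dot0r mulr0 oppr0 cis0 mulr1.
Qed.

Lemma trigM p q : trig p -> trig q -> trig (fun x => p x * q x).
Proof.
move=> tp; elim: tp q => {p} [c k kZ q|p p' _ IHp _ IHp' q tq].
  elim=> {q} [d l lZ|q q' _ IHq _ IHq'].
    rewrite (_ : (fun _ => _) = fun x => (c * d) * E (x, k + l)).
      by apply: trig_char; exact: intvecD.
    by apply/funext => x; rewrite fkerDr; ring.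
  rewrite (_ : (fun _ => _) = fun x => c * E (x, k) * q x + c * E (x, k) * q' x).
    exact: trigD.
  by apply/funext => x; rewrite mulrDr.
rewrite (_ : (fun _ => _) = fun x => p x * q x + p' x * q x).
  by apply: trigD; [exact: IHp|exact: IHp'].
by apply/funext => x; rewrite mulrDl.
Qed.

Lemma cmeas_trig p : trig p -> cmeas p.
Proof.
elim=> {p} [c k kZ|p q _ mp _ mq]; last exact: cmeasD.
by apply: cmeasM; [exact: cmeas_cst|exact: (cmeas_fst k (@cmeas_fker R n))].
Qed.

Lemma N2_set1_lty (k : V) : intvec n k ->
  (N2 Z (fun z => Complex (\1_[set k] z) 0)%R < +oo)%E.
Proof.
move=> kZ; rewrite (_ : N2 _ _ = Z [set k]).
  by rewrite [X in (X < _)%E](counting_intvec_set1 kZ) ltry.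
rewrite (measure_integral_indic Z (@measurable_set1_cV R n k)).
apply: eq_integral => z _; rewrite normc_real indicE.
by case: (z \in _); rewrite ?normr1 ?expr1n// normr0 expr0n.
Qed.

(** A character is the inverse transform of the indicator of one integer point.
    *)
Lemma trig_check p : trig p ->
  exists a, [/\ cint Z a, (N2 Z a < +oo)%E & forall x, p x = check a x].
Proof.
have mEd := cmeas_dual_kernel (@cmeas_fker R n).
elim=> {p} [c k kZ|p q _ [a [ai aoo pa]] _ [b [bi boo qb]]].
  have kZ' := intvecN kZ; have ki := cint_set1 kZ'.
  exists (fun z => c * Complex (\1_[set - k] z) 0); split.
  - exact: cintZl.
  - rewrite N2Z; last exact: ki.1.
    by rewrite lte_mul_pinfty// ?lee_fin ?sqr_ge0//; exact: N2_set1_lty.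
  - move=> x; rewrite /transform (@cintegral_counting_pick _ _ _ (- k))//.
    + by rewrite indicE mem_set// -[Complex _ _]/(1 : R[i]) mulr1 dual_fkerE opprK.
    + apply: cmeasM; first by apply: cmeasM; [exact: cmeas_cst|exact: ki.1].
      exact: (cmeas_fst x mEd).
    + move=> z _ zk; rewrite indicE memNset; last exact/eqP.
      by rewrite -[Complex _ _]/(0 : R[i]) mulr0 mul0r.
exists (fun z => a z + b z); split.
- exact: cintD.
- by apply: N2D_lty => //; [exact: ai.1|exact: bi.1].
move=> x; rewrite pa qb /transform -cintegralD.
- by congr cintegral; apply/funext => z; rewrite mulrDl.
- apply: (@cintM_bounded _ _ _ _ _ _ 1) => //; first exact: (cmeas_fst x mEd).
  by move=> z; rewrite (unimodular_dual_kernel (@unimodular_fker R n)).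
- apply: (@cintM_bounded _ _ _ _ _ _ 1) => //; first exact: (cmeas_fst x mEd).
  by move=> z; rewrite (unimodular_dual_kernel (@unimodular_fker R n)).
Qed.

Definition approximable f := cmeas f /\ forall e : R, 0 < e ->
  exists2 p, trig p & (N2 Q (fun x => f x - p x)%R <= e%:E)%E.

Lemma approximable_trig p : trig p -> approximable p.
Proof.
move=> tp; split => [|e e0]; first exact: cmeas_trig.
exists p => //; rewrite [leLHS](_ : _ = 0%E) ?lee_fin ?ltW//.
by apply: integral0_eq => x _; rewrite subrr ComplexField.Normc.normc0 expr0n.
Qed.

Lemma approximable_lim f : cmeas f ->
  (forall e : R, 0 < e -> exists2 g, approximable g &
    (N2 Q (fun x => f x - g x)%R <= e%:E)%E) -> approximable f.
Proof.
move=> mf H; split => // e e0; have e4 : 0 < e / 4 by rewrite divr_gt0.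
have [g [mg gA] fg] := H _ e4; have [p tp gp] := gA _ e4.
exists p => //; have mp := cmeas_trig tp.
rewrite (_ : (fun x => _) = fun x => (f x - g x) + (g x - p x)); last first.
  by apply/funext => x; ring.
have m1 : cmeas (fun x => f x - g x) by exact: cmeasB.
have m2 : cmeas (fun x => g x - p x) by exact: cmeasB.
apply: (le_trans (N2D_le Q m1 m2)).
have oo1 := le_lt_trans fg (ltry _); have oo2 := le_lt_trans gp (ltry _).
move: fg gp; rewrite -(N2_fineK oo1) -(N2_fineK oo2) -!EFinM -EFinD !lee_fin.
lra.
Qed.

Lemma approximableD f g : approximable f -> approximable g ->
  approximable (fun x => f x + g x).
Proof.
move=> [mf fA] [mg gA]; split => [|e e0]; first exact: cmeasD.
have e4 : 0 < e / 4 by rewrite divr_gt0.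
have [p tp fp] := fA _ e4; have [q tq gq] := gA _ e4.
exists (fun x => p x + q x); first exact: trigD.
have mp := cmeas_trig tp; have mq := cmeas_trig tq.
rewrite (_ : (fun x => _) = fun x => (f x - p x) + (g x - q x)); last first.
  by apply/funext => x; ring.
have m1 : cmeas (fun x => f x - p x) by exact: cmeasB.
have m2 : cmeas (fun x => g x - q x) by exact: cmeasB.
apply: (le_trans (N2D_le Q m1 m2)).
have oo1 := le_lt_trans fp (ltry _); have oo2 := le_lt_trans gq (ltry _).
move: fp gq; rewrite -(N2_fineK oo1) -(N2_fineK oo2) -!EFinM -EFinD !lee_fin.
lra.
Qed.

Lemma approximableZ c f : approximable f -> approximable (fun x => c * f x).
Proof.
move=> [mf fA]; split => [|e e0]; first by apply: cmeasM => //; exact: cmeas_cst.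
have c1 : 0 < normc c ^+ 2 + 1 by rewrite ltr_wpDl// sqr_ge0.
have ec : 0 < e / (normc c ^+ 2 + 1) by rewrite divr_gt0.
have [p tp fp] := fA _ ec; have mp := cmeas_trig tp.
exists (fun x => c * p x); first by apply: trigM => //; exact: trig_cst.
rewrite (_ : (fun x => _) = fun x => c * (f x - p x)); last first.
  by apply/funext => x; ring.
rewrite N2Z; last exact: cmeasB.
apply: (@le_trans _ _ ((normc c ^+ 2)%:E * (e / (normc c ^+ 2 + 1))%:E)%E).
  by apply: lee_wpmul2l => //; rewrite lee_fin sqr_ge0.
rewrite -EFinM lee_fin mulrCA ler_piMr ?(ltW e0)// ler_pdivrMr// mul1r; lra.
Qed.

Lemma approximableB f g : approximable f -> approximable g ->
  approximable (fun x => f x - g x).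
Proof.
move=> fA gA; rewrite (_ : (fun x => _) = fun x => f x + (-1) * g x).
  by apply: approximableD => //; exact: approximableZ.
by apply/funext => x; rewrite mulN1r.
Qed.

Lemma approximable_sum (I : Type) (s : seq I) (F : I -> V -> R[i]) :
  (forall i, approximable (F i)) -> approximable (fun x => \sum_(i <- s) F i x).
Proof.
move=> FA; elim: s => [|i s IH].
  by under eq_fun do rewrite big_nil; apply: approximable_trig; exact: trig_cst.
by under eq_fun do rewrite big_cons; exact: approximableD.
Qed.

(** Dominated convergence on the cube. *)
Lemma approximable_cvg (F : (V -> R[i])^nat) f (G : V -> R) :
  (forall j, approximable (F j)) -> cmeas f ->
  measurable_fun setT G -> (\int[Q]_x (G x)%:E < +oo)%E ->
  (forall j x, normc (f x - F j x) ^+ 2 <= G x) ->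
  (forall x, cube x -> forall e : R, 0 < e ->
    \forall j \near \oo, normc (f x - F j x) <= e) ->
  approximable f.
Proof.
move=> FA mf mG Goo FG Ff; apply: approximable_lim => // e e0.
have mFj j : cmeas (fun x => f x - F j x) by apply: cmeasB => //; exact: (FA j).1.
pose h j x := (normc (f x - F j x) ^+ 2)%:E.
have mh j : measurable_fun setT (h j).
  by apply/measurable_EFinP; exact: measurable_sqr_normc.
have G0 x : 0 <= G x by apply: le_trans (FG 0%N x); rewrite sqr_ge0.
have Gi : Q.-integrable setT (EFin \o G).
  by apply: (integral_real_lty mG mG _ Goo) => x; rewrite ger0_norm.
have hcvg : {ae Q, forall x, setT x -> h ^~ x @ \oo --> 0%E}.
  apply: filterS (@ae_cube R n) => x xQ _.
  apply: cvg_EFin; first by apply: nearW.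
  apply/cvgrPdist_le => d d0; have sd : 0 < Num.sqrt d by rewrite sqrtr_gt0.
  apply: filterS (Ff x xQ _ sd) => j fFj.
  rewrite /h/= sub0r normrN ger0_norm ?sqr_ge0// -(sqr_sqrtr (ltW d0)).
  by rewrite lerXn2r// ?nnegrE ?normc_ge0// sqrtr_ge0.
have hG : {ae Q, forall x n, setT x -> (`|h n x| <= (EFin \o G) x)%E}.
  apply: aeW => x j _; rewrite gee0_abs ?lee_fin ?sqr_ge0//.
have [_ _] := dominated_convergence measurableT mh (measurable_cst _) hcvg Gi hG.
rewrite integral0 => hlim.
have [j _ /(_ j (leqnn j)) Hj] : \forall j \near \oo, (\int[Q]_x h j x < e%:E)%E.
  apply: (hlim (fun y => y < e%:E)%E); exact: open_ereal_lt'.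
by exists (F j) => //; exact: ltW.
Qed.

(** On the cube, this trigonometric polynomial in the coordinate [x i] is at
    least one half exactly when [x i <= b]: both sines are nonnegative when [0
    <= x i <= b], and the second one is negative when [b < x i < 1]. For [b]
    outside the unit interval a constant has the same effect. *)
Definition coord_phase (b : R) (i : 'I_n) (x : V) : R :=
  if b < 0 then 0 else if 1 <= b then 1 else
  2^-1 + 2^-1 * (sin (pi * x i ord0) * sin (pi * (b - x i ord0))).

Lemma coord_phase_itv b i x : 0 <= coord_phase b i x <= 1.
Proof.
rewrite /coord_phase; case: ifP => _; first by rewrite lexx ler01.
case: ifP => _; first by rewrite lexx ler01.
set s := sin _; set t := sin _.
have : `|s * t| <= 1.
  by rewrite normrM mulr_ile1// ler_norml ?sin_geN1 ?sin_le1.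
rewrite ler_norml => /andP[st1 st2]; lra.
Qed.

Lemma coord_phase_half b i x : cube x ->
  (2^-1 <= coord_phase b i x) = (x i ord0 <= b).
Proof.
move=> /(_ i) /andP[x0 x1]; rewrite /coord_phase.
have [b0|b0] := ltP b 0.
  by rewrite leNgt invr_gt0 ltr0n/=; apply/esym/negbTE; rewrite -ltNge; lra.
have [b1|b1] := leP 1 b.
  by rewrite invf_le1// ler1n (le_trans (ltW x1) b1).
have pi0 := pi_gt0 R.
rewrite lerDl pmulr_rge0 ?invr_gt0//.
have [xb|xb] := leP (x i ord0) b.
  apply: mulr_ge0; apply: sin_ge0_pi; apply/andP; split.
  - by rewrite mulr_ge0// ltW.
  - by rewrite ler_piMr ?(ltW pi0)// ltW.
  - by rewrite mulr_ge0 ?subr_ge0// ltW.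
  - by rewrite ler_piMr ?(ltW pi0)//; lra.
apply/negbTE; rewrite -ltNge pmulr_rlt0.
  rewrite -[b - _]opprB mulrN sinN oppr_lt0 sin_gt0_pi//.
  by rewrite mulr_gt0 ?subr_gt0// gtr_pMr//; lra.
by apply: sin_gt0_pi; rewrite mulr_gt0 ?gtr_pMr//; lra.
Qed.

Definition rtrig (p : V -> R) := trig (fun x => Complex (p x) 0).

Lemma rtrig_cst (r : R) : rtrig (fun=> r).
Proof. exact: trig_cst. Qed.

Lemma rtrigD (p q : V -> R) : rtrig p -> rtrig q -> rtrig (fun x => p x + q x).
Proof.
move=> tp tq; have := trigD tp tq; congr trig; apply/funext => x.
by apply: complex_eqP; rewrite /= ?addr0.
Qed.

Lemma rtrigM (p q : V -> R) : rtrig p -> rtrig q -> rtrig (fun x => p x * q x).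
Proof.
move=> tp tq; have := trigM tp tq; congr trig; apply/funext => x.
by apply: complex_eqP; rewrite /= ?mulr0 ?mul0r ?subr0 ?addr0.
Qed.

Lemma rtrigN (p : V -> R) : rtrig p -> rtrig (fun x => - p x).
Proof.
move=> tp; under eq_fun do rewrite -mulN1r.
by apply: rtrigM => //; exact: rtrig_cst.
Qed.

Lemma rtrigX (p : V -> R) m : rtrig p -> rtrig (fun x => p x ^+ m).
Proof.
move=> tp; elim: m => [|m IH]; first exact: rtrig_cst.
by under eq_fun do rewrite exprS; exact: rtrigM.
Qed.

Lemma rtrig_prod (I : Type) (s : seq I) (p : I -> V -> R) :
  (forall i, rtrig (p i)) -> rtrig (fun x => \prod_(i <- s) p i x).
Proof.
move=> tp; elim: s => [|i s IH].
  by under eq_fun do rewrite big_nil; exact: rtrig_cst.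
by under eq_fun do rewrite big_cons; exact: rtrigM.
Qed.

Lemma dot_delta (x : V) i : dot (delta_mx i ord0) x = x i ord0.
Proof.
rewrite /dot (bigD1 i)//= big1 ?addr0 => [|j ji]; first by rewrite mxE !eqxx mul1r.
by rewrite mxE (negbTE ji) mul0r.
Qed.

Lemma intvec_delta i : intvec n (delta_mx i ord0 : V).
Proof. by move=> j; rewrite mxE; case: eqP; rewrite ?rpred1 ?rpred0. Qed.

Lemma rtrig_cos (t : R) i : rtrig (fun x => cos (2 * pi * x i ord0 + t)).
Proof.
pose c := Complex 2^-1 0 : R[i].
have := trigD (trig_char (c * cis (- t)) (intvec_delta i))
  (trig_char (c * cis t) (intvecN (intvec_delta i))).
congr trig; apply/funext => x.
rewrite -!mulrA /fker -!cisD !dotNl !dot_delta mulrN opprK addrC.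
rewrite -opprD [t + _]addrC cisN; apply: complex_eqP; rewrite !cE/=.
  by rewrite !mul0r !subr0 [2 * (pi * _)]mulrA; field.
by rewrite !mul0r !addr0; ring.
Qed.

(** The product of the two sines is a difference of cosines, one of which is
    constant. *)
Lemma rtrig_coord_phase b i : rtrig (coord_phase b i).
Proof.
rewrite /coord_phase; case: (b < 0); first exact: rtrig_cst.
case: (1 <= b); first exact: rtrig_cst.
rewrite (_ : (fun x => _) = fun x : V =>
  (2^-1 - 4^-1 * cos (pi * b)) + 4^-1 * cos (2 * pi * x i ord0 + - (pi * b))).
  apply: rtrigD; first exact: rtrig_cst.
  by apply: rtrigM; [exact: rtrig_cst|exact: rtrig_cos].
apply/funext => x; set y := x i ord0.
have -> : pi * b = pi * y + pi * (b - y) by ring.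
have -> : 2 * pi * y + - (pi * y + pi * (b - y)) = pi * y - pi * (b - y) by ring.
by rewrite cosD cosB; field.
Qed.

Definition box_poly (b : 'I_n -> R) (j : nat) (x : V) : R :=
  \prod_i step_poly j (coord_phase (b i) i x).

Lemma rtrig_box_poly b j : rtrig (box_poly b j).
Proof.
apply: rtrig_prod => i; apply: rtrigX; apply: rtrigD; first exact: rtrig_cst.
apply/rtrigN/rtrigX/rtrigD; first exact: rtrig_cst.
exact/rtrigN/rtrig_coord_phase.
Qed.

Definition lower_box (b : 'I_n -> R) : set V := [set x | forall i, x i ord0 <= b i].

Lemma measurable_lower_box b : measurable (lower_box b).
Proof.
rewrite (_ : lower_box b = \bigcap_(i in [set: 'I_n])
    (fun v : V => v i ord0) @^-1` `]-oo, b i]%classic); last first.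
  apply/seteqP; split => v /= H i; first by move=> _; rewrite /= in_itv; exact: H.
  by have := H i Logic.I; rewrite /= in_itv.
apply: fin_bigcap_measurable => // i _; rewrite -[X in measurable X]setTI.
by apply: measurable_coord => //; exact: measurable_itv.
Qed.

Lemma norm_prod_sub_le (I : Type) (s : seq I) (u v : I -> R) :
  (forall i, 0 <= u i <= 1) -> (forall i, 0 <= v i <= 1) ->
  `|\prod_(i <- s) u i - \prod_(i <- s) v i| <= \sum_(i <- s) `|u i - v i|.
Proof.
move=> u01 v01; elim: s => [|i s IH]; first by rewrite !big_nil subrr normr0.
rewrite !big_cons; set U := \prod_(j <- s) u j; set W := \prod_(j <- s) v j.
have -> : u i * U - v i * W = (u i - v i) * U + v i * (U - W) by ring.
have U01 : 0 <= U <= 1.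
  apply/andP; split; first by apply: prodr_ge0 => j _; have /andP[] := u01 j.
  by apply: prodr_ile1 => j _.
have /andP[U0 U1] := U01; have /andP[v0 v1] := v01 i.
rewrite (le_trans (ler_normD _ _))// lerD//.
  by rewrite normrM [`|U|]ger0_norm// ler_piMr.
by rewrite normrM [`|v i|]ger0_norm// (le_trans _ IH)// ler_piMl.
Qed.

Lemma box_poly_cvg b x : cube x -> forall e : R, 0 < e ->
  \forall j \near \oo, `|\1_(lower_box b) x - box_poly b j x| <= e.
Proof.
move=> xQ e e0; have n0 : 0 < n.+1%:R :> R by rewrite ltr0n.
have en : 0 < e / n.+1%:R by rewrite divr_gt0.
have : \forall j \near \oo, forall i : 'I_n,
    `|step_poly j (coord_phase (b i) i x) - (x i ord0 <= b i)%R%:R| <= e / n.+1%:R.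
  apply: filter_forall => i.
  have := step_poly_cvg (coord_phase_itv (b i) i x) en.
  by rewrite coord_phase_half.
apply: filterS => j H.
have -> : \1_(lower_box b) x = \prod_i (x i ord0 <= b i)%R%:R :> R.
  rewrite indicE; have [xb|xb] := boolP (x \in lower_box b).
    by move: xb; rewrite inE => xb; rewrite big1// => i _; rewrite xb.
  apply/esym/eqP; rewrite prodf_seq_eq0; apply/hasP.
  have [i xi] : exists i, ~~ (x i ord0 <= b i).
    apply: contrapT => /forallNP H'; move/negP: xb; apply.
    by rewrite inE => i; have /negP := H' i; rewrite negbK.
  by exists i; [exact: mem_index_enum|rewrite /= (negbTE xi) eqxx].
rewrite distrC; apply: (le_trans (norm_prod_sub_le _ _ _)).
- by move=> i; apply: step_poly_itv; exact: coord_phase_itv.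
- by move=> i; case: (x i ord0 <= b i); rewrite ?lexx ?ler01.
apply: (@le_trans _ _ (\sum_(i < n) e / n.+1%:R)); first exact: ler_sum.
rewrite sumr_const card_ord -[leLHS]mulr_natl mulrCA ler_piMr ?(ltW e0)//.
by rewrite ler_pdivrMr// mul1r ler_nat.
Qed.

Lemma box_poly_itv b j x : 0 <= box_poly b j x <= 1.
Proof.
have H i : 0 <= step_poly j (coord_phase (b i) i x) <= 1.
  by apply: step_poly_itv; exact: coord_phase_itv.
apply/andP; split; first by apply: prodr_ge0 => i _; have /andP[] := H i.
by apply: prodr_ile1 => i _.
Qed.

Lemma cmeas_indic_real (D : set V) : measurable D ->
  cmeas (fun x => Complex (\1_D x) 0 : R[i]).
Proof. by move=> mD; apply: cmeas_real; exact: measurable_indic. Qed.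

Lemma approximable_indic_cvg (F : nat -> V -> R) (D : set V) : measurable D ->
  (forall j, approximable (fun x => Complex (F j x) 0)) ->
  (forall j x, 0 <= F j x <= 1) ->
  (forall x, cube x -> forall e : R, 0 < e ->
    \forall j \near \oo, `|\1_D x - F j x| <= e) ->
  approximable (fun x => Complex (\1_D x) 0).
Proof.
move=> mD FA F01 Fcvg.
have nE x j : normc (Complex (\1_D x) 0 - Complex (F j x) 0) = `|\1_D x - F j x|.
  by rewrite -normc_real; congr normc; apply: complex_eqP; rewrite !cE/= ?subrr.
apply: (@approximable_cvg (fun j x => Complex (F j x) 0) _ (fun=> 1)) => //.
- exact: cmeas_indic_real.
- by rewrite integral_mcube_cst ltry.
- move=> j x; rewrite nE exprn_ile1//.
  have /andP[F0 F1] := F01 j x; rewrite indicE ler_norml.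
  by case: (x \in D) => /=; lra.
- move=> x xQ e e0; apply: filterS (Fcvg x xQ e e0) => j.
  by rewrite nE.
Qed.

Lemma approximable_lower_box b : approximable (fun x => Complex (\1_(lower_box b) x) 0).
Proof.
apply: (@approximable_indic_cvg (box_poly b)).
- exact: measurable_lower_box.
- by move=> j; apply: approximable_trig; exact: rtrig_box_poly.
- exact: box_poly_itv.
- by move=> x xQ; exact: box_poly_cvg.
Qed.

End trigonometric_approximation.

Section square_integrable_approximation.
Variables (R : realType) (n : nat).
Local Notation V := 'cV[R]_n.
Local Notation Q := (@mcube R n).
Local Notation Z := (@counting_intvec R n).

Import HBNNSimple.

Let G : set (set V) := range (@lower_box R n).

(** The identity is measurable from the generated sigma-algebra as soon as its
    coordinates are, and half-spaces are increasing unions of lower boxes. *)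
Lemma measurable_lower_boxE : @measurable _ V = <<s G >>.
Proof.
apply/seteqP; split; last first.
  apply: smallest_sub; first exact: sigma_algebra_measurable.
  by move=> _ [b _ <-]; exact: measurable_lower_box.
pose VG := g_sigma_algebraType G.
have half (i : 'I_n) (r : R) : (<<s G >>) [set x : V | x i ord0 <= r].
  rewrite (_ : [set x | _] =
    \bigcup_(m in [set: nat]) lower_box (fun k => if k == i then r else m%:R)).
    apply: (@bigcupT_measurable _ VG) => m; apply: sub_sigma_algebra.
    by eexists.
  apply/seteqP; split => x /=.
    move=> xr; exists (\sum_k (Num.truncn `|x k ord0|).+1)%N => // k.
    have [->//|ki] := eqVneq k i.
    rewrite (le_trans (ler_norm _))// (le_trans (ltW (truncnS_gt _)))// ler_nat.
    by rewrite (bigD1 k)//= leq_addr.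
  by move=> [m _ /(_ i)]; rewrite eqxx.
have mid : measurable_fun setT (id : VG -> V).
  apply: measurable_fun_mx => i j.
  apply: (measurability _ (RGenOInfty.measurableE R)).
  move=> _ [_ [r ->] <-]; rewrite setTI (ord1 j).
  rewrite (_ : _ @^-1` _ = ~` [set x : V | x i ord0 <= r]).
    by apply: (@measurableC _ VG); exact: half.
  apply/seteqP; split => x /=; rewrite in_itv/= andbT ltNge => /negP//.
by move=> A mA; have := mid measurableT A mA; rewrite setTI preimage_id.
Qed.

Lemma setI_closed_lower_box : setI_closed G.
Proof.
move=> _ _ [a _ <-] [b _ <-]; exists (fun i => Num.min (a i) (b i)) => //.
apply/seteqP; split => x /=.
  by move=> H; split=> i; have := H i; rewrite le_min => /andP[].
by move=> [xa xb] i; rewrite le_min xa xb.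
Qed.

(** Approximable indicators form a Dynkin system that contains the lower boxes,
    which are stable under intersection and generate the Borel sets. *)
Lemma approximable_indic (D : set V) : measurable D ->
  approximable (fun x => Complex (\1_D x) 0).
Proof.
move=> mD; move: (mD); rewrite measurable_lower_boxE.
apply: (dynkin_induction measurable_lower_boxE setI_closed_lower_box
  (P := fun D => approximable (fun x => Complex (\1_D x) 0))) => {D mD}.
- rewrite (_ : (fun x => _) = fun=> 1).
    by apply: approximable_trig; exact: trig_cst.
  by apply/funext => x; rewrite indicE in_setT.
- by move=> _ [b _ <-]; exact: approximable_lower_box.
- move=> D mD DA; rewrite (_ : (fun x => _) = fun x => 1 - Complex (\1_D x) 0).
    by apply: approximableB => //; apply: approximable_trig; exact: trig_cst.
  apply/funext => x; rewrite !indicE in_setC.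
  by apply: complex_eqP; rewrite !cE/= ?subr0; case: (x \in D); rewrite ?subrr ?subr0.
- move=> F mF tF FA; pose S m x : R := \sum_(k < m) \1_(F k) x.
  (* The sets are disjoint: a partial sum of indicators is an indicator. *)
  have SE x m : S m x = 0 \/ exists2 k0, F k0 x & S m x = (k0 < m)%N%:R.
    have [[k0 Fk0]|nF] := pselect (exists k, F k x).
      right; exists k0 => //; rewrite /S.
      elim: m => [|m IH]; first by rewrite big_ord0.
      rewrite big_ord_recr/= IH ltnS.
      have -> : \1_(F m) x = (k0 == m)%:R :> R.
        rewrite indicE; have [k0m|k0m] := eqVneq k0 m; first by rewrite mem_set// -k0m.
        rewrite memNset// => Fm; move/eqP: k0m; apply.
        by apply: tF => //; exists x.
      by case: ltngtP => /= _; rewrite ?addr0 ?add0r.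
    left; apply: big1 => k _; rewrite indicE memNset// => Fk.
    by apply: nF; exists (k : nat).
  apply: (@approximable_indic_cvg _ _ S).
  + exact: bigcupT_measurable.
  + move=> m; rewrite (_ : (fun x => _) = fun x => \sum_(k < m) Complex (\1_(F k) x) 0).
      by apply: approximable_sum => k; exact: FA.
    apply/funext => x; rewrite /S; elim/big_rec2: _ => // k y z _ <-.
    by apply: complex_eqP; rewrite !cE/= ?addr0.
  + move=> m x; have [->|[k0 _ ->]] := SE x m; first by rewrite lexx ler01.
    by case: (k0 < m)%N; rewrite ?lexx ?ler01.
  + move=> x _ e e0; have [[k0 Fk0]|nF] := pselect (exists k, F k x).
      exists k0.+1 => // m /= k0m.
      rewrite indicE mem_set; last by exists k0.
      have [S0|[k1 Fk1 ->]] := SE x m.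
        move: S0 => /eqP; rewrite /S psumr_eq0// => /allP/(_ (Ordinal k0m)).
        rewrite mem_index_enum => /(_ isT) /=.
        by rewrite indicE mem_set// oner_eq0.
      have -> : k1 = k0 by apply: tF => //; exists x.
      by rewrite (_ : (k0 < m)%N = true)// subrr normr0 ltW.
    apply: nearW => m; rewrite indicE memNset; last first.
      by move=> [k _ Fk]; apply: nF; exists k.
    have [->|[k1 Fk1 _]] := SE x m; first by rewrite subrr normr0 ltW.
    by exfalso; apply: nF; exists k1.
Qed.

Lemma approximable_nnsfun (g : {nnsfun V >-> R}) :
  approximable (fun x => Complex (g x) 0).
Proof.
pose s : seq R := finmap.enum_fset (fset_set (range g)).
rewrite (_ : (fun x => _) = fun x => \sum_(i < size s)
  Complex (nth 0 s i) 0 * Complex (\1_(g @^-1` [set nth 0 s i]) x) 0).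
  apply: approximable_sum => i; apply: approximableZ; apply: approximable_indic.
  by rewrite -[X in measurable X]setTI; exact: measurable_funP.
apply/funext => x; rewrite fimfunEord.
elim/big_rec2: _ => // i y z _ <-.
by apply: complex_eqP; rewrite !cE/= ?mulr0 ?mul0r ?subr0 ?addr0.
Qed.

Lemma approximable_nonneg (h : V -> R) : measurable_fun setT h ->
  (forall x, 0 <= h x) -> (\int[Q]_x (h x ^+ 2)%:E < +oo)%E ->
  approximable (fun x => Complex (h x) 0).
Proof.
move=> mh h0 hoo; have mhE : measurable_fun setT (EFin \o h) by exact/measurable_EFinP.
pose g := nnsfun_approx measurableT mhE.
have gcvg x : (fun j => g j x) @ \oo --> h x.
  have := @cvg_nnsfun_approx _ _ _ _ measurableT _ mhE (fun x _ => _) x Logic.I.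
  by move=> /(_ (fun x => h0 x)) /fine_cvgP[].
have gle j x : g j x <= h x.
  have := @nondecreasing_cvgn_le R (fun j => g j x) _ (cvgP _ (gcvg x)) j.
  rewrite (cvg_lim _ (gcvg x))//; apply => i k ik.
  exact/lefP/nd_nnsfun_approx.
have nE x j : normc (Complex (h x) 0 - Complex (g j x) 0) = `|h x - g j x|.
  by rewrite -normc_real; congr normc; apply: complex_eqP; rewrite !cE/= ?subrr.
apply: (@approximable_cvg _ _ (fun j x => Complex (g j x) 0) _ (fun x => h x ^+ 2)) => //.
- by move=> j; exact: approximable_nnsfun.
- exact: measurable_funX.
- move=> j x; rewrite nE ger0_norm ?subr_ge0// lerXn2r// ?nnegrE ?subr_ge0//.
  by rewrite gerBl.
- move=> x _ e e0; have /cvgrPdist_le/(_ _ e0) := gcvg x.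
  by apply: filterS => j; rewrite nE.
Qed.

Lemma approximable_real (h : V -> R) : measurable_fun setT h ->
  (\int[Q]_x (h x ^+ 2)%:E < +oo)%E -> approximable (fun x => Complex (h x) 0).
Proof.
move=> mh hoo.
have part (k : V -> R) : measurable_fun setT k -> (forall x, 0 <= k x <= `|h x|) ->
    approximable (fun x => Complex (k x) 0).
  move=> mk kh; apply: approximable_nonneg => //.
    by move=> x; have /andP[] := kh x.
  apply: le_lt_trans hoo; apply: le_integral_real.
  - exact: measurable_funX.
  - exact: measurable_funX.
  - by move=> x; exact: sqr_ge0.
  - move=> x; have /andP[k0 kx] := kh x.
    by rewrite -[leRHS]real_normK ?num_real// lerXn2r// nnegrE.
rewrite (_ : (fun x => _) =
    fun x => Complex (Num.max (h x) 0) 0 - Complex (Num.max (- h x) 0) 0).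
  apply: approximableB; apply: part.
  - exact: measurable_maxr.
  - by move=> x; rewrite le_max lexx orbT/= ge_max ler_norm normr_ge0.
  - by apply: measurable_maxr => //; exact: measurableT_comp.
  - by move=> x; rewrite le_max lexx orbT/= ge_max -normrN ler_norm normr_ge0.
apply/funext => x; apply: complex_eqP; rewrite !cE/= ?subrr//.
by have [hx|hx] := leP 0 (h x); rewrite /Num.max; case: ltP; case: ltP; lra.
Qed.

Lemma approximable_square_integrable (f : V -> R[i]) : cmeas f ->
  (N2 Q f < +oo)%E -> approximable f.
Proof.
move=> mf foo; have [mr mi] := mf.
rewrite (_ : f = fun x => Complex (Re (f x)) 0 + Complex 0 1 * Complex (Im (f x)) 0).
  apply: approximableD; last apply: approximableZ; apply: approximable_real => //.
  - apply: le_lt_trans foo; apply: le_integral_real.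
    + exact: measurable_funX.
    + exact: measurable_sqr_normc.
    + by move=> x; rewrite sqr_ge0.
    + by move=> x; rewrite sqr_normcE lerDl sqr_ge0.
  - apply: le_lt_trans foo; apply: le_integral_real.
    + exact: measurable_funX.
    + exact: measurable_sqr_normc.
    + by move=> x; rewrite sqr_ge0.
    + by move=> x; rewrite sqr_normcE lerDr sqr_ge0.
apply/funext => x; apply: complex_eqP; rewrite !cE/=; ring.
Qed.

(** Parseval's identity for Fourier series. *)
Lemma plancherel_cube_integer : plancherel Q Z (@fker R n).
Proof.
apply: plancherel_dual.
- exact: cmeas_fker.
- exact: unimodular_fker.
- exact: plancherel_integer_cube.
move=> f fi foo e e0.
have [_ /(_ e e0) [p tp fp]] := approximable_square_integrable fi.1 foo.
have [a [ai aoo pa]] := trig_check tp.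
exists a; split => //.
by under [X in N2 _ X]eq_fun do rewrite -pa.
Qed.

End square_integrable_approximation.

(** * Plancherel theorems for Euclidean spaces and slabs *)

Section plancherel_variants.
Context d1 d2 (X : measurableType d1) (Y : measurableType d2) (R : realType).
Variables (mX : {sigma_finite_measure set X -> \bar R}).
Variables (mY : {sigma_finite_measure set Y -> \bar R}).

Lemma plancherel_conj (E : X * Y -> R[i]) : cmeas E -> unimodular E ->
  plancherel mX mY E -> plancherel mX mY (fun p => conjC (E p)).
Proof.
move=> mE uE PE f fi foo.
have cfi := cintJ fi.
have cfE : N2 mX (fun x => conjC (f x)) = N2 mX f.
  by apply: eq_N2 => x; rewrite normc_conj.
rewrite -cfE -(PE _ cfi) ?cfE//; apply: eq_N2 => y.
rewrite -[LHS]normc_conj /transform -cintegralJ.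
  by congr (normc (cintegral _ _ _)); apply/funext => x; rewrite rmorphM/= conjcK.
apply: (@cintM_bounded _ _ _ _ _ _ 1) => //.
  by apply: cmeasJ; exact: cmeas_fst.
by move=> x; rewrite normc_conj uE.
Qed.

Lemma eq_plancherel_ae (E E' : X * Y -> R[i]) : cmeas E -> cmeas E' ->
  {ae mY, forall y, {ae mX, forall x, E (x, y) = E' (x, y)}} ->
  plancherel mX mY E -> plancherel mX mY E'.
Proof.
move=> mE mE' EE' PE f fi foo; rewrite -(PE _ fi foo).
apply: ae_eq_N2; do ?by apply: cmeas_transform => //; exact: fi.1.
apply: filterS EE' => y EE'; apply: ae_eq_cintegral.
- by apply: cmeasM; [exact: fi.1|exact: cmeas_fst].
- by apply: cmeasM; [exact: fi.1|exact: cmeas_fst].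
- by apply: filterS EE' => x ->.
Qed.

Lemma ae_prodm_snd (P : Y -> Prop) :
  {ae mY, forall y, P y} -> {ae prodm mX mY, forall p, P p.2}.
Proof.
move=> [N [mN N0 PN]]; exists (setT `*` N); split.
- exact: measurableX.
- by apply: etrans (product_measure1E _ _ _ _) _ => //; rewrite N0 mule0.
- by move=> p Pp; split => //; exact: PN.
Qed.

Lemma ae_prodm_fst (P : X -> Prop) :
  {ae mX, forall x, P x} -> {ae prodm mX mY, forall p, P p.1}.
Proof.
move=> [N [mN N0 PN]]; exists (N `*` setT); split.
- exact: measurableX.
- by apply: etrans (product_measure1E _ _ _ _) _ => //; rewrite [X in (X * _)%E]N0 mul0e.
- by move=> p Pp; split => //; exact: PN.
Qed.

Lemma prodm_swap (D : set (Y * X)) : measurable D ->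
  prodm mY mX D = prodm mX mY ((fun p => (p.2, p.1)) @^-1` D).
Proof.
move=> mD.
have msw : measurable_fun setT (fun p : X * Y => (p.2, p.1)).
  by apply: measurable_fun_pair.
have mD' : measurable ((fun p : X * Y => (p.2, p.1)) @^-1` D).
  by rewrite -[X in measurable X]setTI; exact: msw.
rewrite (measure_integral_indic (prodm mY mX) mD).
rewrite (measure_integral_indic (prodm mX mY) mD').
rewrite prodm_tonelli1//; last exact: measurable_indic_EFin.
by rewrite prodm_tonelli2//; exact: measurable_indic_EFin.
Qed.

End plancherel_variants.

Section plancherel_euclidean.
Variables (R : realType) (n : nat).
Local Notation V := 'cV[R]_n.
Local Notation Q := (@mcube R n).
Local Notation Z := (@counting_intvec R n).
Local Notation L := (lebesgue_cV R n).
Local Notation E := (@fker R n).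

Lemma plancherel_integer_cube_fker : plancherel Z Q E.
Proof.
have mE := @cmeas_fker R n; have uE := @unimodular_fker R n.
have := plancherel_conj (cmeas_dual_kernel mE) (unimodular_dual_kernel uE)
  (@plancherel_integer_cube R n).
by congr plancherel; apply/funext => -[k x]; rewrite /dual_kernel conjcK fkerC.
Qed.

Lemma lebesgue_unfold_swap (D : set V) : measurable D ->
  L D = prodm Z Q ((fun p => p.1 + p.2) @^-1` D).
Proof.
move=> mD; rewrite lebesgue_unfold// prodm_swap; last first.
  rewrite -[X in measurable X]setTI.
  have : measurable_fun setT (fun p : V * V => p.1 + p.2) by exact: measurable_addmx.
  exact.
by congr (prodm _ _ _); apply/funext => -[x y] /=; rewrite addrC.
Qed.

(** Write the space variable as [x + m] and the frequency as [k + y], with [x]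
    and [y] in the cube and [m] and [k] integer points. Since [dot m k] is an
    integer, the Fourier kernel at these points is the product of the kernels
    at [(x, k)], [(m, y)] and [(x, y)]: two Fourier series and a unimodular
    coupling. *)
Lemma plancherel_lebesgue : plancherel L L E.
Proof.
have mE := @cmeas_fker R n; have uE := @unimodular_fker R n.
have madd : measurable_fun setT (fun p : V * V => p.1 + p.2).
  exact: measurable_addmx.
apply: (plancherel_transport_l madd (@lebesgue_unfold R n)) => //.
have mE1 : cmeas (fun p : (V * V) * V => E (p.1.1 + p.1.2, p.2)).
  apply: (cmeas_comp (phi := fun p : (V * V) * V => (p.1.1 + p.1.2, p.2))) mE.
  apply: measurable_fun_pair; last exact: measurable_snd.
  exact: (measurableT_comp madd measurable_fst).
apply: (plancherel_transport_r madd lebesgue_unfold_swap) => //.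
have mE2 : cmeas (fun p : (V * V) * (V * V) => E (p.1.1 + p.1.2, p.2.1 + p.2.2)).
  apply: (cmeas_comp (phi := fun p : (V * V) * (V * V) =>
    (p.1.1 + p.1.2, p.2.1 + p.2.2))) mE.
  apply: measurable_fun_pair.
    exact: (measurableT_comp madd measurable_fst).
  exact: (measurableT_comp madd measurable_snd).
apply: (@eq_plancherel_ae _ _ _ _ _ (prodm Q Z) (prodm Z Q)
    (twisted_kernel E E E)) => //.
- exact: cmeas_twisted.
- apply: filterS (ae_prodm_fst Q (@ae_intvec R n)) => -[k y] kZ.
  apply: filterS (ae_prodm_snd Q (@ae_intvec R n)) => -[x m] mZ.
  rewrite /twisted_kernel !fkerDl !fkerDr (fker_intvec mZ kZ) mul1r; ring.
- apply: plancherel_twisted => //.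
  + exact: plancherel_cube_integer.
  + exact: plancherel_integer_cube_fker.
Qed.

End plancherel_euclidean.

Section plancherel_slab.
Variables (R : realType) (d1 d2 : nat).
Local Notation V1 := 'cV[R]_d1.
Local Notation V2 := 'cV[R]_d2.
Local Notation Q := (@mcube R d1).
Local Notation Z := (@counting_intvec R d1).
Local Notation L := (lebesgue_cV R d2).

Lemma dot_col_mx (x x' : V1) (y y' : V2) :
  dot (col_mx x y) (col_mx x' y') = dot x x' + dot y y'.
Proof.
rewrite /dot big_split_ord; congr (_ + _); apply: eq_bigr => i _.
  by rewrite !col_mxEu.
by rewrite !col_mxEd.
Qed.

Lemma fker_col_mx (x x' : V1) (y y' : V2) :
  fker (col_mx x y, col_mx x' y') = fker (x, x') * fker (y, y').
Proof. by rewrite /fker/= dot_col_mx mulrDr opprD cisD. Qed.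

Definition slab_kernel (p : (V1 * V2) * (V1 * V2)) : R[i] :=
  fker (col_pair p.1, col_pair p.2).

Lemma slab_kernelE : slab_kernel =
  twisted_kernel (@fker R d1) (@fker R d2) (fun=> 1).
Proof.
by apply/funext => -[[x y] [k l]]; rewrite /slab_kernel fker_col_mx
  /twisted_kernel mulr1.
Qed.

Lemma cmeas_slab_kernel : cmeas slab_kernel.
Proof.
rewrite slab_kernelE; apply: cmeas_twisted; do ?exact: cmeas_fker.
exact: cmeas_cst.
Qed.

Lemma unimodular_slab_kernel : unimodular slab_kernel.
Proof. by move=> p; exact: normc_cis. Qed.

Lemma plancherel_slab : plancherel (prodm Q L) (prodm Z L) slab_kernel.
Proof.
rewrite slab_kernelE; apply: plancherel_twisted; do ?exact: cmeas_fker;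
  do ?exact: unimodular_fker.
- exact: cmeas_cst.
- by move=> p; exact: ComplexField.Normc.normc1.
- exact: plancherel_cube_integer.
- exact: plancherel_lebesgue.
Qed.

Lemma plancherel_slab_dual :
  plancherel (prodm Z L) (prodm Q L) (dual_kernel slab_kernel).
Proof.
rewrite (_ : dual_kernel _ = fun p => conjC (slab_kernel p)); last first.
  by apply/funext => p; rewrite /dual_kernel /slab_kernel fkerC.
apply: plancherel_conj; [exact: cmeas_slab_kernel|exact: unimodular_slab_kernel|].
rewrite slab_kernelE; apply: plancherel_twisted; do ?exact: cmeas_fker;
  do ?exact: unimodular_fker.
- exact: cmeas_cst.
- by move=> p; exact: ComplexField.Normc.normc1.
- exact: plancherel_integer_cube_fker.
- exact: plancherel_lebesgue.
Qed.

End plancherel_slab.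

(** * Folding along the lattice *)

Section counting_pick.
Variables (R : realType) (n : nat).
Local Notation V := 'cV[R]_n.
Local Notation Z := (@counting_intvec R n).

Lemma ge0_integral_counting_pick (g : V -> \bar R) (k : V) : intvec n k ->
  measurable_fun setT g -> (forall z, 0 <= g z)%E ->
  (forall z, intvec n z -> z != k -> g z = 0%E) -> (\int[Z]_z g z = g k)%E.
Proof.
move=> kZ mg g0 gk; have mk := @measurable_set1_cV R n k.
transitivity (\int[Z]_z (g k * (\1_[set k] z)%:E))%E.
  apply: ge0_ae_eq_integral => //.
  - by apply: emeasurable_funM => //; exact: measurable_indic_EFin.
  - by move=> z _; rewrite mule_ge0.
  apply: filterS (@ae_intvec R n) => z zZ _.
  have [->|zk] := eqVneq z k; first by rewrite indicE mem_set// mule1.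
  by rewrite gk// indicE memNset ?mule0//; exact/eqP.
rewrite ge0_integralZl//; last exact: measurable_indic_EFin.
by rewrite -(measure_integral_indic Z mk) [X in (_ * X)%E](counting_intvec_set1 kZ) mule1.
Qed.

Lemma ge0_integral_counting_ge (g : V -> \bar R) (k : V) : intvec n k ->
  measurable_fun setT g -> (forall z, 0 <= g z)%E -> (g k <= \int[Z]_z g z)%E.
Proof.
move=> kZ mg g0; have mk := @measurable_set1_cV R n k.
have mg1 : measurable_fun setT (fun z => g k * (\1_[set k] z)%:E)%E.
  by apply: emeasurable_funM => //; exact: measurable_indic_EFin.
apply: (@le_trans _ _ (\int[Z]_z (g k * (\1_[set k] z)%:E))%E).
  rewrite (ge0_integral_counting_pick kZ)//.
  - by rewrite indicE mem_set// mule1.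
  - by move=> z; rewrite mule_ge0.
  - by move=> z _ zk; rewrite indicE memNset ?mule0//; exact/eqP.
apply: ge0_le_integral => //.
- by move=> z _; rewrite mule_ge0.
- move=> z _; rewrite indicE; have [->|zk] := eqVneq z k.
    by rewrite mem_set// mule1.
  by rewrite memNset ?mule0//; exact/eqP.
Qed.

End counting_pick.

Section lattice_unfolding.
Variables (R : realType) (d1 d2 : nat) (A : 'M[R]_(d1 + d2)).
Hypothesis unitA : A \in unitmx.
Local Notation d := (d1 + d2)%N.
Local Notation V1 := 'cV[R]_d1.
Local Notation V2 := 'cV[R]_d2.
Local Notation V := 'cV[R]_d.
Local Notation Q := (@mcube R d1).
Local Notation Z := (@counting_intvec R d1).
Local Notation L := (lebesgue_cV R d2).
Local Notation Ld := (lebesgue_cV R d).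
Local Notation X := (prodm Q L).
Local Notation Y := (prodm Z L).
Local Notation c := `|\det A|.
Local Notation mu := (transpose_measure unitA (intvec_lebesgue d1 d2)).

(** The coset of the lattice through the image under [A] of a point of the slab
    is enumerated by the integer points [q.2]. *)
Definition lattice_point (q : (V1 * V2) * V1) : V :=
  A *m col_mx (q.1.1 + q.2) q.1.2.
Local Notation theta := lattice_point.

(** A parametrization of the dual set, when the first component ranges over the
    integer points. *)
Definition dual_point (l : V1 * V2) : V := invmx A^T *m col_pair l.
Local Notation Psi := dual_point.

Let c0 : 0 < c.
Proof. by rewrite normr_gt0 -unitfE -unitmxE. Qed.

Lemma measurable_lattice_point : measurable_fun setT theta.
Proof.
have mg : measurable_fun setT (fun q : (V1 * V2) * V1 => (q.1.1 + q.2, q.1.2)).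
  apply: measurable_fun_pair; last exact: (measurableT_comp measurable_snd measurable_fst).
  apply: measurable_addmx; last exact: measurable_snd.
  exact: (measurableT_comp measurable_fst measurable_fst).
exact: (measurableT_comp (measurableT_comp (measurable_mulmx A)
  (@measurable_col_pair R d1 d2)) mg).
Qed.

Lemma measurable_dual_point : measurable_fun setT Psi.
Proof. exact: (measurableT_comp (measurable_mulmx _) (@measurable_col_pair R d1 d2)). Qed.

Lemma ge0_integral_lattice (h : V -> \bar R) : measurable_fun setT h ->
  (forall x, 0 <= h x)%E ->
  (\int[Ld]_x h x = c%:E * \int[prodm X Z]_q h (theta q))%E.
Proof.
move=> mh h0; rewrite (change_of_variables_unitmx unitA 0)//.
under eq_integral do rewrite addr0.
have mhA : measurable_fun setT (fun x => h (A *m x)).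
  exact: (measurableT_comp mh (measurable_mulmx A)).
congr (_ * _)%E; rewrite ge0_integral_col_mx//.
have mhc : measurable_fun setT (fun p : V1 * V2 => h (A *m col_mx p.1 p.2)).
  exact: (measurableT_comp mhA (@measurable_col_pair R d1 d2)).
rewrite ge0_integral_unfold; last 2 first.
- exact: (@measurable_fun_fubini_tonelli_F _ _ _ _ R L
    (fun p : V1 * V2 => h (A *m col_mx p.1 p.2)) mhc (fun p => h0 _)).
- by move=> v; exact: integral_ge0.
have mht : measurable_fun setT (fun q => h (theta q)).
  exact: (measurableT_comp mh measurable_lattice_point).
rewrite prodm_tonelli1// prodm_tonelli1//; last 2 first.
- exact: (@measurable_fun_fubini_tonelli_F _ _ _ _ R Z (fun q => h (theta q)) mht (fun p => h0 _)).
- by move=> p; exact: integral_ge0.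
apply: eq_integral => q _.
rewrite (@fubini_tonelli _ _ _ _ R L Z (fun p : V2 * V1 => h (theta ((q, p.1), p.2))))//.
by apply: (measurableT_comp mht); apply: measurable_fun_pair => //; apply: measurable_fun_pair.
Qed.

Lemma N2_lattice (f : V -> R[i]) : cmeas f ->
  N2 Ld f = (c%:E * N2 (prodm X Z) (fun q => f (theta q)))%E.
Proof.
move=> mf; rewrite /N2 ge0_integral_lattice//.
- by apply/measurable_EFinP; exact: measurable_sqr_normc.
- by move=> x; rewrite lee_fin sqr_ge0.
Qed.

Lemma normc_lattice (f : V -> R[i]) : cmeas f ->
  (\int[Ld]_x (normc (f x))%:E =
   c%:E * \int[prodm X Z]_q (normc (f (theta q)))%:E)%E.
Proof.
move=> mf; rewrite ge0_integral_lattice//.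
- by apply/measurable_EFinP; exact: measurable_normc.
- by move=> x; rewrite lee_fin normc_ge0.
Qed.

Lemma lte_lattice (x : \bar R) : ((c%:E * x < +oo) = (x < +oo))%E.
Proof.
case: x => [r||] /=; first by rewrite -EFinM !ltry.
- by rewrite gt0_muley ?lte_fin// ltxx.
- by rewrite gt0_muleNy ?lte_fin// ltNyr.
Qed.

Lemma cmeas_lattice (f : V -> R[i]) : cmeas f -> cmeas (fun q => f (theta q)).
Proof. exact: (cmeas_comp measurable_lattice_point). Qed.

Lemma cint_lattice (f : V -> R[i]) : cint Ld f ->
  cint (prodm X Z) (fun q => f (theta q)).
Proof.
move=> [mf foo]; split; first exact: cmeas_lattice.
by rewrite -lte_lattice -normc_lattice.
Qed.

Lemma Rintegral_lattice (h : V -> R) : Ld.-integrable setT (EFin \o h) ->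
  \int[Ld]_x h x = c * \int[prodm X Z]_q h (theta q).
Proof.
move=> hi; have mh := measurable_int _ hi.
have mt := measurable_lattice_point.
rewrite /Rintegral integralE [in RHS]integralE.
rewrite !ge0_integral_lattice//; do ?[exact: measurable_funepos|exact: measurable_funeneg].
have := integrable_pos_fin_num measurableT hi.
have := integrable_neg_fin_num measurableT hi.
rewrite !ge0_integral_lattice//; do ?[exact: measurable_funepos|exact: measurable_funeneg].
have -> : (\int[prodm X Z]_q (EFin \o h)^\+ (theta q) =
    \int[prodm X Z]_q (fun q => (h (theta q))%:E)^\+ q)%E.
  by apply: eq_integral => q _; rewrite !funeposE.
have -> : (\int[prodm X Z]_q (EFin \o h)^\- (theta q) =
    \int[prodm X Z]_q (fun q => (h (theta q))%:E)^\- q)%E.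
  by apply: eq_integral => q _; rewrite !funenegE.
set a := (\int[_]_q _)%E; set b := (\int[_]_q _)%E.
have fin (x : \bar R) : (0 <= x)%E -> (c%:E * x)%E \is a fin_num -> x \is a fin_num.
  by move=> x0; rewrite !ge0_fin_numE ?mule_ge0 ?lte_lattice// lee_fin ltW.
move=> /fin ca /fin cb.
have {}ca := ca (integral_ge0 _ (fun _ _ => funeneg_ge0 _ _)).
have {}cb := cb (integral_ge0 _ (fun _ _ => funepos_ge0 _ _)).
by rewrite -(fineK ca) -(fineK cb) -!EFinM -!EFinB /= mulrBr.
Qed.

Lemma cintegral_lattice (f : V -> R[i]) : cint Ld f ->
  cintegral Ld setT f =
  Complex c 0 * cintegral (prodm X Z) setT (fun q => f (theta q)).
Proof.
move=> fi; apply: complex_eqP; rewrite cE/= mul0r ?subr0 ?addr0.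
  exact: (Rintegral_lattice (cint_Re fi)).
exact: (Rintegral_lattice (cint_Im fi)).
Qed.

Lemma ge0_integral_dual (h : V -> \bar R) : measurable_fun setT h ->
  (forall x, 0 <= h x)%E ->
  (\int[mu]_x h x = (c^-1)%:E * \int[Y]_l h (Psi l))%E.
Proof.
move=> mh h0; pose k : {nonneg R} := NngNum (normr_ge0 (\det (invmx A^T))).
have kE : k%:num = c^-1 by rewrite /k/= det_inv det_tr normfV.
have unitAT : A^T \in unitmx by rewrite unitmx_tr.
transitivity (\int[mscale k (image_measure Y measurable_dual_point)]_x h x)%E.
  apply: eq_measure_integral => D mD _.
  change (`|\det (invmx A^T)|%:E * intvec_lebesgue d1 d2 (mulmx A^T @` D) =
    k%:num%:E * Y (Psi @^-1` D))%E; congr (_ * _)%E.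
  change (Y (@col_pair R d1 d2 @^-1` (mulmx A^T @` D)) = Y (Psi @^-1` D)).
  congr (Y _); apply/seteqP; split => l /=.
    by move=> [x Dx xl]; rewrite /dual_point -xl mulKmx.
  by move=> Dl; exists (Psi l) => //; rewrite /dual_point mulKVmx.
rewrite ge0_integral_mscale// kE; congr (_ * _)%E.
by rewrite (ge0_integral_transport (mX := Y) measurable_dual_point).
Qed.

Lemma N2_dual (f : V -> R[i]) : cmeas f ->
  N2 mu f = ((c^-1)%:E * N2 Y (fun l => f (Psi l)))%E.
Proof.
move=> mf; rewrite /N2 ge0_integral_dual//.
- by apply/measurable_EFinP; exact: measurable_sqr_normc.
- by move=> x; rewrite lee_fin sqr_ge0.
Qed.

Lemma dot_dual_lattice (l : V1 * V2) (q : (V1 * V2) * V1) :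
  dot (Psi l) (theta q) = dot (col_pair l) (col_mx (q.1.1 + q.2) q.1.2).
Proof.
have dotE (x y : V) : dot x y = (x^T *m y) 0 0.
  by rewrite mxE; apply: eq_bigr => i _; rewrite mxE.
rewrite !dotE /dual_point /lattice_point trmx_mul trmx_inv trmxK mulmxA.
by rewrite mulmxKV.
Qed.

(** The dot product of a dual point and a lattice vector is an integer. *)
Lemma fker_dual_lattice (l : V1 * V2) (q : (V1 * V2) * V1) :
  intvec d1 l.1 -> intvec d1 q.2 -> fker (theta q, Psi l) = slab_kernel (q.1, l).
Proof.
move=> lZ qZ; rewrite /fker/= dot_dual_lattice /slab_kernel -[LHS]/(fker (_, _)).
by rewrite !fker_col_mx fkerDl (fker_intvec qZ lZ) mulr1.
Qed.

End lattice_unfolding.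

Section folding.
Variables (R : realType) (d1 d2 : nat) (A : 'M[R]_(d1 + d2)).
Hypothesis unitA : A \in unitmx.
Local Notation d := (d1 + d2)%N.
Local Notation V1 := 'cV[R]_d1.
Local Notation V2 := 'cV[R]_d2.
Local Notation V := 'cV[R]_d.
Local Notation Q := (@mcube R d1).
Local Notation Z := (@counting_intvec R d1).
Local Notation L := (lebesgue_cV R d2).
Local Notation Ld := (lebesgue_cV R d).
Local Notation X := (prodm Q L).
Local Notation Y := (prodm Z L).
Local Notation c := `|\det A|.
Local Notation mu := (transpose_measure unitA (intvec_lebesgue d1 d2)).
Local Notation theta := (lattice_point A).
Local Notation Psi := (dual_point A).
Local Notation FT := (transform Ld (@fker R d)).
Implicit Types (f : V -> R[i]) (O : set V).

Let c0 : 0 < c.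
Proof. by rewrite normr_gt0 -unitfE -unitmxE. Qed.

(** The sum over the coset of [p], that is over the fibre of the projection to
    the quotient by the lattice. *)
Definition fold f (p : V1 * V2) : R[i] :=
  cintegral Z setT (fun z => f (theta (p, z))).

Lemma cmeas_fold f : cmeas f -> cmeas (fold f).
Proof.
by move=> mf; exact: (@cmeas_integral_snd _ _ _ _ _ Z (fun q => f (theta q))
  (cmeas_lattice A mf)).
Qed.

Lemma cint_fold f : cint Ld f -> cint X (fold f).
Proof.
move=> fi; have ti := cint_lattice unitA fi.
have mn : measurable_fun setT (fun q => (normc (f (theta q)))%:E).
  by apply/measurable_EFinP; apply: measurable_normc; exact: ti.1.
have n0 q : (0 <= (normc (f (theta q)))%:E)%E by rewrite lee_fin normc_ge0.
split; first by apply: cmeas_fold; exact: fi.1.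
apply: le_lt_trans (_ : \int[X]_p \int[Z]_z (normc (f (theta (p, z))))%:E < +oo)%E.
  apply: ae_ge0_le_integral => //.
  - by move=> p _; rewrite lee_fin normc_ge0.
  - by apply/measurable_EFinP/measurable_normc; apply: cmeas_fold; exact: fi.1.
  - by move=> p _; exact: integral_ge0.
  - exact: (@measurable_fun_fubini_tonelli_F _ _ _ _ R Z _ mn n0).
  - by apply: filterS (cint_snd_ae ti) => p pi _; exact: le_normc_cintegral.
by rewrite -(prodm_tonelli1 X Z mn n0); exact: ti.2.
Qed.

(** Unfolding the integral along the lattice: the character of a dual point is
    constant on each coset and comes out of the sum. *)
Lemma transform_fold f (l : V1 * V2) : cint Ld f -> intvec d1 l.1 ->
  FT f (Psi l) = Complex c 0 * transform X (@slab_kernel R d1 d2) (fold f) l.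
Proof.
move=> fi lZ; have ti := cint_lattice unitA fi.
have mE := @cmeas_fker R d.
have mk : cmeas (fun x => fker (x, Psi l)) := cmeas_fst _ mE.
have fEi : cint Ld (fun x => f x * fker (x, Psi l)).
  apply: (@cintM_bounded _ _ _ _ _ _ 1) => //.
  by move=> x; rewrite unimodular_fker.
rewrite /transform (cintegral_lattice unitA fEi); congr (_ * _).
have fEti := cint_lattice unitA fEi.
rewrite -(cintegral_prod_snd fEti); apply: ae_eq_cintegral.
- exact: (@cmeas_integral_snd _ _ _ _ _ Z _ fEti.1).
- apply: cmeasM; first by apply: cmeas_fold; exact: fi.1.
  exact: (cmeas_fst l (@cmeas_slab_kernel R d1 d2)).
apply: filterS (cint_snd_ae ti) => p pi.
rewrite mulrC -cintegralZl//; apply: ae_eq_cintegral.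
- exact: (cmeas_snd p fEti.1).
- by apply: cmeasM; [exact: cmeas_cst|exact: (cmeas_snd p ti.1)].
by apply: filterS (@ae_intvec R d1) => z zZ; rewrite fker_dual_lattice// mulrC.
Qed.

Lemma N2_FT_fold f (g : V -> R[i]) : cint Ld f -> cmeas g ->
  N2 mu (fun l => FT f l - g l) =
  ((c^-1)%:E * N2 Y (fun l => Complex c 0 * transform X (@slab_kernel R d1 d2) (fold f) l
    - g (Psi l))%R)%E.
Proof.
move=> fi mg; have mFT : cmeas (FT f).
  by apply: cmeas_transform; [exact: cmeas_fker|exact: fi.1].
rewrite N2_dual; last exact: cmeasB.
congr (_ * _)%E; apply: ae_eq_N2.
- exact: (cmeas_comp (measurable_dual_point A) (cmeasB mFT mg)).
- apply: cmeasB; last exact: (cmeas_comp (measurable_dual_point A) mg).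
  apply: cmeasM; first exact: cmeas_cst.
  by apply: cmeas_transform; [exact: cmeas_slab_kernel|apply: cmeas_fold; exact: fi.1].
by apply: filterS (ae_prodm_fst L (@ae_intvec R d1)) => l lZ; rewrite transform_fold.
Qed.

(** A null set meets the coset of almost no point of the slab, because its
    measure is the integral over the slab of the number of its points in the
    coset. *)
Lemma ae_lattice (P : V -> Prop) : {ae Ld, forall x, P x} ->
  {ae X, forall p, forall z, intvec d1 z -> P (theta (p, z))}.
Proof.
move=> [N [mN N0 PN]].
have mt := measurable_lattice_point A.
have m1 : measurable_fun setT (fun q => (\1_N (theta q))%:E : \bar R).
  exact: (measurableT_comp (@measurable_indic_EFin _ _ R _ mN) mt).
have p0 q : (0 <= (\1_N (theta q))%:E :> \bar R)%E by [].
have mZ : measurable_fun setT (fun p => \int[Z]_z (\1_N (theta (p, z)))%:E : \bar R)%E.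
  exact: (@measurable_fun_fubini_tonelli_F _ _ _ _ R Z _ m1 p0).
have I0 : (\int[X]_p `|\int[Z]_z (\1_N (theta (p, z)))%:E| = 0 :> \bar R)%E.
  under eq_integral do rewrite gee0_abs ?integral_ge0//.
  have : (\int[Ld]_x (\1_N x)%:E = 0 :> \bar R)%E.
    by apply: etrans N0; apply/esym; exact: (measure_integral_indic Ld mN).
  rewrite (ge0_integral_lattice unitA)//; last exact: measurable_indic_EFin.
  rewrite prodm_tonelli1// => /eqP; rewrite mule_eq0 => /orP[|/eqP//].
  by rewrite eqe gt_eqF.
have /(ae_eq_integral_abs X measurableT mZ) H := I0.
apply: filterS H => p /= /(_ Logic.I) Ip z zZ.
apply: contrapT => nP; have Nt : N (theta (p, z)) by exact: PN.
have := @ge0_integral_counting_ge R d1 (fun z => (\1_N (theta (p, z)))%:E) z zZ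
  (measurableT_comp m1 (pair1_measurable p)) (fun z => p0 _).
by rewrite Ip indicE mem_set// lee_fin ler10.
Qed.

Definition packing O := {ae X, forall p, forall z z', intvec d1 z -> intvec d1 z' ->
  O (theta (p, z)) -> O (theta (p, z')) -> z = z'}.

Definition covering O :=
  {ae X, forall p, exists2 z, intvec d1 z & O (theta (p, z))}.

Lemma fold_pick f O (p : V1 * V2) (z : V1) : cmeas f ->
  (forall x, ~ O x -> f x = 0) ->
  (forall z z', intvec d1 z -> intvec d1 z' ->
    O (theta (p, z)) -> O (theta (p, z')) -> z = z') ->
  intvec d1 z -> O (theta (p, z)) -> fold f p = f (theta (p, z)).
Proof.
move=> mf fO Op zZ Oz; apply: cintegral_counting_pick => //.
  exact: (cmeas_snd p (cmeas_lattice A mf)).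
move=> z' zZ' zz'; apply: fO => Oz'; move/eqP: zz'; apply.
exact: Op.
Qed.

(** On each coset at most one value of [f] is not zero, so that the square of
    the sum is the sum of the squares. *)
Lemma N2_fold f O : cmeas f -> (forall x, ~ O x -> f x = 0) -> packing O ->
  (c%:E * N2 X (fold f))%E = N2 Ld f.
Proof.
move=> mf fO pO; rewrite (N2_lattice unitA)//; congr (_ * _)%E.
have mt := cmeas_lattice A mf.
rewrite (N2_prod_snd X Z mt); apply: ge0_ae_eq_integral => //.
- by apply/measurable_EFinP; apply: measurable_sqr_normc; exact: cmeas_fold.
- exact: (measurable_N2_snd Z mt).
- by move=> p _; rewrite lee_fin sqr_ge0.
- by move=> p _; exact: N2_ge0.
move: pO; rewrite /packing; apply: filterS => p Op _.
have mtp : measurable_fun setT (fun z => (normc (f (theta (p, z))) ^+ 2)%:E).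
  by apply/measurable_EFinP; apply: measurable_sqr_normc; exact: (cmeas_snd p mt).
have [[z [zZ Oz]]|nO] := pselect (exists z, intvec d1 z /\ O (theta (p, z))).
  rewrite (fold_pick mf fO Op zZ Oz) /N2 (ge0_integral_counting_pick zZ)//.
    by move=> z'; rewrite lee_fin sqr_ge0.
  move=> z' zZ' zz'; rewrite fO ?ComplexField.Normc.normc0 ?expr0n// => Oz'.
  by move/eqP: zz'; apply; exact: Op.
have f0 z : intvec d1 z -> f (theta (p, z)) = 0.
  by move=> zZ; apply: fO => Oz; apply: nO; exists z.
have z0 := @intvec0 R d1.
rewrite /fold (cintegral_counting_pick z0 (cmeas_snd p mt)).
  rewrite /N2 (ge0_integral_counting_pick z0)//.
    by move=> z'; rewrite lee_fin sqr_ge0.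
  by move=> z' zZ' _; rewrite f0// ComplexField.Normc.normc0 expr0n.
by move=> z zZ _; exact: f0.
Qed.

Lemma N2_FT_packing f O : cint Ld f -> (N2 Ld f < +oo)%E ->
  (forall x, ~ O x -> f x = 0) -> packing O -> N2 mu (FT f) = N2 Ld f.
Proof.
move=> fi foo fO pO; have Fi := cint_fold fi.
have cF := N2_fold fi.1 fO pO.
have Foo : (N2 X (fold f) < +oo)%E by rewrite -(lte_lattice unitA) cF.
have -> : N2 mu (FT f) = N2 mu (fun l => FT f l - 0).
  by apply: eq_N2 => l; rewrite subr0.
rewrite (N2_FT_fold fi (cmeas_cst _ 0)).
under [X in N2 _ X]eq_fun do rewrite subr0.
rewrite N2Z; last first.
  by apply: cmeas_transform; [exact: cmeas_slab_kernel|exact: Fi.1].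
rewrite (plancherel_slab Fi Foo) -cF muleA -EFinM; congr (_%:E * _)%E.
by rewrite normc_real normr_id expr2 mulrA mulVf ?mul1r// gt_eqF.
Qed.

(** Folding is inverted: a function [F] on the slab, whose transform
    approximates [g], is spread over [O] by giving to each point of [O] the
    value of [F] at the representative of its coset. The coset meets [O]
    exactly once. *)
Lemma FT_dense O : measurable O -> packing O -> covering O ->
  forall g, cmeas g -> (N2 mu g < +oo)%E -> forall e : R, 0 < e ->
  exists f, [/\ cint Ld f, (N2 Ld f < +oo)%E, (forall x, ~ O x -> f x = 0) &
    (N2 mu (fun l => FT f l - g l)%R < e%:E)%E].
Proof.
move=> mO pO cO g mg goo e e0.
pose G l := g (Psi l).
have mG : cmeas G by exact: (cmeas_comp (measurable_dual_point A) mg).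
have Goo : (N2 Y G < +oo)%E.
  move: goo; rewrite N2_dual//; case: (N2 Y G) (N2_ge0 Y G) => [r _ _|_|//]; first exact: ltry.
  by rewrite gt0_muley// lte_fin invr_gt0.
have ce0 : 0 < c * e by rewrite mulr_gt0.
have [F [Fi Foo FG]] := transform_dense (@cmeas_slab_kernel R d1 d2)
  (@unimodular_slab_kernel R d1 d2) (@plancherel_slab R d1 d2)
  (@plancherel_slab_dual R d1 d2) mG Goo ce0.
(* The point of the slab in the coset of [x]. *)
pose rep (x : V) : V1 * V2 := (frac_cV (usubmx (invmx A *m x)), dsubmx (invmx A *m x)).
have mrep : measurable_fun setT rep.
  have mu1 : measurable_fun setT (fun x : V => usubmx (invmx A *m x)).
    apply: measurable_fun_mx => i j; under eq_fun do rewrite mxE.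
    exact: (measurableT_comp (measurable_coord _ _) (measurable_mulmx (invmx A))).
  have mu2 : measurable_fun setT (fun x : V => dsubmx (invmx A *m x)).
    apply: measurable_fun_mx => i j; under eq_fun do rewrite mxE.
    exact: (measurableT_comp (measurable_coord _ _) (measurable_mulmx (invmx A))).
  apply: measurable_fun_pair => //.
  exact: (measurableT_comp (@measurable_frac_cV R d1) mu1).
pose f x := Complex (\1_O x) 0 * (Complex c^-1 0 * F (rep x)).
have mf : cmeas f.
  apply: cmeas_indic => //; apply: cmeasM; first exact: cmeas_cst.
  exact: (cmeas_comp mrep Fi.1).
have fO x : ~ O x -> f x = 0.
  by move=> nO; rewrite /f indicE memNset// -[Complex _ _]/(0 : R[i]) mul0r.
have rep_theta p z : cube p.1 -> intvec d1 z -> rep (theta (p, z)) = p.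
  move=> pQ zZ; rewrite /rep /lattice_point mulKmx// col_mxKu col_mxKd/=.
  by rewrite frac_cVD// frac_cV_cube//; case: p {pQ}.
have f_theta p z : cube p.1 -> intvec d1 z -> O (theta (p, z)) ->
    f (theta (p, z)) = Complex c^-1 0 * F p.
  move=> pQ zZ Oz; rewrite /f rep_theta// indicE mem_set//.
  by rewrite -[Complex 1%:R _]/(1 : R[i]) mul1r.
have ae_fold : {ae X, forall p, fold f p = Complex c^-1 0 * F p}.
  have := ae_prodm_fst L (@ae_cube R d1); move: pO cO; rewrite /packing /covering.
  apply: filterS3 => p Op [z zZ Oz] pQ.
  by rewrite (fold_pick mf fO Op zZ Oz) f_theta.
have fNorm : (\int[Ld]_x (normc (f x))%:E = \int[X]_p (normc (F p))%:E)%E.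
  rewrite (normc_lattice unitA mf).
  have mt := cmeas_lattice A mf.
  have mn : measurable_fun setT (fun q => (normc (f (theta q)))%:E).
    by apply/measurable_EFinP; exact: measurable_normc.
  have n0 q : (0 <= (normc (f (theta q)))%:E)%E by rewrite lee_fin normc_ge0.
  rewrite (prodm_tonelli1 X Z mn n0).
  transitivity (c%:E * \int[X]_p ((c^-1)%:E * (normc (F p))%:E))%E.
    congr (_ * _)%E; apply: ge0_ae_eq_integral => //.
    - exact: (@measurable_fun_fubini_tonelli_F _ _ _ _ R Z _ mn n0).
    - apply: emeasurable_funM => //.
      by apply/measurable_EFinP; apply: measurable_normc; exact: Fi.1.
    - by move=> p _; exact: integral_ge0.
    - by move=> p _; rewrite -EFinM lee_fin mulr_ge0 ?invr_ge0 ?normc_ge0.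
    have := ae_prodm_fst L (@ae_cube R d1); move: pO cO; rewrite /packing /covering.
    apply: filterS3 => p Op [z zZ Oz] pQ _.
    rewrite (ge0_integral_counting_pick zZ)//.
    - by rewrite f_theta// ComplexField.Normc.normcM normc_real normfV normr_id EFinM.
    - by apply/measurable_EFinP/measurable_normc; exact: (cmeas_snd p mt).
    - move=> z' zZ' zz'; rewrite fO ?ComplexField.Normc.normc0// => Oz'.
      by move/eqP: zz'; apply; exact: Op.
  rewrite ge0_integralZl//.
  - by rewrite muleA -EFinM divff ?mul1e// gt_eqF.
  - by apply/measurable_EFinP; apply: measurable_normc; exact: Fi.1.
  - by move=> p _; rewrite lee_fin normc_ge0.
have fi : cint Ld f by split => //; rewrite fNorm; exact: Fi.2.
have mcF : cmeas (fun p => Complex c^-1 0 * F p).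
  by apply: cmeasM; [exact: cmeas_cst|exact: Fi.1].
have foo : (N2 Ld f < +oo)%E.
  rewrite -(N2_fold mf fO pO) (lte_lattice unitA).
  rewrite (ae_eq_N2 _ _ ae_fold)//; last exact: cmeas_fold.
  rewrite N2Z; last exact: Fi.1.
  by rewrite lte_mul_pinfty// lee_fin sqr_ge0.
exists f; split => //; rewrite N2_FT_fold//.
have -> : (fun l => Complex c 0 * transform X (@slab_kernel R d1 d2) (fold f) l -
    g (Psi l)) = fun l => transform X (@slab_kernel R d1 d2) F l - G l.
  apply/funext => l; congr (_ - _).
  have FEi : cint X (fun p => F p * slab_kernel (p, l)).
    apply: (@cintM_bounded _ _ _ _ _ _ 1) => //.
      exact: (cmeas_fst l (@cmeas_slab_kernel R d1 d2)).
    by move=> x; rewrite unimodular_slab_kernel.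
  rewrite /transform.
  rewrite (_ : cintegral _ _ _ = Complex c^-1 0 *
    cintegral X setT (fun p => F p * slab_kernel (p, l))).
    rewrite mulrA -[RHS]mul1r; congr (_ * _).
    by apply: complex_eqP; rewrite !cE/= ?mulr0 ?mul0r ?subr0 ?addr0 ?divff// gt_eqF.
  rewrite -cintegralZl//; apply: ae_eq_cintegral.
  - apply: cmeasM; first exact: cmeas_fold.
    exact: (cmeas_fst l (@cmeas_slab_kernel R d1 d2)).
  - by apply: cmeasM; [exact: cmeas_cst|exact: FEi.1].
  - by apply: filterS ae_fold => p ->; rewrite mulrA.
move: FG; have := N2_ge0 Y (fun l => transform X (@slab_kernel R d1 d2) F l - G l).
case: (N2 Y _) => [r||]//= r0; rewrite -EFinM !lte_fin => rce.
by rewrite ltr_pdivrMl.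
Qed.

End folding.

(** * Borel representatives for a completed measure *)

Section completion.
Context d (T : measurableType d) (R : realType).
Variable m : {sigma_finite_measure set T -> \bar R}.
Local Notation cm := (@completed_measure_extension _ _ _ m).
Local Notation CT := (caratheodory_type (m^*)%mu).
Local Open Scope ereal_scope.

Lemma measurable_completion (E : set T) : measurable E ->
  @measurable _ CT E.
Proof. exact: caratheodory_measurable_mu_ext. Qed.

Lemma completionE (E : set T) : measurable E -> cm E = m E.
Proof. exact: measurable_mu_extE. Qed.

Lemma measurable_id_completion :
  @measurable_fun _ _ CT T setT id.
Proof. by move=> _ E mE; rewrite setTI preimage_id; exact: measurable_completion. Qed.

(** The outer measure is an infimum over countable covers by Borel sets; the
    intersection of a minimizing sequence of covers attains it. *)
Lemma hull_completion (X : set T) : cm X < +oo ->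
  exists B, [/\ measurable B, X `<=` B & m B = cm X].
Proof.
move=> Xoo.
have fX : cm X \is a fin_num by rewrite ge0_fin_numE// mu_ext_ge0.
have H n : exists B, [/\ measurable B, X `<=` B & m B < cm X + (n.+1%:R^-1)%:E].
  have n0 : (0 < n.+1%:R^-1 :> R)%R by rewrite invr_gt0.
  have [_/= [F [mF XF] <-] Flt] := lb_ereal_inf_adherent n0 fX.
  exists (\bigcup_i F i); split => //; first exact: bigcupT_measurable.
  apply: le_lt_trans Flt; apply: measure_sigma_subadditive => //.
  exact: bigcupT_measurable.
have /choice[B HB] := H.
exists (\bigcap_n B n).
have mB : measurable (\bigcap_n B n) by apply: bigcapT_measurable => n; have [] := HB n.
have XB : X `<=` \bigcap_n B n by move=> x Xx n _; have [_ + _] := HB n; exact.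
split => //; apply/eqP; rewrite eq_le; apply/andP; split; last first.
  by rewrite -completionE//; exact: le_mu_ext.
apply/lee_addgt0Pr => e e0.
have [n ne] : exists n : nat, (n.+1%:R^-1 < e)%R.
  exists (Num.truncn e^-1); rewrite invf_plt ?posrE//.
  by rewrite truncnS_gt.
have [mBn _ Bn] := HB n.
apply: (@le_trans _ _ (m (B n))).
  by apply: le_measure; rewrite ?inE//; exact: bigcap_inf.
by apply: (le_trans (ltW Bn)); rewrite leeD2l// lee_fin ltW.
Qed.

Lemma negligible_completion (N : set T) :
  cm.-negligible N <-> m.-negligible N.
Proof.
split=> [[E [mE E0 NE]]|[E [mE E0 NE]]]; last first.
  by exists E; split => //; [exact: measurable_completion|rewrite completionE].
have [|B [mB EB B0]] := @hull_completion E; first by rewrite E0.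
by exists B; split => //; [rewrite B0|exact: subset_trans NE EB].
Qed.

(** A hull is taken inside each set of finite measure of an exhaustion, where
    the difference of two sets of equal measure is null. *)
Lemma outer_hull_completion (E : set T) : @measurable _ CT E ->
  exists B, [/\ measurable B, E `<=` B & m.-negligible (B `\` E)].
Proof.
move=> mE; have /sigma_finiteP[F [FT ndF Foo]] := sigma_finiteT m.
have mF i : measurable (F i) by have [] := Foo i.
have H i : exists B, [/\ measurable B, E `&` F i `<=` B &
    m.-negligible (B `\` (E `&` F i))].
  have mEF : @measurable _ CT (E `&` F i).
    by apply: measurableI => //; exact: measurable_completion.
  have EFoo : cm (E `&` F i) < +oo.
    apply: (@le_lt_trans _ _ (cm (F i))); first exact: le_mu_ext.
    by rewrite completionE//; have [] := Foo i.
  have [B [mB EB B0]] := hull_completion EFoo.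
  exists B; split => //; apply/negligible_completion.
  have mB' := measurable_completion mB.
  exists (B `\` (E `&` F i)); split => //; first exact: measurableD.
  have cB : cm B = cm (E `&` F i) by rewrite completionE.
  have Boo : cm B < +oo by rewrite cB.
  rewrite (measureD mB' mEF Boo) (setIidr EB) [X in (X - _)%E](cB : _ = cm _).
  by rewrite subee// ge0_fin_numE.
have /choice[B HB] := H.
exists (\bigcup_i B i); split.
- by apply: bigcupT_measurable => i; have [] := HB i.
- move=> x Ex; have : setT x by []. 
  by rewrite FT => -[i _ Fix]; exists i => //; have [_ + _] := HB i; apply.
- apply: (@negligibleS _ _ _ _ (\bigcup_i (B i `\` (E `&` F i)))).
    by move=> x [[i _ Bix] nE]; exists i => //; split => // -[].
  by apply: negligible_bigcup => i; have [] := HB i.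
Qed.

Lemma inner_core_completion (E : set T) : @measurable _ CT E ->
  exists B, [/\ measurable B, B `<=` E & m.-negligible (E `\` B)].
Proof.
move=> mE; have [B [mB EB nB]] := outer_hull_completion (measurableC mE).
exists (~` B); split; first exact: measurableC.
  by rewrite -[E]setCK; exact: subsetC.
by apply: negligibleS nB => x [Ex] /contrapT Bx; split.
Qed.

(** Each set on which [f] exceeds a rational number differs from a Borel set by
    a null set; outside the countable union of these null sets, [f] is Borel.
    *)
Lemma measurable_fun_completion (f : T -> R) :
  @measurable_fun _ _ CT (measurableTypeR R) setT f ->
  exists D, [/\ measurable D, m.-negligible (~` D) & measurable_fun D f].
Proof.
move=> mf.
have H (q : rat) : exists BN : set T * set T, [/\ measurable BN.1, measurable BN.2,
    m BN.2 = 0, BN.1 `<=` [set x | (ratr q < f x)%R] &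
    [set x | (ratr q < f x)%R] `<=` BN.1 `|` BN.2].
  have mq : @measurable _ CT [set x | (ratr q < f x)%R].
    have := mf measurableT _ (@measurable_itv R `]ratr q, +oo[).
    by rewrite setTI; congr measurable; apply/seteqP; split => x /=; rewrite in_itv/= andbT.
  have [B [mB Bq [N [mN N0 qN]]]] := inner_core_completion mq.
  exists (B, N); split => //= x qx; have [|nB] := pselect (B x); first by left.
  by right; apply: qN.
have /choice[BN HBN] := H.
pose N := \bigcup_(q : rat) (BN q).2.
have mN : measurable N.
  by apply: countable_bigcupT_measurable => [|q]; [exact: countableP|have [] := HBN q].
exists (~` N); split; first exact: measurableC.
  rewrite setCK; have -> : N = \bigcup_n (if choice.unpickle n is Some q then (BN q).2 else set0).
    apply/seteqP; split => [x [q _ Nx]|x [n _]].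
      by exists (choice.pickle q); [exact: Logic.I|rewrite choice.pickleK].
    by case: choice.unpickle => // q Nx; exists q.
  apply: negligible_bigcup => n; case: choice.unpickle => [q|]; last exact: negligible_set0.
  by have [_ mNq N0 _ _] := HBN q; exists (BN q).2; split.
apply: (measurability _ (RGenOInfty.measurableE R)).
move=> _ [_ [r ->] <-].
rewrite (_ : ~` N `&` _ = ~` N `&` \bigcup_(q in [set q : rat | (r < ratr q)%R]) (BN q).1).
  apply: measurableI; first exact: measurableC.
  rewrite bigcup_mkcond; apply: countable_bigcupT_measurable => [|q]; first exact: countableP.
  by case: ifP => // _; have [] := HBN q.
apply/seteqP; split => x [Nx /=].
  rewrite in_itv/= andbT => rf; split => //.
  have [q] := rat_in_itvoo rf; rewrite in_itv/= => /andP[rq qf].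
  exists q => //; have [_ _ _ _ /(_ _ qf)[//|Nq]] := HBN q.
  by exfalso; apply: Nx; exists q.
move=> [q /= rq Bq]; split => //; rewrite in_itv/= andbT.
by have [_ _ _ /(_ _ Bq) qf _] := HBN q; exact: lt_trans qf.
Qed.

Lemma cmeas_completion (D : set T) (h : T -> R[i]) : cmeas h ->
  @cmeasurable_fun _ CT R D h.
Proof.
move=> mh; have [mr mi] : @cmeasurable_fun _ CT R setT h.
  exact: (cmeas_comp measurable_id_completion mh).
by split; apply: measurable_funTS.
Qed.

Section completed_functions.
Local Open Scope ring_scope.
Variables (Omega : set T) (mOmega : @measurable _ CT Omega).
Implicit Types f g : T -> R[i].

Let zero_extension f : T -> R[i] := fun x => if x \in Omega then f x else 0.

Let cmeas_zero_extension f : @cmeasurable_fun _ CT R Omega f ->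
  @cmeasurable_fun _ CT R setT (zero_extension f).
Proof.
move=> [/(measurable_restrictT _ mOmega) mr /(measurable_restrictT _ mOmega) mi].
by split; [move: mr|move: mi]; apply: eq_measurable_fun => x _;
  rewrite /zero_extension patchE; case: ifP.
Qed.

Lemma borel_representative (Omega0 : set T) f : measurable Omega0 ->
  Omega0 `<=` Omega -> m.-negligible (Omega `\` Omega0) ->
  @cmeasurable_fun _ CT R Omega f ->
  exists g, [/\ cmeas g, forall x, ~ Omega0 x -> g x = 0 &
    {ae cm, forall x : CT, Omega x -> f x = g x}].
Proof.
move=> m0 s0 n0 /cmeas_zero_extension[mr mi].
have [D1 [mD1 nD1 f1]] := measurable_fun_completion mr.
have [D2 [mD2 nD2 f2]] := measurable_fun_completion mi.
pose D := D1 `&` D2 `&` Omega0.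
have mD : measurable D by apply: measurableI => //; exact: measurableI.
have DO x : D x -> Omega x by move=> [_]; exact: s0.
exists (fun x => if x \in D then f x else 0); split.
- have {}f1 : measurable_fun D (fun x => Re (zero_extension f x)).
    by apply: measurable_funS f1 => // x [[]].
  have {}f2 : measurable_fun D (fun x => Im (zero_extension f x)).
    by apply: measurable_funS f2 => // x [[]].
  move/(measurable_restrictT _ mD) : f1 => f1.
  move/(measurable_restrictT _ mD) : f2 => f2.
  by split; [move: f1|move: f2]; apply: eq_measurable_fun => x _;
    rewrite patchE /zero_extension; case: ifPn => // xD; rewrite mem_set//; exact: DO (set_mem xD).
- by move=> x nx; rewrite memNset// => -[].
apply/negligible_completion.
apply: (@negligibleS _ _ _ _ ((~` D1 `|` ~` D2) `|` (Omega `\` Omega0))); last first.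
  by apply: negligibleU => //; exact: negligibleU.
move=> x /= /not_implyP[Ox]; case: ifPn => [//|/negP xD _].
have [x0|] := pselect (Omega0 x); last by right.
left; apply: contrapT => /not_orP[/contrapT ? /contrapT ?]; by apply: xD; rewrite inE.
Qed.

Variables f g : T -> R[i].
Hypothesis mf : @cmeasurable_fun _ CT R Omega f.
Hypothesis mg : cmeas g.
Hypothesis gO : forall x, ~ Omega x -> g x = 0.
Hypothesis fg : {ae cm, forall x : CT, Omega x -> f x = g x}.

Let fg' : {ae cm, forall x : CT, zero_extension f x = g x}.
Proof.
apply: filterS fg => x fgx; rewrite /zero_extension.
case: ifPn => [xO|/negP nO]; first by rewrite fgx//; exact: set_mem.
by rewrite gO// => Ox; apply: nO; rewrite inE.
Qed.

Lemma cintegral_completion : cintegral cm Omega f = cintegral m setT g.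
Proof.
transitivity (@cintegral _ CT R cm setT (zero_extension f)).
  rewrite /cintegral !(Rintegral_mkcond cm Omega).
  by congr Complex; apply: eq_Rintegral => x _; rewrite patchE /zero_extension; case: ifP.
rewrite (ae_eq_cintegral (cmeas_zero_extension mf) (cmeas_completion setT mg) fg').
rewrite (@cintegral_transport _ _ CT T R cm m id measurable_id_completion) //.
by move=> D mD; exact/esym/completionE.
Qed.

Lemma integral_normc_completion k : (0 < k)%N ->
  (\int[cm]_(x in Omega) (normc (f x) ^+ k)%:E = \int[m]_x (normc (g x) ^+ k)%:E)%E.
Proof.
move=> k0; have mh (h : T -> R[i]) : @cmeasurable_fun _ CT R setT h ->
    @measurable_fun _ _ CT _ setT (fun x => (normc (h x) ^+ k)%:E).
  by move=> /measurable_normc mh; apply/measurable_EFinP; exact: measurable_funX.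
rewrite integral_mkcond.
transitivity (@integral _ CT R cm setT (fun x => (normc (zero_extension f x) ^+ k)%:E)).
  apply: eq_integral => x _; rewrite patchE /zero_extension; case: ifP => // _.
  by rewrite ComplexField.Normc.normc0 expr0n gtn_eqF.
transitivity (@integral _ CT R cm setT (fun x => (normc (g x) ^+ k)%:E)).
  apply: ge0_ae_eq_integral => //.
  - by apply: mh; exact: cmeas_zero_extension.
  - by apply: mh; exact: cmeas_completion.
  - by move=> x _; rewrite lee_fin exprn_ge0// normc_ge0.
  - by move=> x _; rewrite lee_fin exprn_ge0// normc_ge0.
  - by apply: filterS fg' => x ->.
rewrite (@ge0_integral_transport _ _ CT T R cm m id measurable_id_completion) //.
- by move=> D mD; exact/esym/completionE.
- by apply/measurable_EFinP; apply: measurable_funX; exact: measurable_normc.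
- by move=> x; rewrite lee_fin exprn_ge0// normc_ge0.
Qed.

End completed_functions.

End completion.

(** * Radon measures *)

Section compact_sets.
Variables (R : realType) (n : nat).
Local Notation V := 'cV[R]_n.

Definition box (M : R) : set V := [set v | forall i, `|v i ord0| <= M].

Lemma closed_box M : closed (box M).
Proof.
rewrite (_ : box M = \bigcap_(i in [set: 'I_n])
    (fun v : V => v i ord0) @^-1` [set x | `|x| <= M]); last first.
  by apply/seteqP; split => v /= H i; [move=> _|]; exact: H.
apply: closed_bigI => i _; apply: closed_comp => [x _|].
  exact: coord_continuous.
apply: (@closed_comp _ _ (fun x : R => `|x|) [set y | y <= M]).
  by move=> x _; exact: norm_continuous.
exact: closed_le.
Qed.

Lemma compact_box M : compact (box M).
Proof.
pose B := [set v : 'rV[R]_n | forall i, `[- M, M]%classic (v ord0 i)].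
have cB : compact B by apply: (@rV_compact R n (fun=> `[- M, M]%classic)) => i; exact: segment_compact.
have -> : box M = trmx @` B.
  apply/seteqP; split => [v vM|_ [v vB <-] i].
    exists v^T; last by rewrite trmxK.
    by move=> i; rewrite /= in_itv/= mxE -ler_norml.
  by have := vB i; rewrite /= in_itv/= mxE -ler_norml.
apply: continuous_compact => //; apply: continuous_subspaceT => v.
move=> S /nbhs_ballP[e /= e0 eS]; apply/nbhs_ballP; exists e => //= w vw.
by apply: eS; split => // i j; rewrite !mxE; apply: vw.2.
Qed.

Lemma compact_sub_box (K : set V) : compact K -> exists M, K `<=` box M.
Proof.
move=> cK; have H i : exists M, forall v, K v -> `|v i ord0| <= M.
  have /compact_bounded[M [_ KM]] : compact ((fun v : V => v i ord0 : R^o) @` K).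
    apply: continuous_compact => //; apply: continuous_subspaceT.
    exact: coord_continuous.
  by exists (M + 1) => v Kv; apply: (KM (M + 1)); [rewrite ltrDl|exists v].
have /choice[M HM] := H.
exists (\sum_i `|M i|) => v Kv i; rewrite (bigD1 i)//=.
rewrite (le_trans (HM i v Kv))// (le_trans (ler_norm _))// lerDl.
exact: sumr_ge0.
Qed.

Lemma bigcup_box : \bigcup_(k : nat) box k%:R = setT.
Proof.
apply/seteqP; split => // v _.
exists (Num.truncn (\sum_i `|v i ord0|)).+1 => // i.
rewrite ltW// (le_lt_trans _ (truncnS_gt _))// (bigD1 i)//= lerDl.
exact: sumr_ge0.
Qed.

Lemma le_box (M N : R) : M <= N -> box M `<=` box N.
Proof. by move=> MN v vM i; exact: le_trans (vM i) MN. Qed.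

Lemma measurable_closed_cV (C : set V) : closed C -> measurable C.
Proof.
by move=> cC; rewrite -[C]setCK; apply: measurableC; apply: open_measurable_mx;
  exact: closed_openC.
Qed.

End compact_sets.

Section regularity.
Variables (R : realType) (n : nat).
Local Notation V := 'cV[R]_n.
Variable m : {measure set V -> \bar R}.
Hypothesis m_compact : forall K : set V, compact K -> (m K < +oo)%E.
Local Notation B k := (@box R n k%:R).

Let sandwiched (E : set V) := forall (k : nat) (e : R), 0 < e ->
  exists C U, [/\ closed C, open U, C `<=` E, E `<=` U &
    (m ((U `\` C) `&` B k) < e%:E)%E].

Let mB k : measurable (B k).
Proof. by apply: measurable_closed_cV; exact: closed_box. Qed.

Let mUC (U C : set V) k : open U -> closed C -> measurable ((U `\` C) `&` B k).
Proof.
move=> oU cC; apply: measurableI => //; apply: measurableD.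
  exact: open_measurable_mx.
exact: measurable_closed_cV.
Qed.

Let small_tail (F : (set V)^nat) k (e : R) : 0 < e ->
  (forall j, measurable (F j)) -> nonincreasing_seq F ->
  (m (\bigcap_j F j `&` B k) < e%:E)%E -> exists j, (m (F j `&` B k) < e%:E)%E.
Proof.
move=> e0 mF niF Fe.
have mI j : measurable (F j `&` B k) by apply: measurableI.
have FE : \bigcap_j (F j `&` B k) = \bigcap_j F j `&` B k.
  apply/seteqP; split => [v H|v [H1 H2] j _]; last by split => //; exact: H1.
  by split => [j _|]; [have [] := H j Logic.I|have [] := H 0%N Logic.I].
have F0 : (m (F 0%N `&` B k) < +oo)%E.
  apply: le_lt_trans (m_compact (@compact_box R n k%:R)).
  by apply: le_measure; rewrite ?inE//; exact: subIsetr.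
have niI : nonincreasing_seq (fun j => F j `&` B k).
  by move=> i j ij; apply/subsetPset; apply: setSI; apply/subsetPset/niF.
have mcap : measurable (\bigcap_j (F j `&` B k)) by exact: bigcapT_measurable.
have := nonincreasing_cvg_mu F0 mI mcap niI; rewrite FE.
move=> Fcvg; apply: contrapT => /forallNP nF; move: Fe; apply/negP; rewrite -leNgt.
rewrite -(cvg_lim _ Fcvg)//; apply: lime_ge; first by apply/cvg_ex; eexists; exact: Fcvg.
by apply: nearW => j; rewrite leNgt; apply/negP; exact: nF.
Qed.

Let sandwiched_closed F : closed F -> sandwiched F.
Proof.
move=> cF k e e0.
pose U (j : nat) : set V := \bigcup_(y in F) (ball y (j.+1%:R^-1 : R))°.
have oU j : open (U j) by apply: bigcup_open => y _; exact: open_interior.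
have j0 (j : nat) : 0 < j.+1%:R^-1 :> R by rewrite invr_gt0.
have FU j : F `<=` U j.
  by move=> y Fy; exists y => //; apply: nbhsx_ballx; rewrite invr_gt0.
have capU : \bigcap_j (U j `\` F) = set0.
  apply/seteqP; split => // x H; have [_ nF] := H 0%N Logic.I; apply: nF.
  apply: cF => S /nbhs_ballP[r /= r0 rS].
  have [j jr] : exists j : nat, j.+1%:R^-1 < r.
    by exists (Num.truncn r^-1); rewrite invf_plt ?posrE// truncnS_gt.
  have [[y Fy /interior_subset yx] _] := H j Logic.I.
  by exists y; split => //; apply: rS; apply: le_ball (ltW jr) _ _; exact: ball_sym.
have niU : nonincreasing_seq (fun j => U j `\` F).
  move=> i j ij; apply/subsetPset; apply: setSD => x [y Fy yx]; exists y => //.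
  move: yx; apply: interiorS; apply: le_ball.
  by rewrite lef_pV2 ?posrE// ler_nat.
have [|||j jlt] := @small_tail (fun j => U j `\` F) k e e0.
- move=> j; apply: measurableD; [exact: open_measurable_mx|exact: measurable_closed_cV].
- exact: niU.
- by rewrite capU set0I measure0 lte_fin.
by exists F, (U j); split.
Qed.

Let sandwichedC E : sandwiched E -> sandwiched (~` E).
Proof.
move=> sE k e e0; have [C [U [cC oU CE EU UC]]] := sE k e e0.
exists (~` U), (~` C); split; [exact: open_closedC|exact: closed_openC|exact: subsetC|exact: subsetC|].
rewrite (_ : ~` C `\` ~` U = U `\` C)//.
by rewrite !setDE setCK setIC.
Qed.

Let sandwiched_bigcup (E : (set V)^nat) : (forall i, sandwiched (E i)) ->
  sandwiched (\bigcup_i E i).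
Proof.
move=> sE k e e0.
have e2 (i : nat) : 0 < e / 2 / (2 ^ i.+1)%:R.
  by rewrite !divr_gt0// ltr0n expn_gt0.
have /choice[CU HCU] : forall i, exists CU : set V * set V, [/\ closed CU.1, open CU.2,
    CU.1 `<=` E i, E i `<=` CU.2 &
    (m ((CU.2 `\` CU.1) `&` B k) < (e / 2 / (2 ^ i.+1)%:R)%:E)%E].
  by move=> i; have [C [U H]] := sE i k _ (e2 i); exists (C, U).
pose U := \bigcup_i (CU i).2; pose D j := \bigcup_(i in `I_j) (CU i).1.
have oU : open U by apply: bigcup_open => i _; have [] := HCU i.
have cD j : closed (D j).
  by apply: closed_bigcup => // i _; have [] := HCU i.
have [|||j jlt] := @small_tail (fun j => U `\` D j) k e e0.
- by move=> j; apply: measurableD; [exact: open_measurable_mx|exact: measurable_closed_cV].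
- move=> i j ij; apply/subsetPset; apply: setDS; apply: bigcup_subset => l /= li.
  exact: leq_trans ij.
- have mi i : measurable (((CU i).2 `\` (CU i).1) `&` B k).
    by apply: mUC; have [] := HCU i.
  apply: (@le_lt_trans _ _ (\sum_(0 <= i <oo) m (((CU i).2 `\` (CU i).1) `&` B k))%E).
    apply: measure_sigma_subadditive => //.
      apply: measurableI => //; apply: bigcapT_measurable => j.
      by apply: measurableD; [exact: open_measurable_mx|exact: measurable_closed_cV].
    move=> x [H Bx]; have [[i _ Ux] _] := H 0%N Logic.I.
    exists i => //; split => //; split => // Cx.
    by have [_] := H i.+1 Logic.I; apply; exists i => //=.
  apply: (@le_lt_trans _ _ (e / 2)%:E); last by rewrite lte_fin ltr_pdivrMr// ltr_pMr// ltr1n.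
  apply: le_trans (epsilon_trick0 xpredT _); last by rewrite divr_ge0// ltW.
  by apply: lee_nneseries => // i _; apply: ltW; have [] := HCU i.
exists (D j), U; split => //.
- by move=> x [i _ Cx]; exists i => //; have [_ _ + _ _] := HCU i; apply.
- by move=> x [i _ Ex]; exists i => //; have [_ _ _ + _] := HCU i; apply.
Qed.

(** The sets that, inside each box, can be sandwiched up to a small measure
    between a closed set and an open set form a sigma-algebra that contains the
    closed sets. A closed subset of a box is compact. *)
Lemma inner_regular (E : set V) : measurable E ->
  m E = ereal_sup [set m K | K in [set K | compact K /\ K `<=` E]].
Proof.
move=> mE.
have sE : sandwiched E.
  suff : measurable `<=` sandwiched by apply.
  apply: smallest_sub => [|U oU].
    split.
    - by apply: sandwiched_closed; exact: closed0.
    - by move=> A sA; rewrite setTD; exact: sandwichedC.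
    - exact: sandwiched_bigcup.
  by rewrite -[U]setCK; apply/sandwichedC/sandwiched_closed; exact: open_closedC.
apply/eqP; rewrite eq_le; apply/andP; split; last first.
  apply: ge_ereal_sup => _ [K [cK KE] <-].
  apply: le_measure => //; rewrite inE//; apply: measurable_closed_cV.
  by apply: compact_closed cK; exact: norm_hausdorff.
set s := ereal_sup _.
have EB k : (m (E `&` B k) <= s)%E.
  apply/lee_addgt0Pr => e e0; have [C [U [cC oU CE EU UC]]] := sE k e e0.
  have cCB : compact (C `&` B k).
    by rewrite setIC; apply: compact_closedI => //; exact: compact_box.
  have mC := measurable_closed_cV cC.
  apply: (@le_trans _ _ (m (C `&` B k) + m ((U `\` C) `&` B k))%E).
    apply: (@le_trans _ _ (m ((C `&` B k) `|` ((U `\` C) `&` B k)))).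
      apply: le_measure; rewrite ?inE; [exact: measurableI|apply: measurableU; [exact: measurableI|exact: mUC]|].
      move=> x [Ex Bx]; have [Cx|nC] := pselect (C x); [by left|right].
      by split => //; split => //; exact: EU.
    apply: measureU2; [exact: measurableI|exact: mUC].
  apply: leeD; last exact: ltW.
  by apply: ereal_sup_ubound; exists (C `&` B k) => //; split => // x [/CE].
have ndB : nondecreasing_seq (fun k => E `&` B k).
  by move=> i j ij; apply/subsetPset; apply: setIS; apply: le_box; rewrite ler_nat.
have cE : (fun k => m (E `&` B k)) @ \oo --> m E.
  rewrite -[X in _ --> m X](setIT E) -bigcup_box setI_bigcupr.
  apply: nondecreasing_cvg_mu => //; first by move=> i; exact: measurableI.
  by apply: bigcupT_measurable => i; exact: measurableI.
rewrite -(cvg_lim _ cE)//; apply: lime_le; first by apply/cvg_ex; eexists; exact: cE.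
exact: nearW.
Qed.

Lemma radon_compact_lty : radon m.
Proof. by split => //; exact: inner_regular. Qed.

End regularity.

Section dual_measure.
Variables (R : realType).

Lemma measurable_box n (M : R) : measurable (@box R n M).
Proof. by apply: measurable_closed_cV; exact: closed_box. Qed.

Lemma lebesgue_box n (M : R) : (lebesgue_cV R n (box M) < +oo)%E.
Proof.
have -> : @box R n M = [set v | forall i, `[- M, M]%classic (v i ord0)].
  by apply/seteqP; split => v /= H i; have := H i; rewrite /= in_itv/= -ler_norml.
rewrite lebesgue_cV_box; last exact: measurable_itv.
by rewrite -ge0_fin_numE ?expe_ge0// fin_numX// lebesgue_measure_itv/=; case: ifP.
Qed.

(** The unit cells of the integer points of a box are disjoint and lie in a
    larger box. *)
Lemma counting_box n (M : R) : (@counting_intvec R n (box M) < +oo)%E.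
Proof.
have mB (N : R) := @measurable_box n N.
apply: le_lt_trans (@lebesgue_box n (M + 1)).
rewrite (measure_integral_indic _ (mB (M + 1))) ge0_integral_unfold//; last exact: measurable_indic_EFin.
apply: (@le_trans _ _ (\int[@mcube R n]_x counting_intvec n (box M))%E).
  rewrite integral_cst//.
  by rewrite [X in (_ * X)%E](@mcube_setT R n) mule1.
have mi (x : 'cV[R]_n) : measurable_fun setT (fun z => (\1_(box (M + 1)) (x + z))%:E : \bar R).
  apply: (measurableT_comp (measurable_indic_EFin (mB (M + 1)))).
  by apply: measurable_addmx => //; exact: measurable_cst.
apply: ae_ge0_le_integral => //.
- by move=> x _; exact: integral_ge0.
- pose f (p : 'cV[R]_n * 'cV[R]_n) : \bar R := (\1_(box (M + 1)) (p.1 + p.2))%:E.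
  have mf : measurable_fun setT f.
    apply: (measurableT_comp (measurable_indic_EFin (mB (M + 1)))).
    exact: measurable_addmx measurable_fst measurable_snd.
  have f0 p : (0 <= f p)%E by rewrite lee_fin.
  exact: (@measurable_fun_fubini_tonelli_F _ _ _ _ R (@counting_intvec R n) f mf f0).
apply: filterS (@ae_cube R n) => x xQ _.
rewrite (measure_integral_indic _ (mB M)); apply: ge0_le_integral => //.
- exact: measurable_indic_EFin.
move=> z _; rewrite lee_fin !indicE; have [zM|zM] := pselect (box M z).
  rewrite !mem_set// => i; rewrite mxE (le_trans (ler_normD _ _))// addrC lerD//.
  by have := xQ i; move=> /andP[x0 x1]; rewrite ger0_norm// ltW.
by rewrite (memNset zM).
Qed.

Variables (d1 d2 : nat) (A : 'M[R]_(d1 + d2)).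
Hypothesis unitA : A \in unitmx.
Local Notation mu := (transpose_measure unitA (intvec_lebesgue d1 d2)).

(** The linear map [A^T] sends a box into a box, so that the measure is finite
    on boxes. *)
Lemma radon_dual_measure : radon mu.
Proof.
apply: radon_compact_lty => K cK; have [M KM] := compact_sub_box cK.
have mB := @measurable_box.
apply: (@le_lt_trans _ _ (mu (box M))).
  apply: le_measure => //; rewrite inE; apply: measurable_closed_cV.
    by apply: compact_closed cK; exact: norm_hausdorff.
  exact: closed_box.
(* The sum of all entries bounds the sum over each row. *)
pose N : R := \sum_i \sum_j `|A^T i j| * `|M|.
have SN (l : 'cV[R]_d1 * 'cV[R]_d2) : box M (dual_point A l) -> box N l.1 /\ box N l.2.
  move=> Ml; have lE : col_pair l = A^T *m dual_point A l.
    by rewrite /dual_point mulKVmx// unitmx_tr.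
  have colN : box N (col_pair l).
    move=> i; rewrite lE mxE /N [leRHS](bigD1 i)//= -[leLHS]addr0 lerD//; last first.
      by apply: sumr_ge0 => k _; apply: sumr_ge0 => j _; rewrite mulr_ge0.
    rewrite (le_trans (ler_norm_sum _ _ _))//; apply: ler_sum => j _.
    by rewrite normrM ler_wpM2l// (le_trans (Ml j))// ler_norm.
  split=> i; first by have := colN (lshift d2 i); rewrite /col_pair col_mxEu.
  by have := colN (rshift d1 i); rewrite /col_pair col_mxEd.
have mP := @measurable_dual_point R d1 d2 A.
rewrite [ltLHS](measure_integral_indic mu (mB _ M)) ge0_integral_dual//; last exact: (measurable_indic_EFin (mB _ M)).
rewrite lte_mul_pinfty// ?lee_fin ?invr_ge0//.
apply: (@le_lt_trans _ _ (prodm (@counting_intvec R d1) (lebesgue_cV R d2) (box N `*` box N))).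
  have mNN : measurable (box N `*` box N : set ('cV[R]_d1 * 'cV[R]_d2)) by exact: measurableX.
  rewrite (measure_integral_indic _ mNN); apply: ge0_le_integral => //.
  - exact: (measurableT_comp (measurable_indic_EFin (mB _ M)) mP).
  - exact: measurable_indic_EFin.
  move=> l _; rewrite lee_fin !indicE; have [lM|lM] := pselect (box M (dual_point A l)).
    by rewrite (mem_set lM) mem_set//; exact: SN.
  by rewrite (memNset lM).
rewrite /prodm product_measure1E; [|exact: mB|exact: mB]; apply: lte_mul_pinfty => //.
- by rewrite ge0_fin_numE//; exact: counting_box.
- exact: lebesgue_box.
Qed.

End dual_measure.

(** * Translates, overlaps and gaps *)

Section translates.
Variables (R : realType) (n : nat).
Local Notation V := 'cV[R]_n.
Local Notation L := (lebesgue_cV R n).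
Implicit Types (O N : set V) (t x : V).

Lemma translateE O t : translate O t = [set x | O (x - t)].
Proof.
apply/seteqP; split => [_ [x Ox <-]|x Ox]; first by rewrite /= addrK.
by exists (x - t) => //; rewrite subrK.
Qed.

Lemma translateB O s t :
  translate O s `&` translate O t = translate (O `&` translate O (t - s)) s.
Proof.
rewrite !translateE; apply/seteqP; split => x /= [H1 H2]; split => //; move: H2;
  by rewrite opprB addrA subrK.
Qed.

Lemma measurable_translate O t : measurable O -> measurable (translate O t).
Proof.
move=> mO; rewrite translateE -[X in measurable X]setTI.
by apply: (@measurable_addmx R n _ _ id (fun=> - t)) => //; exact: measurable_cst.
Qed.

Lemma lebesgue_translate O t : measurable O -> L (translate O t) = L O.
Proof.
move=> mO; rewrite (measure_integral_indic L (measurable_translate t mO)).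
rewrite (measure_integral_indic L mO).
rewrite -[RHS](ge0_integral_translate (- t))//; last exact: measurable_indic_EFin.
by apply: eq_integral => x _; rewrite translateE !indicE.
Qed.

Lemma negligible_translate N t : L.-negligible N -> L.-negligible (translate N t).
Proof.
move=> [B [mB B0 NB]]; exists (translate B t); split.
- exact: measurable_translate.
- by rewrite lebesgue_translate.
- by move=> _ [x Nx <-]; exists x => //; exact: NB.
Qed.

(** There are countably many integer points. *)
Lemma negligible_bigcup_intvec (F : V -> set V) k (f : 'cV[R]_k -> V) :
  (forall z, intvec k z -> L.-negligible (F (f z))) ->
  L.-negligible (\bigcup_(z in intvec k) F (f z)).
Proof.
move=> F0.
pose e (i : nat) : option 'cV[int]_k := choice.unpickle i.
pose G i := if e i is Some z then F (f (map_mx intr z)) else set0.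
apply: (@negligibleS _ _ _ _ (\bigcup_i G i)).
  move=> x [z zZ Fx].
  have /choice[w Hw] : forall i, exists a : int, z i ord0 = a%:~R.
    by move=> i; apply/intrP; exact: zZ.
  exists (choice.pickle (\col_i w i)); first exact: Logic.I.
  rewrite /G /e choice.pickleK; suff -> : map_mx intr (\col_i w i) = z by [].
  by apply/matrixP => i j; rewrite !mxE ord1 -Hw.
apply: negligible_bigcup => i; rewrite /G; case: (e i) => [z|]; last exact: negligible_set0.
by apply: F0 => j; rewrite mxE; exact: intr_int.
Qed.

End translates.

Section lattice_cells.
Variables (R : realType) (d1 d2 : nat) (A : 'M[R]_(d1 + d2)).
Hypothesis unitA : A \in unitmx.
Local Notation d := (d1 + d2)%N.
Local Notation V1 := 'cV[R]_d1.
Local Notation V2 := 'cV[R]_d2.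
Local Notation V := 'cV[R]_d.
Local Notation L := (lebesgue_cV R d).
Local Notation theta := (lattice_point A).
Implicit Types (O N C : set V) (z w : V1).

Definition lattice_vec z : V := A *m col_mx z 0.
Local Notation tau := lattice_vec.

Lemma lattice_pointD (p : V1 * V2) z w : theta (p, z + w) = theta (p, z) + tau w.
Proof. by rewrite /lattice_point /tau -mulmxDr add_col_mx/= addr0 addrA. Qed.

Lemma lattice_vec_eq0 z : tau z = 0 -> z = 0.
Proof.
rewrite /tau => /(congr1 (mulmx (invmx A))); rewrite mulKmx// mulmx0.
by rewrite -(col_mx0 _ d1 d2 1) => /eq_col_mx[].
Qed.

(** By translation invariance, the overlaps of two translates reduce to those
    of a set with one of its translates. *)
Definition no_overlap O := forall z, intvec d1 z -> z != 0 ->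
  L.-negligible (O `&` translate O (tau z)).

Definition no_gap O :=
  L.-negligible (~` \bigcup_(z in intvec d1) translate O (tau z)).

Lemma no_overlap_packing O : no_overlap O -> packing A O.
Proof.
move=> nO; have : {ae L, forall x, forall z, intvec d1 z -> O x -> O (x - tau z) -> z = 0}.
  apply: (@negligibleS _ _ _ _ (\bigcup_(z in intvec d1)
      (if z == 0 then set0 else O `&` translate O (tau z)))).
    move=> x /= /existsNP[z /not_implyP[zZ /not_implyP[Ox /not_implyP[Oxz z0]]]].
    exists z => //; case: eqP => // _; split => //.
    by rewrite translateE.
  pose F (v : V) := if v == 0 then set0 else O `&` translate O v.
  rewrite (_ : \bigcup_(z in _) _ = \bigcup_(z in intvec d1) F (tau z)); last first.
    apply: eq_bigcupr => z zZ; rewrite /F; have [->|z0] := eqVneq z 0.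
      by rewrite /tau col_mx0 mulmx0 eqxx.
    by case: eqP => // /lattice_vec_eq0/eqP; rewrite (negbTE z0).
  apply: negligible_bigcup_intvec => z zZ; rewrite /F; case: eqP => [_|z0].
    exact: negligible_set0.
  apply: nO => //; apply/eqP => z0'; apply: z0.
  by rewrite z0' /tau col_mx0 mulmx0.
move/(ae_lattice unitA); rewrite /packing; apply: filterS => p H z z' zZ zZ' Oz Oz'.
have [] // : z - z' = 0.
  apply: (H z zZ); [exact: intvecB|exact: Oz|].
  suff -> : theta (p, z) = theta (p, z') + tau (z - z') by rewrite addrK.
  by rewrite -lattice_pointD addrC subrK.
by move=> /eqP; rewrite subr_eq0 => /eqP.
Qed.

Lemma no_gap_covering O : no_gap O -> covering A O.
Proof.
move=> gO; have : {ae L, forall x, exists2 z, intvec d1 z & O (x - tau z)}.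
  apply: negligibleS gO => x /= nx [z zZ]; rewrite translateE => Oz.
  by apply: nx; exists z.
move/(ae_lattice unitA); rewrite /covering; apply: filterS => p H.
have [z zZ Oz] := H 0 (@intvec0 R d1).
exists (- z); first exact: intvecN.
suff <- : theta (p, 0) - tau z = theta (p, - z) by [].
by rewrite -[in RHS](add0r (- z)) lattice_pointD /lattice_vec -[- (A *m _)]mulmxN opp_col_mx oppr0.
Qed.

(** The translates of a cell by the lattice form a partition of the space: a
    set inside a cell has disjoint translates. *)
Definition cell w : set V := [set x | cube (usubmx (invmx A *m x) - w)].

Lemma measurable_cell w : measurable (cell w).
Proof.
rewrite -[X in measurable X]setTI.
have m1 : measurable_fun setT (fun x : V => usubmx (invmx A *m x)).
  apply: measurable_fun_mx => i j; under eq_fun do rewrite mxE.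
  exact: (measurableT_comp (measurable_coord _ _) (measurable_mulmx (invmx A))).
apply: (@measurable_addmx R d1 _ _ _ (fun=> - w) m1 (measurable_cst _)) => //.
exact: measurable_cube.
Qed.

Lemma bigcup_cell : \bigcup_(w in intvec d1) cell w = setT.
Proof.
apply/seteqP; split => // x _; exists (floor_cV (usubmx (invmx A *m x))).
  exact: floor_cV_intvec.
exact: cube_sub_floor.
Qed.

Lemma cell_translate w x z : intvec d1 w -> intvec d1 z -> cell w x -> cell w (x + tau z) -> z = 0.
Proof.
rewrite /cell /= mulmxDr /lattice_vec mulKmx// => wZ zZ xw.
rewrite (_ : usubmx _ = usubmx (invmx A *m x) + z); last first.
  by rewrite -[usubmx (_ + _)]/(usubmx (_ + _)) linearD/= col_mxKu.
rewrite -addrA -opprB => xzw.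
have := intvec_floor_unique (intvecB wZ zZ) xzw.
by rewrite -(intvec_floor_unique wZ xw) -[RHS]subr0 => /addrI/oppr_inj.
Qed.

Lemma packing_cell w : intvec d1 w -> packing A (cell w).
Proof.
move=> wZ; rewrite /packing; apply: aeW => p z z' zZ zZ' Oz Oz'.
suff /eqP : z' - z = 0 by rewrite subr_eq0 => /eqP.
apply: (cell_translate wZ _ Oz); first exact: intvecB.
by rewrite -lattice_pointD addrC subrK.
Qed.

(** The space is a countable union of parts of finite measure of the cells. *)
Lemma negligible_cells C : (forall w F, intvec d1 w -> measurable F -> (L F < +oo)%E ->
  L (C `&` cell w `&` F) = 0%E) -> measurable C -> L.-negligible C.
Proof.
move=> C0 mC.
have /sigma_finiteP[F [FT _ Foo]] := sigma_finiteT L.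
pose G (v : V) := C `&` [set x | cube (usubmx (invmx A *m x) - usubmx v)].
apply: (@negligibleS _ _ _ _ (\bigcup_(w in intvec d1) G (col_mx w 0))).
  move=> x Cx; have : setT x by []. 
  by rewrite -bigcup_cell => -[w wZ cx]; exists w => //; split => //=; rewrite col_mxKu.
apply: negligible_bigcup_intvec => w wZ; rewrite /G col_mxKu -/(cell w).
apply: (@negligibleS _ _ _ _ (\bigcup_i (C `&` cell w `&` F i))).
  by move=> x Cx; have : setT x by []; rewrite FT => -[i _ Fx]; exists i.
apply: negligible_bigcup => i; have [mF Fi] := Foo i.
apply/negligibleP; last exact: C0.
by apply: measurableI => //; apply: measurableI => //; exact: measurable_cell.
Qed.

End lattice_cells.

(** * From the isometry and the density to tiling *)

Section fourier_conditions.
Variables (R : realType) (d1 d2 : nat) (A : 'M[R]_(d1 + d2)).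
Hypothesis unitA : A \in unitmx.
Local Notation d := (d1 + d2)%N.
Local Notation V1 := 'cV[R]_d1.
Local Notation V2 := 'cV[R]_d2.
Local Notation V := 'cV[R]_d.
Local Notation L := (lebesgue_cV R d).
Local Notation theta := (lattice_point A).
Local Notation Psi := (dual_point A).
Local Notation tau := (lattice_vec A).
Local Notation mu := (transpose_measure unitA (intvec_lebesgue d1 d2)).
Local Notation FT := (transform L (@fker R d)).
Implicit Types (f g : V -> R[i]) (O E : set V).

Definition supported_L12 O f :=
  [/\ cint L f, (N2 L f < +oo)%E & forall x, ~ O x -> f x = 0].

Definition isometric_on O := forall f, supported_L12 O f -> N2 mu (FT f) = N2 L f.

Definition dense_on O := forall g, cmeas g -> (N2 mu g < +oo)%E ->
  forall e : R, 0 < e -> exists2 f, supported_L12 O f &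
    (N2 mu (fun l => FT f l - g l)%R < e%:E)%E.

Lemma supported_L12S O O' f : O `<=` O' -> supported_L12 O f -> supported_L12 O' f.
Proof. by move=> OO [fi foo fO]; split => // x nO; apply: fO => /OO. Qed.

Lemma supported_L12B O f g : supported_L12 O f -> supported_L12 O g ->
  supported_L12 O (fun x => f x - g x).
Proof.
move=> [fi foo fO] [gi goo gO]; split; first exact: cintB.
  apply: N2D_lty; [exact: fi.1|exact: (cintN gi).1|exact: foo|by rewrite N2N].
by move=> x nO; rewrite fO// gO// subr0.
Qed.

Lemma FTB f g l : cint L f -> cint L g -> FT (fun x => f x - g x) l = FT f l - FT g l.
Proof.
move=> fi gi; have H h : cint L h -> cint L (fun x => h x * fker (x, l)).
  move=> hi; apply: (@cintM_bounded _ _ _ _ _ _ 1) => //.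
    exact: (cmeas_fst l (@cmeas_fker R d)).
  by move=> x; rewrite unimodular_fker.
rewrite /transform -cintegralB; [|exact: H|exact: H].
by congr cintegral; apply/funext => x; rewrite mulrBl.
Qed.

(** Written as a truncated constant, in the form of the truncation lemmas
    above. *)
Definition cindic E (x : V) : R[i] := Complex (\1_E x) 0 * 1.

Lemma cindicE E x : cindic E x = if x \in E then 1 else 0.
Proof. by rewrite /cindic mulr1 indicE; case: (x \in E). Qed.

Lemma supported_cindic E : measurable E -> (L E < +oo)%E -> supported_L12 E (cindic E).
Proof.
move=> mE Eoo; have b1 (x : V) : normc (1 : R[i]) <= 1.
  by rewrite -[1]/(Complex 1 0 : R[i]) normc_real normr1.
have m1 : cmeas (fun _ : V => 1 : R[i]) := cmeas_cst _ 1.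
split; [exact: (cint_indic mE Eoo m1 b1)|exact: (N2_indic_lty mE Eoo m1 b1)|].
by move=> x nE; rewrite cindicE memNset.
Qed.

Lemma le_N2_indic E f : measurable E -> cmeas f ->
  (forall x, E x -> normc (f x) = 1) -> (L E <= N2 L f)%E.
Proof.
move=> mE mf f1; rewrite (measure_integral_indic L mE); apply: ge0_le_integral => //.
- exact: measurable_indic_EFin.
- by apply/measurable_EFinP; exact: measurable_sqr_normc.
move=> x _; rewrite lee_fin indicE; have [xE|xE] := pselect (E x).
  by rewrite mem_set// f1// expr1n.
by rewrite memNset// sqr_ge0.
Qed.

(** The translation multiplies the transform by the value of a character of the
    dual set at a lattice vector, which is 1. *)
Lemma FT_translate E z (l : V1 * V2) : measurable E -> (L E < +oo)%E ->
  intvec d1 z -> intvec d1 l.1 ->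
  FT (cindic (translate E (- tau z))) (Psi l) = FT (cindic E) (Psi l).
Proof.
move=> mE Eoo zZ lZ; pose h x := cindic E x * fker (x - tau z, Psi l).
have ker1 : fker (- tau z, Psi l) = 1.
  have -> : - tau z = theta ((0, 0), - z).
    by rewrite /lattice_point/= add0r /lattice_vec -mulmxN opp_col_mx oppr0.
  rewrite fker_dual_lattice//=; last exact: intvecN.
  rewrite /slab_kernel/= /fker/= /col_pair/= col_mx0 dot0r.
  by rewrite mulr0 oppr0 cis0.
have [[mI _] _ _] := supported_cindic mE Eoo.
transitivity (cintegral L setT h); last first.
  by congr cintegral; apply/funext => x; rewrite /h fkerDl ker1 mulr1.
have mt : measurable_fun setT (fun x : V => x + tau z).
  by apply: measurable_addmx => //; exact: measurable_cst.
have tE D : measurable D -> L D = L ((fun x : V => x + tau z) @^-1` D).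
  move=> mD; rewrite -(lebesgue_translate (- tau z) mD) translateE.
  by congr (L _); apply/seteqP; split => x /=; rewrite opprK.
have mh : cmeas h.
  apply: cmeasM => //; apply: (cmeas_comp _ (cmeas_fst (Psi l) (@cmeas_fker R d))).
  by apply: measurable_addmx => //; exact: measurable_cst.
rewrite (cintegral_transport mt tE mh) /transform; congr cintegral.
apply/funext => x; rewrite /h /= addrK; congr (_ * _).
rewrite !cindicE translateE; congr (if _ then _ else _).
by apply/idP/idP; rewrite !inE/= opprK.
Qed.

(** Let [E] be a part of the overlap in one cell, of finite measure. Both [E]
    and [E'], its translate by the opposite of the lattice vector, lie in [O]
    and they are disjoint. The transform of the difference of their indicators
    vanishes on the dual set, so that the isometry makes [E] null. *)
Lemma isometric_no_overlap O : measurable O -> isometric_on O -> no_overlap A O.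
Proof.
move=> mO iO z zZ z0; have mW : measurable (O `&` translate O (tau z)).
  by apply: measurableI => //; exact: measurable_translate.
apply: (@negligible_cells R d1 d2 A _ _ mW) => w F wZ mF Foo.
set E := _ `&` F.
have mE : measurable E.
  by apply: measurableI => //; apply: measurableI => //; exact: measurable_cell.
have Eoo : (L E < +oo)%E.
  by apply: le_lt_trans Foo; apply: le_measure; rewrite ?inE//; exact: subIsetr.
pose E' := translate E (- tau z).
have mE' : measurable E' by exact: measurable_translate.
have E'oo : (L E' < +oo)%E by rewrite lebesgue_translate.
have EO : E `<=` O by move=> x [[[]]].
have E'O : E' `<=` O.
  move=> x; rewrite /E' translateE /= opprK => -[[[_]]].
  by rewrite translateE /= addrK.
have sE := supported_cindic mE Eoo; have sE' := supported_cindic mE' E'oo.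
have sf := supported_L12B (supported_L12S EO sE) (supported_L12S E'O sE').
have fi : cint L (fun x => cindic E x - cindic E' x) by have [] := sf.
have [Ei _ _] := sE; have [E'i _ _] := sE'.
have F0 : N2 mu (FT (fun x => cindic E x - cindic E' x)) = 0%E.
  have mFT : cmeas (FT (fun x => cindic E x - cindic E' x)).
    by apply: cmeas_transform; [exact: cmeas_fker|exact: fi.1].
  rewrite N2_dual//.
  rewrite (@ae_eq_N2 _ _ _ _ _ (fun=> 0)).
  - rewrite /N2; under eq_integral do rewrite ComplexField.Normc.normc0 expr0n.
    by rewrite integral0 mule0.
  - exact: (cmeas_comp (measurable_dual_point A) mFT).
  - exact: cmeas_cst.
  apply: filterS (ae_prodm_fst (lebesgue_cV R d2) (@ae_intvec R d1)) => l lZ.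
  by rewrite FTB// FT_translate// subrr.
apply/eqP; rewrite eq_le measure_ge0 andbT -F0 (iO _ sf).
apply: le_N2_indic => //; first exact: fi.1.
move=> x Ex; rewrite !cindicE mem_set// memNset.
  by rewrite subr0 -[1]/(Complex 1 0 : R[i]) normc_real normr1.
rewrite /E' translateE /= opprK => -[[_ c1] _]; have [[_ c2] _] := Ex.
by move/eqP : z0; apply; exact: cell_translate c2 c1.
Qed.

(** Let [E] be a part of the gap in one cell, of finite measure. The translates
    of the union of [O] and [E] do not overlap, so that the transform is
    isometric there. For every [g] supported in [O], the function [g - cindic
    E] has modulus 1 on [E]: its squared norm is at least the measure of [E],
    which therefore bounds from below the distance of the transform of [cindic
    E] to those of functions on [O]. *)
Lemma dense_no_gap O : measurable O -> packing A O -> dense_on O -> no_gap A O.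
Proof.
move=> mO pO dO; set U := \bigcup_(z in intvec d1) translate O (tau z).
have mU : measurable U.
  pose e (k : 'cV[int]_d1) : V1 := map_mx intr k.
  have -> : U = \bigcup_(k in [set: 'cV[int]_d1]) translate O (tau (e k)).
    apply/seteqP; split => x [z zZ Ox].
      have /choice[k Hk] : forall i, exists a : int, z i ord0 = a%:~R.
        by move=> i; apply/intrP; exact: zZ.
      exists (\col_i k i) => //; suff -> : e (\col_i k i) = z by [].
      by apply/matrixP => i j; rewrite !mxE ord1 -Hk.
    by exists (e z) => // i; rewrite mxE; exact: intr_int.
  apply: countable_bigcupT_measurable => [|k]; first exact: countableP.
  exact: measurable_translate.
apply: (@negligible_cells R d1 d2 A); last exact: measurableC.
move=> w F wZ mF Foo; set E := _ `&` F.
have mE : measurable E.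
  apply: measurableI => //; apply: measurableI; [exact: measurableC|exact: measurable_cell].
have Eoo : (L E < +oo)%E.
  by apply: le_lt_trans Foo; apply: le_measure; rewrite ?inE//; exact: subIsetr.
apply: contrapT => E0.
have Egt0 : (0 < L E)%E by rewrite lt0e measure_ge0 andbT; apply/eqP.
have Efin : L E \is a fin_num by rewrite ge0_fin_numE.
have sE := supported_cindic mE Eoo; have [Ei E2 EE] := sE.
have EO x : E x -> ~ O x.
  move=> [[nU _] _] Ox; apply: nU; exists 0; first exact: intvec0.
  by rewrite /lattice_vec col_mx0 mulmx0 translateE /= subr0.
have pE : packing A E.
  move: (packing_cell unitA wZ); rewrite /packing; apply: filterS => p cp z z' zZ zZ'.
  by move=> [[_ c1] _] [[_ c2] _]; exact: cp.
have EO_disjoint p z z' : intvec d1 z -> intvec d1 z' ->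
    O (theta (p, z)) -> ~ E (theta (p, z')).
  move=> zZ zZ' Oz [[nU _] _]; apply: nU; exists (z' - z); first exact: intvecB.
  rewrite translateE /=; suff -> : theta (p, z') = theta (p, z) + tau (z' - z).
    by rewrite addrK.
  by rewrite -lattice_pointD addrC subrK.
have pOE : packing A (O `|` E).
  move: pO pE; rewrite /packing; apply: filterS2 => p Op Ep z z' zZ zZ'.
  move=> [Oz|Ez] [Oz'|Ez']; [exact: Op| | |exact: Ep].
  - by have := EO_disjoint p z z' zZ zZ' Oz.
  - by have := EO_disjoint p z' z zZ' zZ Oz'.
have mFT : cmeas (FT (cindic E)).
  by apply: cmeas_transform; [exact: cmeas_fker|exact: Ei.1].
have FToo : (N2 mu (FT (cindic E)) < +oo)%E.
  by rewrite (N2_FT_packing unitA Ei E2 EE pE).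
have Ee : 0 < fine (L E) by rewrite fine_gt0// Egt0.
have [g sg] := dO _ mFT FToo _ Ee.
have [gi goo gO] := sg.
have sf := supported_L12B (supported_L12S (@subsetUl _ O E) sg)
  (supported_L12S (@subsetUr _ O E) sE).
have [fi foo fO] := sf.
rewrite fineK//; apply/negP; rewrite -leNgt.
have -> : (fun l => FT g l - FT (cindic E) l) = FT (fun x => g x - cindic E x).
  by apply/funext => l; rewrite FTB.
rewrite (N2_FT_packing unitA fi foo fO pOE).
apply: le_N2_indic => //; first exact: fi.1.
move=> x Ex; rewrite gO; last exact: EO.
rewrite cindicE mem_set// sub0r -[- 1]/(Complex (- 1) (- 0) : R[i]) oppr0.
by rewrite normc_real normrN1.
Qed.

End fourier_conditions.

(** * The transfer to Lebesgue measurable sets *)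

Section poweR_half.
Variable R : realType.
Implicit Types x y : \bar R.
Local Open Scope ereal_scope.

Lemma poweR_half_sqr x : 0 <= x -> (x `^ 2^-1) `^ 2 = x.
Proof. by move=> x0; rewrite -poweRrM mulVf// poweRe1. Qed.

Lemma poweR_half_inj x y : 0 <= x -> 0 <= y -> x `^ 2^-1 = y `^ 2^-1 -> x = y.
Proof. by move=> x0 y0 xy; rewrite -(poweR_half_sqr x0) xy poweR_half_sqr. Qed.

Lemma poweR_half_lt x (e : R) : 0 <= x -> (0 < e)%R ->
  (x `^ 2^-1 < e%:E) = (x < (e ^+ 2)%:E).
Proof.
move=> x0 e0; rewrite poweR12_sqrt//; case: x x0 => [x x0||]//=.
rewrite !lte_fin -(ltr_pXn2r (n:=2))// ?nnegrE ?sqrtr_ge0 ?(ltW e0)//.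
by rewrite sqr_sqrtr.
Qed.

End poweR_half.

Section transfer.
Variables (R : realType) (d1 d2 : nat) (A : 'M[R]_(d1 + d2)).
Hypothesis unitA : A \in unitmx.
Local Notation d := (d1 + d2)%N.
Local Notation V := 'cV[R]_d.
Local Notation L := (lebesgue_cV R d).
Local Notation tau := (lattice_vec A).
Local Notation mu := (transpose_measure unitA (intvec_lebesgue d1 d2)).
Local Notation FT := (transform L (@fker R d)).
Local Notation CT := (caratheodory_type (L^*)%mu).
Variables (Omega Omega0 : set V).
Hypothesis mOmega : lebesgue_measurable Omega.
Hypothesis mOmega0 : measurable Omega0.
Hypothesis Omega0S : Omega0 `<=` Omega.
Hypothesis Omega0_conull : L.-negligible (Omega `\` Omega0).
Implicit Types f g : V -> R[i].

(** Removing from [Omega] a null set changes its countably many translates by a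
    null set only. *)
Lemma tiles_coreP : tiles Omega (lattice A) <-> no_overlap A Omega0 /\ no_gap A Omega0.
Proof.
split=> [[gap over]|[over gap]]; split.
- move=> z zZ z0.
  apply: (@negligibleS _ _ _ _ (translate Omega 0 `&` translate Omega (tau z))).
    move=> x; rewrite !translateE /= subr0 => -[Ox Oxz].
    by split; exact: Omega0S.
  apply/negligible_completion/over.
  - by exists 0; [exact: intvec0|rewrite col_mx0 mulmx0].
  - by exists z.
  - rewrite eq_sym; apply: contra_neq z0; exact: lattice_vec_eq0.
- apply: (@negligibleS _ _ _ _ ((~` \bigcup_(t in lattice A) translate Omega t) `|`
    \bigcup_(z in intvec d1) translate (Omega `\` Omega0) (tau z))).
    move=> x nx; have [[_ [z zZ <-]]|] :=
      pselect ((\bigcup_(t in lattice A) translate Omega t) x); last by left.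
    rewrite translateE => Ox; right; exists z => //; rewrite translateE; split => // O0x.
    by apply: nx; exists z => //; rewrite translateE.
  apply: negligibleU; first exact/negligible_completion.
  apply: (@negligible_bigcup_intvec R d (translate (Omega `\` Omega0)) d1 tau) => z _.
  exact: negligible_translate.
- apply/negligible_completion; move: gap; rewrite /no_gap; apply: negligibleS => x nx [z zZ].
  rewrite translateE => Ox; apply: nx; exists (tau z); first by exists z.
  by rewrite translateE; exact: Omega0S.
move=> _ _ [z1 z1Z <-] [z2 z2Z <-] z12; apply/negligible_completion.
rewrite translateB; apply: negligible_translate.
have tE : A *m col_mx z2 0 - A *m col_mx z1 0 = tau (z2 - z1).
  by rewrite /lattice_vec -mulmxN -mulmxDr opp_col_mx add_col_mx subr0.
rewrite tE.
apply: (@negligibleS _ _ _ _ ((Omega0 `&` translate Omega0 (tau (z2 - z1))) `|`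
  ((Omega `\` Omega0) `|` translate (Omega `\` Omega0) (tau (z2 - z1))))).
  move=> x; rewrite !translateE /= => -[Ox Oxt].
  have [xO|xO] := pselect (Omega0 x); last by right; left.
  have [xtO|xtO] := pselect (Omega0 (x - tau (z2 - z1))); last by right; right.
  by left.
apply: negligibleU; last first.
  by apply: negligibleU => //; exact: negligible_translate.
apply: over; first exact: intvecB.
by rewrite subr_eq0; apply: contra_neq z12 => ->.
Qed.

Let cmeas_shift f l : cmeas f -> cmeas (fun x => f x * fker (x, l)).
Proof. by move=> mf; apply: cmeasM => //; exact: (cmeas_fst l (@cmeas_fker R d)). Qed.

Section same_ae.
Variables f g : V -> R[i].
Hypothesis mf : @cmeasurable_fun _ CT R Omega f.
Hypothesis mg : cmeas g.
Hypothesis gO : forall x, ~ Omega x -> g x = 0.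
Hypothesis fg : {ae (@lebesgue R d), forall x : CT, Omega x -> f x = g x}.

Let fourier_same : fourier Omega f = FT g.
Proof.
apply/funext => l; apply: (@cintegral_completion _ _ R L Omega mOmega
  (fun x => f x * fker (x, l)) (fun x => g x * fker (x, l))).
- apply: cmeasM => //.
  exact: (@cmeas_completion _ _ R L Omega _ (cmeas_fst l (@cmeas_fker R d))).
- exact: cmeas_shift.
- by move=> x nx; rewrite gO// mul0r.
- by apply: filterS fg => x fgx Ox; rewrite fgx.
Qed.

Let norm_same := integral_normc_completion mOmega mf mg gO fg.

Let L1L2_same : L1L2 Omega f <-> cint L g /\ (N2 L g < +oo)%E.
Proof.
rewrite /L1L2 /cLp !norm_same//; split=> [[[_ g1] [_ g2]]|[[_ g1] g2]].
  by split => //; split => //; move: g1; under eq_integral do rewrite expr1.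
by split; split => //; under eq_integral do rewrite expr1.
Qed.

Let cL2norm_same : cL2norm lebesgue Omega f = (N2 L g `^ 2^-1)%E.
Proof. by rewrite /cL2norm norm_same. Qed.

(** All the quantities in the definition of the pair measure depend on [f] only
    through an almost everywhere equal Borel function. *)
Lemma same_aeP : [/\ fourier Omega f = FT g,
  cL2norm lebesgue Omega f = (N2 L g `^ 2^-1)%E &
  L1L2 Omega f <-> cint L g /\ (N2 L g < +oo)%E].
Proof. by split; [exact: fourier_same|exact: cL2norm_same|exact: L1L2_same]. Qed.

End same_ae.

Let L1L2_representative f : L1L2 Omega f -> exists g, [/\ supported_L12 Omega0 g,
  fourier Omega f = FT g & cL2norm lebesgue Omega f = (N2 L g `^ 2^-1)%E].
Proof.
move=> fL; have [[mf _] _] := fL.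
have [g [mg gO fg]] := borel_representative mOmega mOmega0 Omega0S Omega0_conull mf.
have gO' x : ~ Omega x -> g x = 0 by move=> nx; apply: gO => /Omega0S.
have [fE nE /iffLR/(_ fL)[gi goo]] := same_aeP mf mg gO' fg.
by exists g; split.
Qed.

Let supported_L1L2 g : supported_L12 Omega0 g -> [/\ L1L2 Omega g,
  fourier Omega g = FT g & cL2norm lebesgue Omega g = (N2 L g `^ 2^-1)%E].
Proof.
move=> [gi goo gO].
have gO' x : ~ Omega x -> g x = 0 by move=> nx; apply: gO => /Omega0S.
have [fE nE /iffRL gL] := same_aeP (@cmeas_completion _ _ R L Omega _ gi.1) gi.1 gO'
  (aeW _ (fun x _ => erefl)).
by split => //; exact: gL.
Qed.

Lemma pair_measure_coreP : pair_measure Omega mu <->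
  isometric_on unitA Omega0 /\ dense_on unitA Omega0.
Proof.
split=> [[_ _ iO dO]|[iO dO]].
  split=> [g sg|g mg goo e e0].
    have [gL fE nE] := supported_L1L2 sg; have := iO _ gL; rewrite nE /cL2norm fE.
    by apply: poweR_half_inj; exact: N2_ge0.
  have se0 : 0 < Num.sqrt e by rewrite sqrtr_gt0.
  have [f fL fg] := dO g (conj mg goo) _ se0.
  have [h [sh fE _]] := L1L2_representative fL; exists h => //.
  move: fg; rewrite /cL2norm fE poweR_half_lt//; last exact: N2_ge0.
  by rewrite sqr_sqrtr// ltW.
split; first exact: radon_dual_measure.
- move=> f /L1L2_representative[g [sg -> _]]; have [gi goo _] := sg; split.
    by apply: cmeas_transform; [exact: cmeas_fker|exact: gi.1].
  by have := iO _ sg; rewrite /N2 => ->.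
- move=> f /L1L2_representative[g [sg -> ->]]; rewrite -(iO _ sg).
  by [].
move=> g [mg goo] e e0; have e20 : 0 < e ^+ 2 by rewrite exprn_gt0.
have [h sh hg] := dO g mg goo _ e20; have [hL hE _] := supported_L1L2 sh.
exists h => //; rewrite /cL2norm hE poweR_half_lt//; exact: N2_ge0.
Qed.

Lemma tiles_pair_measure : tiles Omega (lattice A) <-> pair_measure Omega mu.
Proof.
rewrite tiles_coreP pair_measure_coreP; split=> [[over gap]|[iO dO]].
  have pO := no_overlap_packing unitA over; have cO := no_gap_covering unitA gap.
  split=> [f [fi foo fO]|g mg goo e e0]; first exact: N2_FT_packing pO.
  have [f [fi foo fO fg]] := FT_dense mOmega0 pO cO mg goo e0.
  by exists f.
have over := isometric_no_overlap mOmega0 iO; split => //.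
exact: (dense_no_gap mOmega0 (no_overlap_packing unitA over) dO).
Qed.

End transfer.

(** * The support of the pair measure *)

Section support.
Variables (R : realType) (d1 d2 : nat) (A : 'M[R]_(d1 + d2)).
Hypothesis unitA : A \in unitmx.
Local Notation d := (d1 + d2)%N.
Local Notation V := 'cV[R]_d.
Local Notation mu := (transpose_measure unitA (intvec_lebesgue d1 d2)).

Lemma dual_set_lattice (l : V) :
  intvec d1 (usubmx (A^T *m l)) -> dual_set (lattice A) l.
Proof.
move=> lZ _ [z zZ <-].
have lE : l = dual_point A (usubmx (A^T *m l), dsubmx (A^T *m l)).
  by rewrite /dual_point /col_pair /= vsubmxK mulKmx// unitmx_tr.
have -> : A *m col_mx z 0 = lattice_point A ((0, 0), z).
  by rewrite /lattice_point /= add0r.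
rewrite {1}lE (dot_dual_lattice unitA) /col_pair/= dot_col_mx dot0r addr0 add0r.
exact: dot_intvec.
Qed.

Lemma dual_measure_support : supported_on mu (dual_set (lattice A)).
Proof.
pose B := [set l : V | ~ intvec d1 (usubmx (A^T *m l))].
have mB : measurable B.
  rewrite -[X in measurable X]setTI.
  have mA : measurable_fun setT (fun l : V => usubmx (A^T *m l)).
    apply: measurable_fun_mx => i j; under eq_fun do rewrite mxE.
    exact: (measurableT_comp (measurable_coord _ _) (measurable_mulmx A^T)).
  apply: (mA measurableT (~` intvec d1)); apply: measurableC.
  exact: measurable_intvec.
exists B; split => //; last first.
  by move=> l nl lZ; apply: nl; exact: dual_set_lattice.
apply: etrans (measure_integral_indic mu mB) _.
rewrite ge0_integral_dual//; last exact: measurable_indic_EFin.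
rewrite (ge0_ae_eq_integral (g := fun=> 0%E)) ?integral0 ?mule0//.
- exact: (measurableT_comp (measurable_indic_EFin mB) (measurable_dual_point A)).
- apply: filterS (ae_prodm_fst (lebesgue_cV R d2) (@ae_intvec R d1)) => l lZ _.
  rewrite indicE memNset// /B /= /dual_point mulKVmx ?unitmx_tr//.
  by rewrite /col_pair col_mxKu; apply.
Qed.

End support.

Theorem theorem5p8 (R : realType) (d1 d2 : nat) (Omega : set 'cV[R]_(d1 + d2))
    (mOmega : lebesgue_measurable Omega)
    (A : 'M[R]_(d1 + d2)) (unitA : A \in unitmx) :
  (tiles Omega (lattice A) <->
     pair_measure Omega (transpose_measure unitA (intvec_lebesgue d1 d2))) /\
  supported_on (transpose_measure unitA (intvec_lebesgue d1 d2))
    (dual_set (lattice A)).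
Proof.
split; last exact: dual_measure_support.
have [B [mB BS B_conull]] := inner_core_completion mOmega.
exact: tiles_pair_measure mOmega mB BS B_conull.
Qed.
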